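(* Let $2<p<\infty$ and let $X$ be a closed subspace of $L_p$. Then the following conditions on $X$ are equivalent: (i) $X$ contains no subspace isomorphic to $\ell_2$. (ii) $X$ is isomorphic to a subspace of $\ell_p$. (iii) For any $\varepsilon>0$ there is a subspace $X_0$ of $\ell_p$ such that $d(X_0,X)<1+\varepsilon$.
   Context: $L_p$ is a separable nonatomic $L_p(\mu)$-space with $\mu$ a probability measure on a compact metric space (it is isometric to $L_p[0,1]$). $d(X,Y)=\inf\|T\|\,\|T^{-1}\|$, over all surjective isomorphisms $T:X\to Y$, is the Banach–Mazur distance. *)

(* Defs.v *)
From HB Require Import structures.
From mathcomp Require Import all_boot all_order all_algebra.
From mathcomp Require Import all_classical all_reals all_analysis.
From mathcomp Require Import measurable_realfun ess_sup_inf.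

Set Implicit Arguments.
Unset Strict Implicit.
Unset Printing Implicit Defensive.
Import Order.TTheory GRing.Theory Num.Theory.
Import numFieldNormedType.Exports.

Local Open Scope classical_set_scope.
Local Open Scope ring_scope.

Section Lspace_normed.
Context d (T : measurableType d) (R : realType).
Variables (mu : {measure set T -> \bar R}) (p : \bar R) (p1 : (1 <= p)%E).

Lemma ae_eq_Lnorm (f g : {mfun T >-> R}) : f = g %[ae mu] ->
  ('N[mu]_p[EFin \o f] = 'N[mu]_p[EFin \o g])%E.
Proof.
move=> fg; rewrite unlock; case: p p1 => [r _|_|//].
- have mX (h : {mfun T >-> R}) :
      measurable_fun setT ((fun x => `|(EFin \o h) x| `^ r)%E : T -> \bar R).
    apply: (measurableT_comp (measurable_poweR _)) => //.
    by apply: measurableT_comp => //; exact/measurable_EFinP.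
  congr (_ `^ _)%E; apply: ge0_ae_eq_integral => //.
  + by move=> x _; rewrite poweR_ge0.
  + by move=> x _; rewrite poweR_ge0.
  + by move: fg; apply: filterS => x /(_ I)/= ->.
- case: ifPn => // _; apply: eq_ess_sup.
  by move: fg; apply: filterS => x /(_ I)/= ->.
Qed.


Lemma Lspace_mfun (f : LspaceType mu p1) : (f : T -> R) \in @mfun _ _ T R.
Proof.
apply/mem_set.
exact: (@measurable_funPT _ _ _ _ (repr (LebesgueSpace.sort f))).
Qed.

Lemma Lspace_Lfun (f : LspaceType mu p1) : (f : T -> R) \in Lfun mu p.
Proof.
by apply/andP; split; [exact: Lspace_mfun|exact/mem_set/Lebesgue_finite].
Qed.

(* A representative of the class f. *)
Definition Lrepr (f : LspaceType mu p1) : LfunType mu p1 :=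
  Lfun_Sub p1 (Lspace_Lfun f).


(* R and measurableTypeR R have the same measurable sets but different
   displays, so that {mfun T >-> R} and {mfun T >-> measurableTypeR R} are
   different types. *)
Section mfun_measurableTypeR.
Variable f : {mfun T >-> R}.
Let g : T -> measurableTypeR R := f.
Let mg : measurable_fun setT g.
Proof. exact: (@measurable_funPT _ _ _ _ f). Qed.
HB.instance Definition _ := isMeasurableFun.Build _ _ _ _ g mg.
Definition mfunR : {mfun T >-> measurableTypeR R} := g.
End mfun_measurableTypeR.

Local Notation Q := {mfun_ mu, T >-> measurableTypeR R}.

Let repr_pi (f : {mfun T >-> R}) :
  (repr (\pi_Q%qT (mfunR f)) : T -> R) = f %[ae mu].
Proof.
have /eqP := reprK (\pi_Q%qT (mfunR f)).
by rewrite eqmodE => /asboolP.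
Qed.

Lemma LspaceP (f g : LspaceType mu p1) :
  (f : T -> R) = g %[ae mu] -> f = g.
Proof.
move=> fg.
have : LebesgueSpace.sort f = LebesgueSpace.sort g.
  rewrite -[LHS]reprK -[RHS]reprK.
  by apply/eqP; rewrite eqmodE; apply/asboolP.
move: f g {fg} => [f [[ff]]] [g [[fg]]]/= fE.
by case: _ / fE in fg *; congr LebesgueSpace.Pack; congr LebesgueSpace.Class;
  congr isFinLebesgue.Axioms_; exact: bool_irrelevance.
Qed.

Section class.
Variable f : LfunType mu p1.
Let h : Q := \pi_Q%qT (mfunR f).
Let hfin : finite_norm mu p h.
Proof.
rewrite /finite_norm.
have hR : measurable_fun [set: T] (repr h : T -> R).
  exact: (@measurable_funPT _ _ _ _ (repr h)).
pose h' : {mfun T >-> R} := @MeasurableFun.Pack _ _ _ _ _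
  (MeasurableFun.Class (isMeasurableFun.Build _ _ _ _ _ hR)).
rewrite -[X in (X < _)%E]/('N[mu]_p[EFin \o h'])%E (@ae_eq_Lnorm h' f);
  last exact: repr_pi.
exact: Lfunction_finite.
Qed.
HB.instance Definition _ := isFinLebesgue.Build _ _ _ _ _ p1 h hfin.
Definition Lclass : LspaceType mu p1 := h.
End class.

Lemma LclassK (f : LfunType mu p1) : (Lclass f : T -> R) = f %[ae mu].
Proof. exact: repr_pi. Qed.

Lemma LreprK : cancel Lrepr Lclass.
Proof. by move=> f; apply: LspaceP; exact: LclassK. Qed.

Lemma eq_Lclass (f g : LfunType mu p1) :
  (f : T -> R) = g %[ae mu] -> Lclass f = Lclass g.
Proof.
move=> fg; apply: LspaceP.
apply: ae_eq_trans (LclassK f) _; apply: ae_eq_trans fg _.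
exact/ae_eq_sym/LclassK.
Qed.

HB.instance Definition _ := gen_eqMixin (LspaceType mu p1).
HB.instance Definition _ := gen_choiceMixin (LspaceType mu p1).

Let L := LspaceType mu p1.
Implicit Types f g : L.

Let add f g : L := Lclass (Lrepr f + Lrepr g).
Let opp f : L := Lclass (- Lrepr f).
Let scale (a : R) f : L := Lclass (a *: Lrepr f).

Let LclassD (f g : LfunType mu p1) :
  Lclass (f + g) = add (Lclass f) (Lclass g).
Proof.
apply: eq_Lclass => /=.
have := LclassK f; have := LclassK g; apply: filterS2 => x /(_ I) gE /(_ I) fE _ /=.
exact: (esym (congr2 +%R fE gE)).
Qed.

Let LclassZ a (f : LfunType mu p1) : Lclass (a *: f) = scale a (Lclass f).
Proof.
apply: eq_Lclass => /=.
have := LclassK f; apply: filterS => x /(_ I) fE _ /=.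
exact: (esym (congr1 ( *%R a) fE)).
Qed.

Let addA : associative add.
Proof.
move=> f g h; rewrite -(LreprK f) -(LreprK g) -(LreprK h).
by rewrite -!LclassD addrA.
Qed.
Let addC : commutative add.
Proof. by move=> f g; rewrite /add addrC. Qed.
Let add0 : left_id (Lclass 0) add.
Proof. by move=> f; rewrite -(LreprK f) -LclassD add0r. Qed.
Let addN : left_inverse (Lclass 0) opp add.
Proof. by move=> f; rewrite -{2}(LreprK f) -LclassD addNr. Qed.

HB.instance Definition _ := GRing.isZmodule.Build (LspaceType mu p1)
  addA addC add0 addN.

Let classD (f g : LfunType mu p1) : Lclass (f + g) = Lclass f + Lclass g.
Proof. exact: LclassD. Qed.

Let scaleA a b f : scale a (scale b f) = scale (a * b) f.
Proof. by rewrite -(LreprK f) -!LclassZ scalerA. Qed.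
Let scale1 : left_id 1 scale.
Proof. by move=> f; rewrite -(LreprK f) -LclassZ scale1r. Qed.
Let scaleDr : right_distributive scale +%R.
Proof.
move=> a f g; rewrite -(LreprK f) -(LreprK g).
by rewrite -classD -!LclassZ -classD scalerDr.
Qed.
Let scaleDl f : {morph scale^~ f : a b / a + b}.
Proof.
by move=> a b; rewrite -(LreprK f) -!LclassZ -classD scalerDl.
Qed.

HB.instance Definition _ := GRing.Zmodule_isLmodule.Build R (LspaceType mu p1)
  scaleA scale1 scaleDr scaleDl.

Let classZ a (f : LfunType mu p1) : Lclass (a *: f) = a *: Lclass f.
Proof. exact: LclassZ. Qed.

Definition Lspace_norm (f : LspaceType mu p1) : R := fine 'N[mu]_p[EFin \o f].

Let norm_class (f : LfunType mu p1) :
  Lspace_norm (Lclass f) = fine 'N[mu]_p[EFin \o f].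
Proof.
congr fine; have := @ae_eq_Lnorm (Lrepr (Lclass f)) f; apply.
exact: LclassK.
Qed.

Let norm_add f g : Lspace_norm (f + g) <= Lspace_norm f + Lspace_norm g.
Proof.
rewrite -{1}(LreprK f) -{1}(LreprK g) -classD.
rewrite norm_class; exact: ler_LnormD.
Qed.

Let norm_scale a f : Lspace_norm (a *: f) = `|a| * Lspace_norm f.
Proof.
rewrite -{1}(LreprK f) -classZ norm_class.
by apply: EFin_inj; rewrite finite_norm_fine LnormZ EFinM -finite_norm_fine.
Qed.

Let norm_eq0 f : Lspace_norm f = 0 -> f = 0.
Proof.
move=> f0; rewrite -(LreprK f); apply: eq_Lclass.
exact: (@fine_Lnormr_eq0 _ _ _ mu p p1 (Lrepr f)).
Qed.

HB.instance Definition _ := Lmodule_isNormed.Build R (LspaceType mu p1)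
  norm_add norm_scale norm_eq0.

Lemma Lspace_normE (f : LspaceType mu p1) :
  `|f|%:E = ('N[mu]_p[EFin \o (f : T -> R)])%E.
Proof. exact: (finite_norm_fine (Lrepr f)). Qed.

Lemma Lspace_addE f g : (f + g : T -> R) = (f : T -> R) \+ g %[ae mu].
Proof. exact: LclassK. Qed.

Lemma Lspace_scaleE a f : (a *: f : T -> R) = (fun x => a * f x) %[ae mu].
Proof. exact: LclassK. Qed.

End Lspace_normed.

Record closed_subspace (R : numFieldType) (V : normedModType R) :=
  ClosedSubspace {
    subspace_carrier : set V ;
    subspace_submod : submod_closed (mem subspace_carrier) ;
    subspace_closed : closed subspace_carrier }.

Section subspace_normed.
Context (R : numFieldType) (V : normedModType R) (X : closed_subspace V).

Definition subspace_pred : {pred V} := mem (subspace_carrier X).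

HB.instance Definition _ :=
  GRing.isSubmodClosed.Build R V subspace_pred (subspace_submod X).

Record subspace_type := SubspaceElt {
  subspace_val :> V ;
  subspace_valP : subspace_val \in subspace_pred }.

HB.instance Definition _ := [isSub for subspace_val].
HB.instance Definition _ := [Choice of subspace_type by <:].
HB.instance Definition _ := [SubChoice_isSubLmodule of subspace_type by <:].

Let norm (x : subspace_type) : R := `|val x|.

Let norm_add x y : norm (x + y) <= norm x + norm y.
Proof. exact: ler_normD. Qed.

Let norm_scale a x : norm (a *: x) = `|a| * norm x.
Proof. exact: normrZ. Qed.

Let norm_eq0 x : norm x = 0 -> x = 0.
Proof. by move/normr0_eq0 => x0; apply: val_inj. Qed.

HB.instance Definition _ :=
  Lmodule_isNormed.Build R subspace_type norm_add norm_scale norm_eq0.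

End subspace_normed.
Coercion subspace_type : closed_subspace >-> Sortclass.

Section isomorphism.
Context (R : realType).
Implicit Types X Y : normedModType R.

Definition opnorm X Y (T : X -> Y) : \bar R :=
  ereal_sup [set `|T x|%:E | x in [set x : X | `|x| <= 1]].

Definition is_isomorphism X Y (T : {linear X -> Y}) (S : {linear Y -> X}) :=
  [/\ continuous T, continuous S, cancel T S & cancel S T].

Definition isomorphic X Y :=
  exists (T : {linear X -> Y}) (S : {linear Y -> X}), is_isomorphism T S.

(* The infimum is +oo when X and Y are not isomorphic. *)
Definition banach_mazur X Y : \bar R :=
  ereal_inf [set (opnorm TS.1 * opnorm TS.2)%E |
    TS in [set TS : {linear X -> Y} * {linear Y -> X} |
           is_isomorphism TS.1 TS.2]].

End isomorphism.

(* g_sigma_algebraType is only measurable over a pointed type, hence the chosen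
   point; a space carrying a probability measure is nonempty anyway. *)
#[short(type="pmetricType")]
HB.structure Definition PointedMetric (K : numDomainType) :=
  { M of Metric K M & isPointed M }.

Definition nonatomic d (T : measurableType d) (R : realType)
    (mu : {measure set T -> \bar R}) :=
  forall A, measurable A -> (0 < mu A)%E ->
  exists B, [/\ measurable B, B `<=` A, (0 < mu B)%E & (mu B < mu A)%E].

Lemma gt2_ge1 (R : realType) (p : R) : 2 < p -> (1 <= p%:E)%E.
Proof. by move=> p2; rewrite lee_fin (le_trans _ (ltW p2))// ler1n. Qed.

Definition Lp d (T : measurableType d) (R : realType)
    (mu : {measure set T -> \bar R}) (p : \bar R) (p1 : (1 <= p)%E) :
  normedModType R := LspaceType mu p1.

(* Negligible sets of the counting measure are empty, so elements of lp are
   sequences. *)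
Definition lp (R : realType) (p : \bar R) (p1 : (1 <= p)%E) :
  normedModType R := Lp (counting : {measure set nat -> \bar R}) p1.

Lemma lp_normE (R : realType) (p : R) (p1 : (1 <= p%:E)%E) (x : lp p1) :
  `|x|%:E = ((\sum_(k <oo)
    `|((x : LspaceType counting p1) : nat -> R) k|%:E `^ p) `^ p^-1)%E.
Proof.
rewrite (Lspace_normE (x : LspaceType counting p1)) Lnorm_counting//.
by rewrite -lte_fin (lt_le_trans _ p1)// lte01.
Qed.

(* Main.v *)
(* If the unit ball of X is not totally bounded for the L_2-norm, pick
   elements of the ball that are large in L_2 and almost annihilated by the
   conditional expectations onto finer and finer finite partitions. They are
   small perturbations of martingale differences; orthogonality in L_2 gives a
   lower l_2-estimate and the 2-smoothness of L_p the upper one, so X contains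
   l_2.

   If it is totally bounded, there are conditional expectations E_k onto finer
   and finer finite partitions such that |x - E_k x|_2 tends to 0 so fast,
   uniformly on the ball, that functions fixed by E_k are almost disjoint from
   all E_m' x - E_m x with k < m <= m'. For an offset j < N, dropping from E_m x
   the increments E_(k+1) x - E_k x with k = j mod N cuts it into almost disjoint
   blocks. By Clarkson's inequality the p-th powers of the norms of all
   increments have bounded sum, so the dropped part is negligible on average
   over the N offsets. Each block lives in a finite-dimensional l_p, and all the
   blocks, scaled by N^(-1/p), embed X almost isometrically into l_p.

   Finally l_2 does not embed into l_p: if U is an isomorphic embedding, the
   coordinates of U e_i tend to 0, so along a sparse sequence the p-th power of
   the norm of the sum of n images grows only linearly, instead of like
   n^(p/2). *)

Require Import Defs.
From HB Require Import structures.
From mathcomp Require Import all_boot all_order all_algebra.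
From mathcomp Require Import all_classical all_reals all_analysis.
From mathcomp Require Import measurable_realfun ring lra.

Set Implicit Arguments.
Unset Strict Implicit.
Unset Printing Implicit Defensive.
Import Order.TTheory GRing.Theory Num.Theory.
Import numFieldNormedType.Exports.

Local Open Scope classical_set_scope.
Local Open Scope ring_scope.

(** * Inequalities between powers *)

(** The obstacle in the second half: nothing makes [E_(k+1) x - E_k x] almost disjoint from the
    functions fixed by [E_k], since the control starts one index later. So one increment has to be
    lost between consecutive blocks. It may carry a fixed part of the norm, and the place where it
    is small depends on x, whereas an embedding must treat all x by one linear rule. Keeping all N
    offsets at once removes the choice: the lost p-th powers of all offsets together stay below
    2^(p-1), independently of N, while about N |x|^p is kept.

    L_2 acts on p-th powers through one estimate: for f bounded by M, the defect of additivity of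
    the p-th powers of the norms of f and r is small up to C times the squared L_2-norm of r. A
    function fixed by a finite partition has its sup bounded by its norm, which makes C uniform.

    In the first half, pigeonhole on finitely many rounded coordinates plays the part of a weakly
    null sequence. Averaging over cells is a contraction for every exponent in [1, p], and its range
    is exactly a finite-dimensional l_p, so the distortion can approach 1. *)

Section power_inequalities.
Context (R : realType).
Implicit Types (p q a b x y : R).

(** Convexity in the form of Young's inequality, for [y] and [x ^ (p - 1)] with exponents p and p /
    (p - 1). At p = 1 the conjugate exponent is infinite, hence the separate case. *)
Lemma powR_tangent p x y : 1 <= p -> 0 <= x -> 0 <= y ->
  x `^ p + p * x `^ (p - 1) * (y - x) <= y `^ p.
Proof.
rewrite le_eqVlt => /predU1P[<-|p1] x0 y0.
  by rewrite subrr powRr0 !powRr1// !mul1r subrKC.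
have p0 : 0 < p by rewrite (lt_trans ltr01).
have q0 : 0 < p / (p - 1) by rewrite divr_gt0 ?subr_gt0.
have := conjugate_powR y0 (powR_ge0 x (p - 1)) p0 q0.
rewrite -powRrM mulrCA divff ?subr_eq0 ?gt_eqF// mulr1 invf_div.
rewrite -{1}(div1r p) -mulrDl subrKC divff ?gt_eqF// => /(_ erefl).
rewrite -(ler_pM2l p0) mulrDr [p * (_ / p)]mulrC divfK ?gt_eqF//.
have -> : p * (x `^ p * ((p - 1) / p)) = (p - 1) * x `^ p.
  by field; rewrite gt_eqF.
have := mulr_powRB1 x0 p0; set u := _ `^ (p - 1) => <-; lra.
Qed.

Lemma powR_lipschitz p m x y : 1 <= p -> 0 <= x <= m -> 0 <= y <= m ->
  `|x `^ p - y `^ p| <= p * m `^ (p - 1) * `|x - y|.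
Proof.
move=> p1; wlog yx : x y / y <= x => [H xm ym|].
  by case: (leP y x) => [|/ltW] yx; [|rewrite distrC (distrC x)]; exact: H.
move=> /andP[x0 xm] /andP[y0 ym].
have m0 := le_trans x0 xm.
have p0 : 0 <= p by rewrite (le_trans ler01).
rewrite !ger0_norm ?subr_ge0//; last by rewrite ge0_ler_powR.
rewrite (@le_trans _ _ (p * x `^ (p - 1) * (x - y)))//.
  have := powR_tangent p1 x0 y0; lra.
rewrite ler_wpM2r ?subr_ge0// ler_wpM2l// ge0_ler_powR ?nnegrE//.
by rewrite subr_ge0.
Qed.

Lemma powR_superadditive q a b : 1 <= q -> 0 <= a -> 0 <= b ->
  a `^ q + b `^ q <= (a + b) `^ q.
Proof.
move=> q1 a0 b0; have q0 : 0 < q by rewrite (lt_le_trans ltr01).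
rewrite -(mulr_powRB1 a0)// -(mulr_powRB1 b0)// -(mulr_powRB1 (addr_ge0 a0 b0))//.
have q10 : 0 <= q - 1 by rewrite subr_ge0.
by rewrite mulrDl lerD// ler_wpM2l// ge0_ler_powR// ?nnegrE ?addr_ge0// ?lerDl ?lerDr.
Qed.

(** The tangent inequalities at the midpoint are added; the linear terms cancel. *)
Lemma powR_midconvex q a b : 1 <= q -> 0 <= a -> 0 <= b ->
  (a + b) `^ q <= 2 `^ (q - 1) * (a `^ q + b `^ q).
Proof.
move=> q1 a0 b0; have q0 : 0 < q by rewrite (lt_le_trans ltr01).
have m0 : 0 <= (a + b) / 2 by rewrite divr_ge0// addr_ge0.
have h1 := powR_tangent q1 m0 a0; have h2 := powR_tangent q1 m0 b0.
have E : a + b = 2 * ((a + b) / 2) by field.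
rewrite E powRM// -(mulr_powRB1 (ler0n _ 2) q0) -mulrA mulrCA.
rewrite ler_pM2l ?powR_gt0//.
have := lerD h1 h2; move: E h1 h2; set m := (a + b) / 2 => E _ _.
have -> : a = 2 * m - b by rewrite -E; ring.
lra.
Qed.

Lemma powR_sqr p x : (x ^+ 2) `^ (p / 2) = `|x| `^ p.
Proof.
by rewrite -real_normK ?num_real// -powR_mulrn// -powRrM mulrC divfK// pnatr_eq0.
Qed.

(** Superadditivity of the power p / 2 on squares, then the parallelogram identity, then convexity
    of the same power. *)
Lemma clarkson_powR p x y : 2 <= p ->
  `|x + y| `^ p + `|x - y| `^ p <= 2 `^ (p - 1) * (`|x| `^ p + `|y| `^ p).
Proof.
move=> p2; have q1 : 1 <= p / 2 by rewrite ler_pdivlMr// mul1r.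
rewrite -!powR_sqr (le_trans (powR_superadditive q1 _ _)) ?sqr_ge0//.
have -> : (x + y) ^+ 2 + (x - y) ^+ 2 = 2 * (x ^+ 2 + y ^+ 2) by ring.
rewrite powRM ?addr_ge0 ?sqr_ge0//.
have -> : p - 1 = p / 2 + (p / 2 - 1) by field.
rewrite (@powRD _ 2); last by rewrite pnatr_eq0 implybT.
rewrite -mulrA ler_wpM2l ?powR_ge0//.
by apply: powR_midconvex; rewrite ?sqr_ge0.
Qed.

(** The left side minus 2 is the square of [expR (s / 2) - expR (- s / 2)], whose absolute value is
    at most |s| [expR (m / 2)]. *)
Lemma expR_cosh_le (s m : R) : `|s| <= m ->
  expR s + expR (- s) <= 2 + s ^+ 2 * expR m.
Proof.
move=> sm.
suff : expR s + expR (- s) - 2 <= s ^+ 2 * expR m by lra.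
have E (u : R) : expR u = expR (u / 2) ^+ 2.
  by rewrite expr2 -expRD -splitr.
have Ev : expR (s / 2) * expR (- s / 2) = 1.
  by rewrite -expRD mulNr subrr expR0.
have -> : expR s + expR (- s) - 2 = (expR (s / 2) - expR (- s / 2)) ^+ 2.
  by rewrite sqrrB Ev -E -E; ring.
rewrite (E m) -exprMn -ler_sqrt ?sqr_ge0// !sqrtr_sqr normrM.
rewrite (@ger0_norm _ (expR _)) ?expR_ge0//.
wlog s0 : s sm {Ev} / 0 <= s.
  move=> H; case: (leP 0 s) => [|/ltW] s0; first exact: H.
  have := H (- s); rewrite normrN oppr_ge0 opprK distrC; exact.
have e1 : expR (s / 2) <= expR (m / 2).
  by rewrite ler_expR ler_pM2r// -(ger0_norm s0).
rewrite !ger0_norm//; last by rewrite subr_ge0 ler_expR; lra.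
apply: (@le_trans _ _ (s * expR (s / 2))); last by rewrite ler_wpM2l.
have : expR (- s / 2) = expR (- s) * expR (s / 2).
  by rewrite -expRD; congr expR; field.
move=> ->; rewrite -{1}(mul1r (expR _)) -mulrBl ler_wpM2r ?expR_ge0//.
have := expR_ge1Dx (- s); lra.
Qed.

(** If |x| <= |y|, both terms are at most (2|y|)^p, which gives the part 2 * 2^p of the constant.
    Otherwise, with t = y / x, each |1 +- t|^p is below exp(+- p t); the first-order terms cancel in
    the sum, and the quadratic remainder gives p^2 exp(p). *)
Lemma powR_smooth p : 2 <= p -> exists2 C, 1 <= C & forall x y,
  `|x + y| `^ p + `|x - y| `^ p <=
  2 * `|x| `^ p + C * (`|x| `^ (p - 2) * y ^+ 2 + `|y| `^ p).
Proof.
move=> p2; have p0 : 0 <= p by rewrite (le_trans _ p2).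
have e0 := expR_gt0 p; have pp := sqr_ge0 p.
have t1 : 1 <= 2 `^ p :> R.
  have := ler_powR (ler1n R 2) p0; rewrite powRr0; exact.
exists (2 * 2 `^ p + p ^+ 2 * expR p) => [|x y].
  have := mulr_ge0 pp (ltW e0); move: t1; set u := 2 `^ p; set v := p ^+ 2 * _.
  by lra.
have xp := powR_ge0 `|x| p; have yp := powR_ge0 `|y| p.
have xq := powR_ge0 `|x| (p - 2); have y2 := sqr_ge0 y.
case: (leP `|x| `|y|) => xy.
  have h (z : R) : `|z| <= `|x| + `|y| -> `|z| `^ p <= 2 `^ p * `|y| `^ p.
    move=> zxy; rewrite -powRM// ge0_ler_powR ?nnegrE ?mulr_ge0//.
    by rewrite (le_trans zxy)//; lra.
  have := h _ (ler_normD x y); have := h _ (ler_normB x y).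
  have h1 : 0 <= p ^+ 2 * expR p * `|y| `^ p by rewrite !mulr_ge0// ltW.
  have h2 : 0 <= (2 * 2 `^ p + p ^+ 2 * expR p) * (`|x| `^ (p - 2) * y ^+ 2).
    by rewrite mulr_ge0// ?addr_ge0// mulr_ge0// ?powR_ge0// expR_ge0.
  lra.
have x0 : x != 0 by rewrite -normr_gt0 (le_lt_trans _ xy).
pose t := y / x.
have tx : y = t * x by rewrite /t divfK.
have t1' : `|t| < 1 by rewrite normf_div ltr_pdivrMr ?normr_gt0// mul1r.
have h (s : R) : `|s| < 1 -> `|1 + s| `^ p <= expR (p * s).
  rewrite ltr_norml => /andP[s1 s2].
  rewrite ger0_norm; last by lra.
  rewrite mulrC expRM ge0_ler_powR ?nnegrE ?expR_ge0 ?expR_ge1Dx//; lra.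
have := h _ t1'; have := h (- t); rewrite normrN => /(_ t1').
have pt : `|p * t| <= p by rewrite normrM ger0_norm// ler_piMr// ltW.
have := expR_cosh_le pt; rewrite -mulrN => h3 h4 h5.
have -> : x + y = x * (1 + t) by rewrite tx; ring.
have -> : x - y = x * (1 - t) by rewrite tx; ring.
rewrite !normrM !powRM// -mulrDr.
have hx : `|x| `^ (p - 2) * y ^+ 2 = `|x| `^ p * t ^+ 2.
  have x2 : x ^+ 2 = `|x| `^ 2 by rewrite powR_mulrn// real_normK ?num_real.
  rewrite tx exprMn (mulrC (t ^+ 2)) mulrA x2 -powRD ?subrK//.
  by rewrite normr_eq0 x0 implybT.
apply: (@le_trans _ _ (`|x| `^ p * (2 + (p * t) ^+ 2 * expR p))).
  by rewrite ler_wpM2l//; lra.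
rewrite hx.
have h6 : 0 <= 2 * 2 `^ p * (`|x| `^ p * t ^+ 2 + `|y| `^ p).
  apply: mulr_ge0; first by rewrite mulr_ge0// powR_ge0.
  by rewrite addr_ge0// mulr_ge0// sqr_ge0.
have h7 : 0 <= p ^+ 2 * expR p * `|y| `^ p by rewrite !mulr_ge0// ltW.
rewrite exprMn; lra.
Qed.

(** For large y, adding x changes |y|^p by O(M |y|^(p-1)), which is below e |y|^p once |y| >= K / e;
    this fixes the threshold [B]. For |y| <= B the error is linear in |y|, and C |y| <= e + C^2 y^2
    / e makes it quadratic. *)
Lemma powR_almost_disjoint p (M e : R) : 1 <= p -> 0 <= M -> 0 < e ->
  exists2 C, 0 <= C & forall x y, `|x| <= M ->
  `| `|x + y| `^ p - `|x| `^ p - `|y| `^ p| <=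
  e + e * `|y| `^ p + C * y ^+ 2.
Proof.
move=> p1 M0 e0; have p0 : 0 < p by rewrite (lt_le_trans ltr01).
have p10 : 0 <= p - 1 by rewrite subr_ge0.
pose K := (p * 2 `^ (p - 1) + 1) * M.
have K0 : 0 <= K by rewrite mulr_ge0 ?addr_ge0 ?mulr_ge0 ?powR_ge0// ltW.
pose B := M + K / e.
have B0 : 0 <= B by rewrite addr_ge0// divr_ge0// ltW.
pose C := p * (M + B) `^ (p - 1) + B `^ (p - 1).
have C0 : 0 <= C by rewrite addr_ge0 ?mulr_ge0 ?powR_ge0// ltW.
exists (C ^+ 2 / e) => [|x y xM]; first by rewrite divr_ge0 ?sqr_ge0// ltW.
have y2 := sqr_ge0 y.
have yp := powR_ge0 `|y| p.
have tri : `|x + y| <= `|x| + `|y| := ler_normD x y.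
case: (leP B `|y|) => yB.
  have My : M <= `|y|.
    by apply: le_trans yB; rewrite lerDl divr_ge0// ltW.
  have xy : `|x| <= `|y| by exact: le_trans My.
  have := @powR_lipschitz p (2 * `|y|) `|x + y| `|y| p1.
  rewrite !normr_ge0/= => /(_ ltac:(lra) ltac:(lra)).
  have dxy : `| `|x + y| - `|y| | <= M.
    apply: le_trans xM; have := ler_dist_dist (x + y) y.
    by rewrite addrK.
  rewrite powRM// => h1.
  have h2 : `|x| `^ p <= M * `|y| `^ (p - 1).
    rewrite -mulr_powRB1// ler_pM ?powR_ge0//.
    by rewrite ge0_ler_powR ?nnegrE.
  have h3 : K * `|y| `^ (p - 1) <= e * `|y| `^ p.
    rewrite -(mulr_powRB1 (normr_ge0 y) p0) mulrA ler_wpM2r ?powR_ge0//.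
    rewrite -ler_pdivrMl// mulrC (le_trans _ yB)// /B lerDr//.
  have h4 : p * (2 `^ (p - 1) * `|y| `^ (p - 1)) * `| `|x + y| - `|y| | <=
            p * (2 `^ (p - 1) * `|y| `^ (p - 1)) * M.
    by rewrite ler_wpM2l// !mulr_ge0 ?powR_ge0// ltW.
  have h5 : 0 <= C ^+ 2 / e * y ^+ 2 by rewrite mulr_ge0// divr_ge0 ?sqr_ge0// ltW.
  have := powR_ge0 `|x| p.
  move: h1; rewrite ler_norml => /andP[h1 h1'].
  rewrite ler_norml; rewrite /K in h3; move: h1 h1' h2 h3 h4 h5.
  set yq := `|y| `^ (p - 1); set tq := 2 `^ _; set z := `| _ - _ |; set w := C ^+ 2 / e * _.
  move=> *; apply/andP; split; lra.
have := @powR_lipschitz p (M + B) `|x + y| `|x| p1.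
rewrite !normr_ge0/= => /(_ ltac:(lra) ltac:(lra)).
have dxy : `| `|x + y| - `|x| | <= `|y|.
  by have := ler_dist_dist (x + y) x; rewrite (addrC x) addrK.
move=> h1.
have h2 : p * (M + B) `^ (p - 1) * `| `|x + y| - `|x| | <=
          p * (M + B) `^ (p - 1) * `|y|.
  by rewrite ler_wpM2l// mulr_ge0 ?powR_ge0// ltW.
have h3 : `|y| `^ p <= B `^ (p - 1) * `|y|.
  rewrite -(mulr_powRB1 (normr_ge0 y) p0) mulrC ler_wpM2r//.
  by rewrite ge0_ler_powR ?nnegrE// ltW.
have h4 : C * `|y| <= e + C ^+ 2 / e * y ^+ 2.
  rewrite -(real_normK (num_real y)).
  have -> : C ^+ 2 / e * `|y| ^+ 2 = (C * `|y|) ^+ 2 / e by field; rewrite gt_eqF.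
  set u := C * _.
  have u0 : 0 <= u by rewrite mulr_ge0.
  rewrite -(ler_pM2r e0) mulrDl divfK ?gt_eqF//.
  have := sqr_ge0 (u - e); have := mulr_ge0 u0 (ltW e0); rewrite sqrrB !expr2; lra.
have h5 : 0 <= e * `|y| `^ p by rewrite mulr_ge0// ltW.
move: h1; rewrite ler_norml => /andP[h1 h1'].
rewrite ler_norml; move: h1 h1' h2 h3 h4 h5; rewrite /C.
set u := p * (M + B) `^ (p - 1); set v := B `^ (p - 1); set z := `| _ - _ |.
set w := _ / e * _.
move=> *; apply/andP; split; lra.
Qed.

(** Lets a small summand y be added or removed while the coefficient of the main term stays close to
    1. The cases are y <= t x, where (1 + t)^p suffices, and x < y / t, where y alone dominates. *)
Lemma powRD_le_eps p (s : R) : 1 <= p -> 0 < s ->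
  exists2 C, 0 <= C & forall x y, 0 <= x -> 0 <= y ->
    (x + y) `^ p <= (1 + s) * x `^ p + C * y `^ p.
Proof.
move=> p1 s0; have p0 : 0 < p by rewrite (lt_le_trans ltr01).
have t2 : 0 < p * 2 `^ (p - 1) :> R by rewrite mulr_gt0// powR_gt0.
(* On [0, 2] the power has Lipschitz constant p 2^(p-1), so this t gives (1 + t)^p <= 1 + s. *)
pose t := Num.min 1 (s / (p * 2 `^ (p - 1))).
have t0 : 0 < t by rewrite lt_min ltr01 divr_gt0.
have t1 : t <= 1 by rewrite ge_min lexx.
have ts : p * 2 `^ (p - 1) * t <= s.
  by rewrite -ler_pdivlMl// mulrC ge_min lexx orbT.
have tp : (1 + t) `^ p <= 1 + s.
  have := @powR_lipschitz p 2 (1 + t) 1 p1.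
  rewrite powR1.
  have -> : 1 + t - 1 = t by ring.
  rewrite (gtr0_norm t0) => /(_ ltac:(lra) ltac:(lra)).
  rewrite ler_norml => /andP[_]; lra.
exists ((1 + t^-1) `^ p) => [|x y x0 y0]; first exact: powR_ge0.
have xp := powR_ge0 x p; have yp := powR_ge0 y p.
case: (leP y (t * x)) => ytx.
  apply: (@le_trans _ _ ((1 + t) `^ p * x `^ p)).
    rewrite -powRM//; last by rewrite addr_ge0// ltW.
    rewrite ge0_ler_powR ?nnegrE ?mulr_ge0 ?addr_ge0 ?(ltW p0) ?(ltW t0)//; lra.
  by rewrite ler_wpDr ?mulr_ge0 ?powR_ge0// ler_wpM2r.
apply: (@le_trans _ _ ((1 + t^-1) `^ p * y `^ p)).
  have ti : 0 <= t^-1 by rewrite invr_ge0 ltW.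
  rewrite -powRM//; last by rewrite addr_ge0.
  rewrite ge0_ler_powR ?nnegrE ?mulr_ge0 ?addr_ge0 ?(ltW p0)//.
  rewrite mulrDl mul1r addrC lerD2l.
  by rewrite -ler_pdivrMl ?invr_gt0// invrK ltW.
by rewrite ler_wpDl ?mulr_ge0 ?addr_ge0 ?powR_ge0// ltW.
Qed.

Lemma powR_mul_sqr_le p x y : 2 <= p -> 0 <= x -> 0 <= y ->
  x `^ (p - 2) * y ^+ 2 <= x `^ p + y `^ p.
Proof.
move=> p2 x0 y0; have p20 : 0 <= p - 2 by rewrite subr_ge0.
have p0 : 0 < p by rewrite (lt_le_trans _ p2).
have E z : 0 <= z -> z `^ p = z `^ (p - 2) * z ^+ 2.
  move=> z0; rewrite -powR_mulrn// -powRD ?subrK//.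
  by apply/implyP; rewrite gt_eqF.
case: (leP x y) => [xy|/ltW xy].
  rewrite ler_wpDl ?powR_ge0// (E y)//.
  by rewrite ler_wpM2r ?sqr_ge0// ge0_ler_powR.
rewrite ler_wpDr ?powR_ge0// (E x)// ler_wpM2l ?powR_ge0//.
by rewrite !expr2 ler_pM.
Qed.

(** Compare the (p/2)-th powers. That of a^2 + 2 C d^2 dominates a^p + 2 C d^p by superadditivity
    and a^p + 2 C a^(p-2) d^2 by the tangent at a^2. The mean of these two bounds is the hypothesis
    on x, whence the factor 2. *)
Lemma powR_smooth_sqr p (C a d x : R) : 2 <= p -> 1 <= C ->
  0 <= a -> 0 <= d -> 0 <= x ->
  x `^ p <= a `^ p + C * (a `^ (p - 2) * d ^+ 2 + d `^ p) ->
  x ^+ 2 <= a ^+ 2 + 2 * C * d ^+ 2.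
Proof.
move=> p2 C1 a0 d0 x0 h.
have p0 : 0 < p by rewrite (lt_le_trans _ p2).
have q1 : 1 <= p / 2 by rewrite ler_pdivlMr// mul1r.
have q0 : 0 < p / 2 by rewrite (lt_le_trans ltr01).
have Cd : 0 <= 2 * C * d ^+ 2 by rewrite !mulr_ge0 ?sqr_ge0//; lra.
have Y0 : 0 <= a ^+ 2 + 2 * C * d ^+ 2 by rewrite addr_ge0 ?sqr_ge0.
rewrite leNgt; apply/negP => /(gt0_ltr_powR q0).
rewrite !nnegrE Y0 sqr_ge0 => /(_ isT isT); rewrite powR_sqr ger0_norm//.
apply/negP; rewrite -leNgt (le_trans h)//.
have h1 := powR_superadditive q1 (sqr_ge0 a) Cd.
have h2 := powR_tangent q1 (sqr_ge0 a) Y0.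
have h3 : (a ^+ 2) `^ (p / 2 - 1) = a `^ (p - 2).
  have -> : p / 2 - 1 = (p - 2) / 2 by field.
  by rewrite powR_sqr ger0_norm.
have h4 : 2 * C * d `^ p <= (2 * C * d ^+ 2) `^ (p / 2).
  rewrite powRM ?sqr_ge0//; last by rewrite mulr_ge0//; lra.
  rewrite powR_sqr ger0_norm// ler_wpM2r ?powR_ge0//.
  by rewrite le1r_powR//; lra.
have h5 : a `^ (p - 2) * (2 * C * d ^+ 2) <=
          p / 2 * (a ^+ 2) `^ (p / 2 - 1) * (a ^+ 2 + 2 * C * d ^+ 2 - a ^+ 2).
  rewrite h3 [_ - a ^+ 2]addrAC subrr add0r -[X in _ <= X]mulrA ler_peMl//.
  by rewrite mulr_ge0 ?powR_ge0.
move: h1 h2 h4 h5; rewrite powR_sqr (ger0_norm a0).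
by move=> *; lra.
Qed.

End power_inequalities.

(** * Integrals of p-th powers *)

Section real_integrable.
Context d (T : measurableType d) (R : realType).
Variable mu : {measure set T -> \bar R}.
Implicit Types f g : T -> R.

Lemma Rintegrable_add f g : mu.-integrable setT (EFin \o f) ->
  mu.-integrable setT (EFin \o g) ->
  mu.-integrable setT (EFin \o (fun t => f t + g t)).
Proof. by move=> fi gi; have := integrableD measurableT fi gi. Qed.

Lemma Rintegrable_scale (a : R) f : mu.-integrable setT (EFin \o f) ->
  mu.-integrable setT (EFin \o (fun t => a * f t)).
Proof. by move=> fi; have := integrableZl measurableT a fi. Qed.

Lemma Rintegrable_sub f g : mu.-integrable setT (EFin \o f) ->
  mu.-integrable setT (EFin \o g) ->
  mu.-integrable setT (EFin \o (fun t => f t - g t)).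
Proof. by move=> fi gi; have := integrableB measurableT fi gi. Qed.

Lemma ae_eq_Rintegral f g : measurable_fun setT f -> measurable_fun setT g ->
  f = g %[ae mu] -> \int[mu]_t f t = \int[mu]_t g t.
Proof.
move=> mf mg fg; congr fine; apply: ae_eq_integral => //.
- exact/measurable_EFinP.
- exact/measurable_EFinP.
- exact: ae_eq_comp fg.
Qed.

Lemma ae_le_Rintegral f g : mu.-integrable setT (EFin \o f) ->
  mu.-integrable setT (EFin \o g) ->
  {ae mu, forall t, f t <= g t} -> \int[mu]_t f t <= \int[mu]_t g t.
Proof.
move=> fi gi fg.
have mf : measurable_fun setT f by exact/measurable_EFinP/(measurable_int _ fi).
have mg : measurable_fun setT g by exact/measurable_EFinP/(measurable_int _ gi).
have hi : mu.-integrable setT (EFin \o (fun t => Num.max (f t) (g t))).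
  apply: (le_integrable measurableT _ _ (Rintegrable_add (integrable_norm fi)
    (integrable_norm gi))) => //.
    by apply/measurable_EFinP; exact: measurable_maxr.
  move=> t _; rewrite lee_fin/= [leRHS]ger0_norm ?addr_ge0//.
  by case: (leP (f t) (g t)) => _; rewrite ?lerDl ?lerDr.
(* Monotonicity of the integral is pointwise, so g is replaced by a function equal to it almost
   everywhere and above f everywhere. *)
have -> : \int[mu]_t g t = \int[mu]_t Num.max (f t) (g t).
  apply: ae_eq_Rintegral => //; first exact: measurable_maxr.
  by apply: filterS fg => t ft _; rewrite (elimT max_idPr ft).
by apply: le_Rintegral => // t _; rewrite le_max lexx.
Qed.

End real_integrable.

Section Lp_integrals.
Context d (T : measurableType d) (R : realType).
Variable mu : {measure set T -> \bar R}.
Variables (p : R) (p1 : (1 <= p%:E)%E).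
Local Notation V := (LspaceType mu p1).
Implicit Types x y : V.

Let p1' : 1 <= p. Proof. by rewrite -lee_fin. Qed.
Let p0 : 0 < p. Proof. exact: lt_le_trans p1'. Qed.

Lemma Lspace_measurable x : measurable_fun setT (x : T -> R).
Proof. by have := Lspace_mfun x; rewrite inE. Qed.

Lemma measurable_fun_norm_powR (f : T -> R) q :
  measurable_fun setT f -> measurable_fun setT (fun t => `|f t| `^ q).
Proof.
move=> mf; apply: (measurableT_comp (measurable_powR q)).
exact: measurableT_comp.
Qed.

Lemma Lspace_integrable_powR x :
  mu.-integrable setT (EFin \o (fun t => `|x t| `^ p)).
Proof. exact: Lfun_integrable (Lspace_Lfun x). Qed.

Lemma Lspace_norm_powR x : `|x| `^ p = \int[mu]_t (`|x t| `^ p).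
Proof.
apply: EFin_inj; rewrite -poweR_EFin Lspace_normE poweR_Lnorm ?gt_eqF//.
by rewrite fineK// integrable_fin_num// Lspace_integrable_powR.
Qed.

Lemma Lclass_exists (f : T -> R) : measurable_fun setT f ->
  (\int[mu]_t (`|f t| `^ p)%:E < +oo)%E -> exists x : V, (x : T -> R) = f %[ae mu].
Proof.
move=> mf fi.
have fL : f \in Lfun mu p%:E.
  apply/andP; split; first by rewrite inE.
  rewrite inE /= /finite_norm unlock; apply: poweR_lty; exact: fi.
by exists (Lclass (Lfun_Sub p1 fL)); exact: LclassK.
Qed.

Lemma Lspace_add_ae x y : {ae mu, forall t, (x + y) t = x t + y t}.
Proof. by have := Lspace_addE x y; apply: filterS => t /(_ I). Qed.

Lemma Lspace_scale_ae a x : {ae mu, forall t, (a *: x) t = a * x t}.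
Proof. by have := Lspace_scaleE a x; apply: filterS => t /(_ I). Qed.

Lemma Lspace_sub_ae x y : {ae mu, forall t, (x - y) t = x t - y t}.
Proof.
rewrite -scaleN1r.
have := Lspace_add_ae x (-1 *: y); have := Lspace_scale_ae (-1) y.
by apply: filterS2 => t -> ->; rewrite mulN1r.
Qed.

Lemma Lspace_eq_ae x y : {ae mu, forall t, x t = y t} -> x = y.
Proof. by move=> xy; apply: LspaceP; apply: filterS xy => t ->. Qed.

End Lp_integrals.

Section Lp_probability.
Context d (T : measurableType d) (R : realType).
Variable mu : probability T R.
Variables (p : R) (p2 : 2 < p) (p1 : (1 <= p%:E)%E).
Local Notation V := (LspaceType mu p1).
Implicit Types x y f r : V.

Let p0 : 0 < p. Proof. exact: lt_trans p2. Qed.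
Let p1' : 1 <= p. Proof. by rewrite -lee_fin. Qed.

(** [powint 2] is the squared L_2-norm, so that the L_2 and L_p sizes of an element are compared
    without leaving the type [V]. *)
Definition powint q x : R := \int[mu]_t (`|x t| `^ q).

Lemma powint_integrable q x : 1 <= q <= p ->
  mu.-integrable setT (EFin \o (fun t => `|x t| `^ q)).
Proof.
move=> /andP[q1 qp]; apply: Lfun_integrable => //.
have q1' : (1 <= q%:E)%E by rewrite lee_fin.
apply: (Lfun_subset q1' p1 _ _ (Lspace_Lfun x)) => //.
exact: fin_num_measure.
Qed.

Let int2 x : mu.-integrable setT (EFin \o (fun t => `|x t| `^ 2)).
Proof. by apply: powint_integrable; rewrite ler1n/= ltW. Qed.

Let intp x : mu.-integrable setT (EFin \o (fun t => `|x t| `^ p)).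
Proof. exact: Lspace_integrable_powR. Qed.

Lemma powint_norm x : powint p x = `|x| `^ p.
Proof. by rewrite Lspace_norm_powR. Qed.

Lemma powint_ge0 q x : 0 <= powint q x.
Proof. by apply: Rintegral_ge0 => t _; exact: powR_ge0. Qed.

Lemma Rintegral_prob_cst (c : R) : \int[mu]_(_ in setT) c = c.
Proof.
rewrite (Rintegral_cst mu measurableT) -[RHS]mulr1; congr (_ * _).
by apply: EFin_inj; rewrite fineK ?fin_num_measure//; exact: probability_setT.
Qed.

Lemma Rintegrable_cst (c : R) : mu.-integrable setT (EFin \o (fun _ : T => c)).
Proof. exact: (finite_measure_integrable_cst mu c measurableT). Qed.

Lemma powintZ q a x : 1 <= q <= p -> powint q (a *: x) = `|a| `^ q * powint q x.
Proof.
move=> q1p; rewrite /powint.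
rewrite -(RintegralZl _ measurableT); last exact: powint_integrable.
apply: ae_eq_Rintegral.
- exact/measurable_fun_norm_powR/Lspace_measurable.
- apply: measurable_funM => //.
  exact/measurable_fun_norm_powR/Lspace_measurable.
- have := Lspace_scale_ae a x; apply: filterS => t -> _.
  by rewrite normrM powRM.
Qed.

Lemma powint_clarkson q x y : 2 <= q <= p ->
  powint q (x + y) + powint q (x - y) <=
  2 `^ (q - 1) * (powint q x + powint q y).
Proof.
move=> /andP[q2 qp].
have Iq (z : V) : mu.-integrable setT (EFin \o (fun t => `|z t| `^ q)).
  by apply: powint_integrable; rewrite qp (le_trans _ q2)// ler1n.
have Dq (z w : V) : powint q z + powint q w = \int[mu]_t (`|z t| `^ q + `|w t| `^ q).
  exact/esym/(RintegralD measurableT).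
rewrite !Dq -(RintegralZl _ measurableT); last exact: Rintegrable_add.
apply: ae_le_Rintegral.
- exact: Rintegrable_add.
- exact/Rintegrable_scale/Rintegrable_add.
- have := Lspace_add_ae x y; have := Lspace_sub_ae x y.
  by apply: filterS2 => t -> ->; exact: clarkson_powR.
Qed.

Lemma powint2_sub x y : powint 2 (x - y) <= 2 * powint 2 x + 2 * powint 2 y.
Proof.
have q2 : 2 <= (2 : R) <= p by rewrite lexx ltW.
have := powint_clarkson x y q2; have -> : 2 - 1 = 1 :> R by ring.
rewrite powRr1// mulrDr; apply: le_trans.
by rewrite lerDr powint_ge0.
Qed.

Lemma powint2_le x : powint 2 x <= 2 * `|x| ^+ 2.
Proof.
have H (z : V) : `|z| = 1 -> powint 2 z <= 2.
  move=> z1; suff : powint 2 z <= 1 + powint p z by rewrite powint_norm z1 powR1.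
  have ic := Rintegrable_cst 1.
  have -> : 1 + powint p z = \int[mu]_t (1 + `|z t| `^ p).
    by rewrite RintegralD// Rintegral_prob_cst.
  apply: le_Rintegral => //; first exact: Rintegrable_add ic (intp z).
  move=> t _; case: (leP `|z t| 1) => zt.
    rewrite ler_wpDr ?powR_ge0//.
    have := @ge0_ler_powR _ 2 (ler0n _ 2) _ _ _ _ zt.
    by rewrite powR1 !nnegrE; exact.
  by rewrite ler_wpDl// ler_powR ?(ltW zt)// ltW.
have [->|x0] := eqVneq x 0.
  rewrite -(scale0r 0) powintZ; last by rewrite ler1n/= ltW.
  by rewrite !normr0 powR0// mul0r scale0r normr0 expr0n mulr0.
have n0 : `|x| != 0 by rewrite normr_eq0.
have E : x = `|x| *: (`|x|^-1 *: x) by rewrite scalerA divff// scale1r.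
rewrite {1}E powintZ; last by rewrite ler1n/= ltW.
rewrite normr_id powR_mulrn// mulrC ler_wpM2r ?sqr_ge0//; apply: H.
by rewrite normrZ normrV ?unitfE// normr_id mulVf.
Qed.

(** The pointwise inequality is integrated. For the mixed term, [powR_mul_sqr_le] is applied to x(t)
    and y(t) divided by their norms: the resulting bound integrates to twice |x|^(p-2) |y|^2. *)
Lemma norm_smooth : exists2 C, 1 <= C & forall x y,
  `|x + y| `^ p + `|x - y| `^ p <=
  2 * `|x| `^ p + C * (`|x| `^ (p - 2) * `|y| ^+ 2 + `|y| `^ p).
Proof.
have [C C1 HC] := powR_smooth (ltW p2).
have C0 : 0 <= C by exact: le_trans C1.
exists (2 * C) => [|x y]; first by lra.
have H2 (a b : R) : 0 <= a -> 0 < b -> forall s t : R, 0 <= s -> 0 <= t ->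
  s `^ (p - 2) * t ^+ 2 <= a `^ (p - 2) * b ^+ 2 * (s `^ p / a `^ p + t `^ p / b `^ p)
  \/ a = 0.
  move=> a0 b0 s t s0 t0; have [->|an] := eqVneq a 0; [by right|left].
  have ap : 0 < a by rewrite lt0r an.
  have := @powR_mul_sqr_le _ p (s / a) (t / b) (ltW p2).
  rewrite !divr_ge0 ?(ltW b0)// => /(_ isT isT).
  have PV (c q : R) : 0 <= c -> c^-1 `^ q = (c `^ q)^-1.
    by move=> c0; rewrite -powR_inv1// -powRrM mulN1r powRN.
  rewrite !powRM ?invr_ge0 ?(ltW b0)// !PV ?(ltW b0)// exprMn exprVn => h.
  have E : s `^ (p - 2) * t ^+ 2 = (a `^ (p - 2) * b ^+ 2) *
    (s `^ (p - 2) / a `^ (p - 2) * (t ^+ 2 / b ^+ 2)).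
    by field; rewrite !gt_eqF ?powR_gt0.
  rewrite E; apply: ler_wpM2l; first by rewrite mulr_ge0 ?powR_ge0 ?sqr_ge0.
  exact: h.
have [->|y0] := eqVneq y 0.
  rewrite addr0 subr0 normr0 expr0n mulr0 powR0 ?gt_eqF// addr0 mulr0 addr0.
  by rewrite mulrDl mul1r.
have b0 : 0 < `|y| by rewrite normr_gt0.
have yp := powR_ge0 `|y| p.
have [->|x0] := eqVneq x 0.
  rewrite add0r sub0r normrN normr0 powR0 ?gt_eqF// mulr0 add0r.
  rewrite powR0 ?subr_eq0 ?gt_eqF// mul0r add0r.
  by have := ler_wpM2r yp C1; lra.
have a0 : 0 < `|x| by rewrite normr_gt0.
pose K := `|x| `^ (p - 2) * `|y| ^+ 2.
pose g (t : T) := (2 + C * (K / `|x| `^ p)) * `|x t| `^ p +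
   (C * (K / `|y| `^ p) + C) * `|y t| `^ p.
have gi : mu.-integrable setT (EFin \o g).
  by apply: Rintegrable_add; exact: Rintegrable_scale.
have : powint p (x + y) + powint p (x - y) <= \int[mu]_t g t.
  rewrite -(RintegralD measurableT)//; apply: ae_le_Rintegral => //.
    exact: Rintegrable_add.
  have := Lspace_add_ae x y; have := Lspace_sub_ae x y.
  apply: filterS2 => t -> ->; apply: le_trans (HC _ _) _.
  have [h|] := H2 _ _ (ltW a0) b0 _ _ (normr_ge0 (x t)) (normr_ge0 (y t));
    last by move=> h; move: a0; rewrite h ltxx.
  rewrite real_normK ?num_real// in h.
  rewrite /g -/K; rewrite -/K in h.
  have := ler_wpM2l C0 h; lra.
rewrite RintegralD// ?RintegralZl//; [|exact: Rintegrable_scale..].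
rewrite -!Lspace_norm_powR !powint_norm -/K => /le_trans; apply.
have xp : `|x| `^ p != 0 by rewrite gt_eqF// powR_gt0.
have yp' : `|y| `^ p != 0 by rewrite gt_eqF// powR_gt0.
have : 0 <= C * `|y| `^ p by rewrite mulr_ge0.
have -> : (2 + C * (K / `|x| `^ p)) * `|x| `^ p = 2 * `|x| `^ p + C * K.
  by field.
have -> : (C * (K / `|y| `^ p) + C) * `|y| `^ p = C * K + C * `|y| `^ p.
  by field.
lra.
Qed.

(** The constant depends on f only through its sup bound. Hence a remainder that is small in L_2
    behaves, for p-th powers of norms, as if its support were disjoint from that of f. *)
Lemma norm_almost_disjoint (M e : R) : 0 <= M -> 0 < e ->
  exists2 C, 0 <= C & forall f r, {ae mu, forall t, `|f t| <= M} ->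
  `| `|f + r| `^ p - `|f| `^ p - `|r| `^ p| <=
  e + e * `|r| `^ p + C * powint 2 r.
Proof.
move=> M0 e0; have [C C0 HC] := powR_almost_disjoint p1' M0 e0.
exists C => // f r fM.
pose h t := `|(f + r) t| `^ p - `|f t| `^ p - `|r t| `^ p.
have hi : mu.-integrable setT (EFin \o h).
  by apply: Rintegrable_sub => //; apply: Rintegrable_sub.
have -> : `|f + r| `^ p - `|f| `^ p - `|r| `^ p = \int[mu]_t h t.
  by rewrite !Lspace_norm_powR /h !(RintegralB measurableT)//; apply: Rintegrable_sub.
apply: (le_trans (le_normr_Rintegral measurableT hi)).
pose g t := e + e * `|r t| `^ p + C * `|r t| `^ 2.
have gi1 : mu.-integrable setT (EFin \o (fun t => e + e * `|r t| `^ p)).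
  by apply: Rintegrable_add; [exact: Rintegrable_cst|exact: Rintegrable_scale].
have gi : mu.-integrable setT (EFin \o g).
  by apply: Rintegrable_add => //; exact: Rintegrable_scale.
apply: (@le_trans _ _ (\int[mu]_t g t)).
  apply: ae_le_Rintegral => //; first exact: integrable_norm.
  have := Lspace_add_ae f r; move: fM; apply: filterS2 => t fM frt.
  rewrite /h /g frt powR_mulrn// real_normK ?num_real//.
  exact: HC.
rewrite /g RintegralD//; last exact: Rintegrable_scale.
rewrite RintegralD//; [|exact: Rintegrable_cst|exact: Rintegrable_scale].
by rewrite !RintegralZl// Rintegral_prob_cst -Lspace_norm_powR.
Qed.

End Lp_probability.

(** * Conditional expectations onto finite partitions *)

Section finite_partitions.
Context d (T : measurableType d).

(* A partition is given by the index of the cell of each point; cells may be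
   empty. *)
Record fpart := Fpart {
  cell :> T -> nat ;
  ncell : nat ;
  cell_lt : forall t, (cell t < ncell)%N ;
  cell_measurable : forall i, measurable (cell @^-1` [set i]) }.

Implicit Types pi : fpart.

Definition refines pi pi' := exists g : nat -> nat, forall t, pi t = g (pi' t).

Lemma refines_refl pi : refines pi pi. Proof. by exists id. Qed.

Lemma refines_trans pi2 pi1 pi3 :
  refines pi1 pi2 -> refines pi2 pi3 -> refines pi1 pi3.
Proof. by move=> [g g12] [h h23]; exists (g \o h) => t; rewrite g12 h23. Qed.

Lemma measurable_cell_preimage pi (Y : set nat) : measurable (pi @^-1` Y).
Proof.
rewrite (_ : _ @^-1` _ = \bigcup_(i in Y) (pi @^-1` [set i])).
  by apply: bigcup_measurable => i _; exact: cell_measurable.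
apply/seteqP; split=> [t Yt|t [i Yi /= ti]]; first by exists (pi t).
by rewrite /preimage /= ti.
Qed.

(** A pair of cell indices is coded as a two-digit number in base [ncell pi']; quotient and
    remainder recover the two indices and witness both refinements. *)
Lemma join_cell_lt pi pi' t :
  (pi t * ncell pi' + pi' t < ncell pi * ncell pi')%N.
Proof.
apply: (@leq_trans ((pi t).+1 * ncell pi')).
  by rewrite mulSn addnC ltn_add2r cell_lt.
by rewrite leq_mul2r cell_lt orbT.
Qed.

Lemma join_cell_measurable pi pi' i :
  measurable ((fun t => (pi t * ncell pi' + pi' t)%N) @^-1` [set i]).
Proof.
rewrite (_ : _ @^-1` _ = \bigcup_j ((pi' @^-1` [set j]) `&`
    (pi @^-1` [set k | (k * ncell pi' + j)%N = i]))).
  by apply: bigcup_measurable => j _; apply: measurableI;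
    exact: measurable_cell_preimage.
apply/seteqP; split => [t /= ti|t [j _ [/= tj]]]; first by exists (pi' t).
by rewrite /preimage /= tj.
Qed.

Definition fpart_join pi pi' :=
  Fpart (join_cell_lt pi pi') (join_cell_measurable pi pi').

Lemma refines_joinl pi pi' : refines pi (fpart_join pi pi').
Proof.
exists (fun k => k %/ ncell pi')%N => t /=.
have lt := cell_lt pi' t.
by rewrite divnMDl ?(leq_ltn_trans _ lt)// divn_small// addn0.
Qed.

Lemma refines_joinr pi pi' : refines pi' (fpart_join pi pi').
Proof.
by exists (fun k => k %% ncell pi')%N => t /=; rewrite modnMDl modn_small// cell_lt.
Qed.

Lemma trivial_cell_measurable i : measurable ((fun _ : T => 0%N) @^-1` [set i]).
Proof.
case: i => [|i].
  by rewrite (_ : _ @^-1` _ = setT)//; apply/seteqP; split.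
by rewrite (_ : _ @^-1` _ = set0)//; apply/seteqP; split.
Qed.

Definition fpart_trivial := @Fpart (fun=> 0%N) 1 (fun=> isT) trivial_cell_measurable.

End finite_partitions.

Section cell_integrals.
Context d (T : measurableType d) (R : realType).
Variable mu : probability T R.
Implicit Types (pi : fpart T) (f : T -> R) (g : nat -> R).

Definition mass pi i : R := fine (mu (pi @^-1` [set i])).

Lemma mass_ge0 pi i : 0 <= mass pi i.
Proof. by rewrite fine_ge0. Qed.

Lemma massE pi i : mu (pi @^-1` [set i]) = (mass pi i)%:E.
Proof. by rewrite fineK// fin_num_measure//; exact: cell_measurable. Qed.

Lemma measurable_step pi g : measurable_fun setT (fun t => g (pi t)).
Proof.
move=> _ Y mY; rewrite setTI.
exact: (measurable_cell_preimage pi (g @^-1` Y)).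
Qed.

Lemma step_bounded pi g t : `|g (pi t)| <= \sum_(i < ncell pi) `|g i|.
Proof.
by rewrite (bigD1 (Ordinal (cell_lt pi t)))//= lerDl sumr_ge0.
Qed.

Lemma integrable_step pi g : mu.-integrable setT (EFin \o (fun t => g (pi t))).
Proof.
pose B := \sum_(i < ncell pi) `|g i|.
apply: (le_integrable measurableT _ _ (Rintegrable_cst mu B)).
  exact/measurable_EFinP/measurable_step.
move=> t _; rewrite lee_fin /= (le_trans (step_bounded pi g t))//.
exact: ler_norm.
Qed.

Lemma Rintegral_cells pi f : mu.-integrable setT (EFin \o f) ->
  \int[mu]_t f t = \sum_(i < ncell pi) \int[mu]_(t in pi @^-1` [set val i]) f t.
Proof.
move=> fi; pose S k := pi @^-1` [set i | (i < k)%N].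
have mS k : measurable (S k) by exact: measurable_cell_preimage.
have H k : \int[mu]_(t in S k) f t =
    \sum_(i < k) \int[mu]_(t in pi @^-1` [set val i]) f t.
  elim: k => [|k IH].
    by rewrite big_ord0 (_ : S 0%N = set0) ?Rintegral_set0//; apply/seteqP; split.
  rewrite big_ord_recr /= -IH -Rintegral_setU//.
  - congr Rintegral; apply/seteqP; split => t; rewrite /S /=.
      by rewrite (ltnS (pi t) k) (leq_eqVlt (pi t)) => /orP[/eqP|]; [right|left].
    by case=> [/ltnW|->].
  - exact: cell_measurable.
  - apply: (integrableS measurableT _ _ fi) => //.
    by apply: measurableU; [exact: mS|exact: cell_measurable].
  - by apply/disj_setPS => t [] /= + tk; rewrite /S /= tk ltnn.
by rewrite -H; congr Rintegral; apply/seteqP; split => t // _; exact: cell_lt.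
Qed.

Lemma Rintegral_cell_preimage pi (Y : set nat) f :
  mu.-integrable setT (EFin \o f) ->
  \int[mu]_(t in pi @^-1` Y) f t =
  \sum_(i < ncell pi | val i \in Y) \int[mu]_(t in pi @^-1` [set val i]) f t.
Proof.
move=> fi; have mY := measurable_cell_preimage pi Y.
rewrite Rintegral_mkcond (Rintegral_cells pi); last first.
  rewrite -restrict_EFin; apply/(integrable_mkcond _ mY).
  exact: integrableS fi.
rewrite [RHS]big_mkcond; apply: eq_bigr => i _.
case: ifPn => [|] iY.
  apply: eq_Rintegral => t; rewrite inE /= => ti.
  by rewrite patchE mem_set//= ti; exact: set_mem iY.
rewrite (@eq_Rintegral _ _ _ _ _ (cst 0)) ?Rintegral_cst ?mul0r//.
  exact: cell_measurable.
move=> t; rewrite inE /= => ti.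
by rewrite patchE memNset//= ti => Yi; rewrite (mem_set Yi) in iY.
Qed.

Lemma Rintegral_cell_step pi g i :
  \int[mu]_(t in pi @^-1` [set i]) g (pi t) = mass pi i * g i.
Proof.
rewrite (@eq_Rintegral _ _ _ _ _ (cst (g i))); last first.
  by move=> t; rewrite inE /= => ->.
by rewrite (Rintegral_cst mu (cell_measurable pi i)) mulrC.
Qed.

Lemma Rintegral_step pi g :
  \int[mu]_t g (pi t) = \sum_(i < ncell pi) mass pi i * g i.
Proof.
rewrite (Rintegral_cells pi (integrable_step pi g)).
by apply: eq_bigr => i _; exact: Rintegral_cell_step.
Qed.

(** Almost no point lies in a null cell, so the default value taken by the average there does not
    affect the class of a conditional expectation. *)
Lemma mass_neq0_ae pi : {ae mu, forall t, mass pi (pi t) != 0}.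
Proof.
have : mu.-negligible (\bigcup_i [set t | pi t = i /\ mass pi i = 0]).
  apply: negligible_bigcup => i; have [m0|m0] := eqVneq (mass pi i) 0.
    exists (pi @^-1` [set i]); split; [exact: cell_measurable|by apply: (etrans (massE pi i)); rewrite m0|].
    by move=> t [].
  exists set0; split => // t [_ /eqP]; by rewrite (negbTE m0).
apply: negligibleS => t /= /negP; rewrite negbK => /eqP m0.
by exists (pi t).
Qed.

End cell_integrals.

Section conditional_expectation.
Context d (T : measurableType d) (R : realType).
Variable mu : probability T R.
Variables (p : R) (p2 : 2 < p) (p1 : (1 <= p%:E)%E).
Local Notation V := (LspaceType mu p1).
Implicit Types (x y : V) (pi : fpart T).

Let p0 : 0 < p. Proof. exact: lt_trans p2. Qed.
Let p1' : 1 <= p. Proof. by rewrite -lee_fin. Qed.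

Lemma Lspace_integrable x : mu.-integrable setT (EFin \o (x : T -> R)).
Proof.
apply/Lfun1_integrable.
by apply: (Lfun_subset _ p1 _ _ (Lspace_Lfun x)); rewrite ?fin_num_measure.
Qed.

Lemma Lspace_integrable_cell pi i x :
  mu.-integrable (pi @^-1` [set i]) (EFin \o (x : T -> R)).
Proof.
exact: integrableS measurableT (cell_measurable pi i) _ (Lspace_integrable x).
Qed.

(* Equal to 0 on cells of mass 0. *)
Definition cellavg pi (f : T -> R) i : R :=
  (\int[mu]_(t in pi @^-1` [set i]) f t) / mass mu pi i.

Lemma step_Lfun pi (g : nat -> R) : (fun t => g (pi t)) \in Lfun mu p%:E.
Proof.
apply/andP; split; first by rewrite inE; exact: measurable_step.
rewrite inE /= /finite_norm unlock; apply: poweR_lty.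
have := integrable_step mu pi (fun i => `|g i| `^ p).
exact: integrable_lty.
Qed.

Definition cexp pi x : V := Lclass (Lfun_Sub p1 (step_Lfun pi (cellavg pi x))).

Lemma cexp_ae pi x : {ae mu, forall t, cexp pi x t = cellavg pi x (pi t)}.
Proof.
have := LclassK (Lfun_Sub p1 (step_Lfun pi (cellavg pi x))).
by apply: filterS => t /(_ I).
Qed.

Lemma ae_eq_Rintegral_cell pi i (f g : T -> R) :
  measurable_fun setT f -> measurable_fun setT g ->
  {ae mu, forall t, f t = g t} ->
  \int[mu]_(t in pi @^-1` [set i]) f t = \int[mu]_(t in pi @^-1` [set i]) g t.
Proof.
move=> mf mg fg; congr fine; apply: ae_eq_integral => //.
- exact: cell_measurable.
- exact/measurable_EFinP/measurable_funTS.
- exact/measurable_EFinP/measurable_funTS.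
- by apply: filterS fg => t /= ->.
Qed.

Lemma cellavg_linear pi i a x y :
  cellavg pi (a *: x + y) i = a * cellavg pi x i + cellavg pi y i.
Proof.
rewrite /cellavg mulrA -mulrDl; congr (_ / _).
have mA := cell_measurable pi i.
rewrite -RintegralZl//; last exact: Lspace_integrable_cell.
rewrite -RintegralD//; last 2 first.
- by have := integrableZl mA a (Lspace_integrable_cell pi i x).
- exact: Lspace_integrable_cell.
apply: ae_eq_Rintegral_cell.
- exact: Lspace_measurable.
- apply: measurable_funD; last exact: Lspace_measurable.
  by apply: measurable_funM => //; exact: Lspace_measurable.
- have := Lspace_add_ae (a *: x) y; have := Lspace_scale_ae a x.
  by apply: filterS2 => t <-.
Qed.

Lemma cexp_linear pi : linear (cexp pi).
Proof.
move=> a x y; apply: Lspace_eq_ae.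
have h : {ae mu, forall t,
    (a *: cexp pi x + cexp pi y) t = a * cexp pi x t + cexp pi y t}.
  have := Lspace_scale_ae a (cexp pi x).
  have := Lspace_add_ae (a *: cexp pi x) (cexp pi y).
  by apply: filterS2 => t -> ->.
have h2 : {ae mu, forall t,
    a * cexp pi x t + cexp pi y t = cexp pi (a *: x + y) t}.
  have := cexp_ae pi (a *: x + y); have := cexp_ae pi x; have := cexp_ae pi y.
  by apply: filterS3 => t -> -> ->; rewrite cellavg_linear.
by move: h h2; apply: filterS2 => t -> ->.
Qed.

HB.instance Definition _ pi :=
  GRing.isLinear.Build R V V _ (cexp pi) (cexp_linear pi).

(** Jensen's inequality on one cell: integrate the tangent to the power q at the absolute value of
    the average. *)
Lemma cellavg_jensen pi q i x : 1 <= q <= p ->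
  mass mu pi i * `|cellavg pi x i| `^ q <=
  \int[mu]_(t in pi @^-1` [set i]) (`|x t| `^ q).
Proof.
move=> qp; have q1 : 1 <= q by case/andP: qp.
have mA := cell_measurable pi i.
have xi : mu.-integrable (pi @^-1` [set i]) (EFin \o (fun t => `|x t|)).
  exact: integrable_norm (Lspace_integrable_cell pi i x).
have qi : mu.-integrable (pi @^-1` [set i]) (EFin \o (fun t => `|x t| `^ q)).
  exact: integrableS measurableT mA _ (powint_integrable x qp).
pose m := `|cellavg pi x i|.
pose c := q * m `^ (q - 1).
have ci (k : R) : mu.-integrable (pi @^-1` [set i]) (EFin \o (fun=> k)).
  exact: finite_measure_integrable_cst.
have dxi : mu.-integrable (pi @^-1` [set i]) (EFin \o (fun t => c * `|x t|)).
  by have := integrableZl mA c xi.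
pose h t := (m `^ q - c * m) + c * `|x t|.
have hi : mu.-integrable (pi @^-1` [set i]) (EFin \o h).
  by have := integrableD mA (ci (m `^ q - c * m)) dxi.
have : \int[mu]_(t in pi @^-1` [set i]) h t <=
       \int[mu]_(t in pi @^-1` [set i]) (`|x t| `^ q).
  apply: le_Rintegral => // t _.
  have := powR_tangent q1 (normr_ge0 _ : 0 <= m) (normr_ge0 (x t)).
  by rewrite /h /c -/m; lra.
apply: le_trans.
rewrite /h RintegralD// RintegralZl//.
rewrite (Rintegral_cst mu mA) -/(mass mu pi i).
have : m * mass mu pi i <= \int[mu]_(t in pi @^-1` [set i]) `|x t|.
  rewrite /m /cellavg normrM normfV (ger0_norm (mass_ge0 mu pi i)).
  have [->|m0] := eqVneq (mass mu pi i) 0; first by rewrite mulr0 Rintegral_ge0.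
  by rewrite divfK// le_normr_Rintegral// Lspace_integrable_cell.
have c0 : 0 <= c by rewrite mulr_ge0 ?powR_ge0// (le_trans ler01).
move=> /(ler_wpM2l c0); rewrite -/m; lra.
Qed.

Lemma powint_step q x pi (g : nat -> R) : {ae mu, forall t, x t = g (pi t)} ->
  powint q x = \sum_(i < ncell pi) mass mu pi i * `|g i| `^ q.
Proof.
move=> xg; rewrite -(Rintegral_step mu pi (fun i => `|g i| `^ q)).
apply: ae_eq_Rintegral.
- exact/measurable_fun_norm_powR/Lspace_measurable.
- exact: (measurable_step pi (fun i => `|g i| `^ q)).
- by apply: filterS xg => t ->.
Qed.

Lemma powint_cexp q pi x : powint q (cexp pi x) =
  \sum_(i < ncell pi) mass mu pi i * `|cellavg pi x i| `^ q.
Proof. exact: powint_step (cexp_ae pi x). Qed.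

Lemma powint_cexp_le q pi x : 1 <= q <= p ->
  powint q (cexp pi x) <= powint q x.
Proof.
move=> qp; rewrite powint_cexp /powint.
rewrite (Rintegral_cells pi (powint_integrable x qp)).
by apply: ler_sum => i _; exact: cellavg_jensen.
Qed.

Lemma norm_cexp_le pi x : `|cexp pi x| <= `|x|.
Proof.
rewrite leNgt; apply/negP => /(gt0_ltr_powR p0).
rewrite !nnegrE !normr_ge0 => /(_ isT isT); apply/negP; rewrite -leNgt.
by rewrite -!powint_norm powint_cexp_le// lexx p1'.
Qed.

Lemma cexp_step pi x (g : nat -> R) : {ae mu, forall t, x t = g (pi t)} ->
  cexp pi x = x.
Proof.
move=> xg; apply: Lspace_eq_ae.
have := cexp_ae pi x; have := xg; have := mass_neq0_ae mu pi.
apply: filterS3 => t m0 xt ->; rewrite xt.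
rewrite /cellavg (@ae_eq_Rintegral_cell _ _ _ (fun t => g (pi t))).
- by rewrite Rintegral_cell_step mulrC mulKf.
- exact: Lspace_measurable.
- exact: measurable_step.
- exact: xg.
Qed.

End conditional_expectation.

Section conditional_expectation_approximation.
Context d (T : measurableType d) (R : realType).
Variable mu : probability T R.
Variables (p : R) (p2 : 2 < p) (p1 : (1 <= p%:E)%E).
Local Notation V := (LspaceType mu p1).
Implicit Types (x y : V) (pi : fpart T).

Let p0 : 0 < p. Proof. exact: lt_trans p2. Qed.
Let q2p : 1 <= (2 : R) <= p. Proof. by rewrite ler1n ltW. Qed.

(** True on null cells too, where both sides vanish. *)
Lemma mass_cellavg pi i (f : T -> R) : mu.-integrable setT (EFin \o f) ->
  mass mu pi i * cellavg mu pi f i = \int[mu]_(t in pi @^-1` [set i]) f t.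
Proof.
move=> fi; rewrite /cellavg; have [m0|m0] := eqVneq (mass mu pi i) 0.
  have mA := cell_measurable pi i.
  rewrite m0 mul0r /Rintegral null_set_integral//.
  - exact/measurable_funTS/(measurable_int _ fi).
  - by apply: (etrans (massE mu pi i)); rewrite m0.
by rewrite mulrC divfK.
Qed.

Lemma cexp_towerr pi pi' x : refines pi pi' -> cexp pi' (cexp pi x) = cexp pi x.
Proof.
move=> [g gE]; apply: (@cexp_step _ _ _ _ _ _ _ _ (cellavg mu pi x \o g)) => //.
by have := cexp_ae pi x; apply: filterS => t ->; rewrite /= gE.
Qed.

Lemma cexp_idem pi x : cexp pi (cexp pi x) = cexp pi x.
Proof. exact/cexp_towerr/refines_refl. Qed.

Lemma eq_cexp pi x y : cellavg mu pi x =1 cellavg mu pi y -> cexp pi x = cexp pi y.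
Proof.
move=> xy; apply: Lspace_eq_ae.
by have := cexp_ae pi x; have := cexp_ae pi y; apply: filterS2 => t -> ->.
Qed.

Lemma cexp_towerl pi pi' x : refines pi pi' -> cexp pi (cexp pi' x) = cexp pi x.
Proof.
move=> [g gE]; apply: eq_cexp => i; rewrite /cellavg; congr (_ / _).
have -> : pi @^-1` [set i] = pi' @^-1` [set j | g j = i].
  by apply/seteqP; split => t /=; rewrite gE.
rewrite !Rintegral_cell_preimage//; [|exact: Lspace_integrable..].
apply: eq_bigr => j _; rewrite -(mass_cellavg pi' (val j) (Lspace_integrable x)).
rewrite (@ae_eq_Rintegral_cell _ _ _ _ _ _ _ (fun t => cellavg mu pi' x (pi' t))).
- exact: Rintegral_cell_step.
- exact: Lspace_measurable.
- exact: measurable_step.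
- exact: cexp_ae.
Qed.

(* Coordinates in which the range of [cexp pi] is isometric to a
   finite-dimensional l_p. *)
Definition cellfun pi i x : R := mass mu pi i `^ p^-1 * cellavg mu pi x i.

Lemma cellfun_linear pi i a x y :
  cellfun pi i (a *: x + y) = a * cellfun pi i x + cellfun pi i y.
Proof. by rewrite /cellfun cellavg_linear// mulrDr mulrCA. Qed.

Lemma norm_cexp_powR pi x :
  `|cexp pi x| `^ p = \sum_(i < ncell pi) `|cellfun pi i x| `^ p.
Proof.
rewrite -powint_norm powint_cexp; apply: eq_bigr => i _.
rewrite [in RHS]/cellfun [in RHS]normrM powRM// (ger0_norm (powR_ge0 _ _)) -powRrM mulVf ?gt_eqF//.
by rewrite powRr1 ?mass_ge0.
Qed.

Lemma norm_le_ae x (K : R) : 0 <= K -> {ae mu, forall t, `|x t| <= K} -> `|x| <= K.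
Proof.
move=> K0 xK; rewrite leNgt; apply/negP => /(gt0_ltr_powR p0).
rewrite !nnegrE normr_ge0 => /(_ K0 isT); apply/negP; rewrite -leNgt.
rewrite -powint_norm -[leRHS](Rintegral_prob_cst mu).
apply: ae_le_Rintegral; [exact: Lspace_integrable_powR|exact: Rintegrable_cst|].
by apply: filterS xK => t xK; rewrite ge0_ler_powR// ?nnegrE// ltW.
Qed.

(** By Jensen, the squared average over a cell times the mass of the cell is at most the squared
    L_2-norm. Hence the sum of the inverse masses bounds the sup; null cells add 0 to it. *)
Lemma cexp_sup_bound pi : exists2 C, 0 <= C & forall x,
  {ae mu, forall t, `|cexp pi x t| <= C * Num.sqrt (powint 2 x)}.
Proof.
pose C := \sum_(i < ncell pi) (mass mu pi i)^-1.
have C0 : 0 <= C by apply: sumr_ge0 => i _; rewrite invr_ge0 mass_ge0.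
exists (Num.sqrt C) => [|x]; first exact: sqrtr_ge0.
have := cexp_ae pi x; have := mass_neq0_ae mu pi; apply: filterS2 => t m0 ->.
have mp : 0 < mass mu pi (pi t) by rewrite lt0r m0 mass_ge0.
have x20 : 0 <= powint 2 x by exact: powint_ge0.
rewrite -sqrtrM// -[leLHS]ger0_norm// -sqrtr_sqr ler_wsqrtr//.
rewrite -powR_mulrn// -(ler_pM2l mp).
apply: (le_trans (cellavg_jensen pi (pi t) x q2p)).
apply: (@le_trans _ _ (powint 2 x)).
  rewrite /powint (Rintegral_cells pi (powint_integrable x q2p)).
  rewrite (bigD1 (Ordinal (cell_lt pi t)))//= lerDl sumr_ge0// => i _.
  by apply: Rintegral_ge0 => u _; exact: powR_ge0.
rewrite mulrA ler_peMl//.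
rewrite -(divff m0) ler_wpM2l ?(ltW mp)//.
rewrite /C (bigD1 (Ordinal (cell_lt pi t)))//= lerDl sumr_ge0// => i _.
by rewrite invr_ge0 mass_ge0.
Qed.

Lemma cexp_norm_bound pi : exists2 C, 0 <= C & forall x,
  `|cexp pi x| <= C * Num.sqrt (powint 2 x).
Proof.
have [C C0 HC] := cexp_sup_bound pi; exists C => // x.
by apply: norm_le_ae; [rewrite mulr_ge0 ?sqrtr_ge0|exact: HC].
Qed.

Lemma powint_tail x (e : R) : 0 < e -> exists M : nat,
  \int[mu]_t (`|x t| `^ p * \1_[set u | M%:R < `|x u|] t) <= e.
Proof.
move=> e0; have mx := Lspace_measurable x.
have mS (n : nat) : measurable [set u | n%:R < `|x u|].
  have mn : measurable_fun setT (fun u => `|x u|) by exact: measurableT_comp.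
  rewrite -[X in measurable X]setTI (_ : [set u | _] = (fun u => `|x u|) @^-1` `]n%:R, +oo[).
    exact: mn.
  by apply/seteqP; split => u /=; rewrite in_itv/= andbT.
pose h n t := (`|x t| `^ p * \1_[set u | n%:R < `|x u|] t)%:E.
have mh n : measurable_fun setT (h n).
  apply/measurable_EFinP/measurable_funM; last exact: measurable_indic.
  exact: measurable_fun_norm_powR.
have [||_ _] := @dominated_convergence _ _ _ mu setT measurableT h (cst 0)%E
    (EFin \o (fun t => `|x t| `^ p)) mh (measurable_cst _) _
    (Lspace_integrable_powR x) _.
- apply: aeW => t _; apply: cvg_near_cst.
  near=> n; rewrite /h indicE memNset ?mulr0//=.
  apply/negP; rewrite -leNgt; near: n; exact: nbhs_infty_ger.
- apply: aeW => t n _; rewrite /h abse_EFin lee_fin normrM (ger0_norm (powR_ge0 _ _)).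
  by rewrite ler_piMr ?powR_ge0// indicE; case: (_ \in _); rewrite ?normr1 ?normr0.
rewrite integral0 => /fine_cvgP[_ /cvgrPdist_le/(_ _ e0)[M _ HM]].
exists M; have := HM M (leqnn M); rewrite sub0r normrN; apply: le_trans.
exact: ler_norm.
Unshelve. all: by end_near.
Qed.

Section mesh.
Variables (x : V) (M N : nat).

(** Level sets of x of height 1/N. The shift by one frees index 0 for the points with |x| > M, where
    the approximation [mesh_value] is 0; the top index 2MN + 1 occurs at x = M. *)
Let c t : nat :=
  if `|x t| <= M%:R then (Num.truncn ((x t + M%:R) * N%:R)).+1 else 0%N.

Let c_lt t : (c t < (2 * M * N).+2)%N.
Proof.
rewrite /c; case: ifPn => // xM; rewrite !ltnS.
have [xM1 xM2] : - M%:R <= x t /\ x t <= M%:R by apply/andP; rewrite -ler_norml.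
have h0 : 0 <= (x t + M%:R) * N%:R by rewrite mulr_ge0//; lra.
rewrite -(ler_nat R); apply: (@le_trans _ _ ((x t + M%:R) * N%:R)).
  by rewrite truncn_le.
by rewrite !natrM ler_wpM2r//; lra.
Qed.

Let c_meas i : measurable (c @^-1` [set i]).
Proof.
have mx := Lspace_measurable x.
have mM : measurable [set t | `|x t| <= M%:R].
  rewrite (_ : [set t | _] = x @^-1` `[- M%:R, M%:R]).
    by rewrite -[X in measurable X]setTI; exact: mx.
  by apply/seteqP; split => t /=; rewrite in_itv/= ler_norml.
case: i => [|i].
  rewrite (_ : _ @^-1` _ = ~` [set t | `|x t| <= M%:R]); first exact: measurableC.
  by apply/seteqP; split => t; rewrite /preimage/= /c; case: ifPn.
have my : measurable_fun setT (fun t => (x t + M%:R) * N%:R).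
  by apply: measurable_funM => //; exact: measurable_funD.
rewrite (_ : _ @^-1` _ = [set t | `|x t| <= M%:R] `&`
    (fun t => (x t + M%:R) * N%:R) @^-1` `[i%:R, i.+1%:R[).
  by apply: measurableI => //; rewrite -[X in measurable X]setTI; exact: my.
apply/seteqP; split => t; rewrite /preimage/= /c.
  case: ifPn => // xM [<-]; split=> //.
  move: xM; rewrite ler_norml => /andP[xM1 xM2].
  by rewrite in_itv/=; apply: truncn_itv; rewrite mulr_ge0//; lra.
case=> xM; rewrite xM in_itv/= => ti; congr S.
exact/truncn_def.
Qed.

Definition mesh : fpart T := Fpart c_lt c_meas.

Definition mesh_value k : R := if k is k'.+1 then k'%:R / N%:R - M%:R else 0.

Lemma mesh_dist t : (0 < N)%N ->
  `|x t - mesh_value (mesh t)| `^ p <=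
  N%:R^-1 `^ p + `|x t| `^ p * \1_[set u | M%:R < `|x u|] t.
Proof.
move=> N0; have NR : 0 < N%:R :> R by rewrite ltr0n.
rewrite /mesh /= /c; case: ifPn => xM /=; last first.
  by rewrite subr0 indicE mem_set ?mulr1 ?lerDr ?powR_ge0//= ltNge.
rewrite ler_wpDr ?mulr_ge0 ?powR_ge0//.
rewrite ge0_ler_powR ?nnegrE ?invr_ge0 ?(ltW p0)//.
have [xM1 xM2] : - M%:R <= x t /\ x t <= M%:R by apply/andP; rewrite -ler_norml.
have h0 : 0 <= (x t + M%:R) * N%:R by rewrite mulr_ge0//; lra.
have := truncn_itv h0; set k := Num.truncn _ => /andP[k1 k2].
have -> : x t - (k%:R / N%:R - M%:R) = ((x t + M%:R) * N%:R - k%:R) / N%:R.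
  by field; rewrite gt_eqF.
have Ni : 0 <= N%:R^-1 :> R by rewrite invr_ge0 ltW.
rewrite normrM (ger0_norm Ni) ler_piMl//.
by rewrite ger0_norm ?subr_ge0//; move: k2; rewrite -natr1; lra.
Qed.

End mesh.

(** A step function y on a mesh of x lies within e / 2 of x and is fixed by every finer conditional
    expectation. These are contractions, so x moves by at most twice its distance to y. Having this
    for all finer partitions allows later joins. *)
Lemma cexp_dense x (e : R) : 0 < e ->
  exists pi, forall pi', refines pi pi' -> `|x - cexp pi' x| <= e.
Proof.
move=> e0; have ep : 0 < (e / 2) `^ p by rewrite powR_gt0// divr_gt0.
have [M HM] := powint_tail x (divr_gt0 ep (ltr0n R 2)).
pose N := (Num.truncn (2 / (e / 2) `^ p)).+1.
have NR : N%:R^-1 `^ p <= (e / 2) `^ p / 2.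
  have Ni : N%:R^-1 <= (e / 2) `^ p / 2.
    rewrite -[leRHS]invrK lef_pV2 ?posrE ?invr_gt0 ?divr_gt0 ?ltr0n//.
    by rewrite invf_div ltW// truncnS_gt.
  apply: le_trans Ni; apply: ge1r_powR => //.
  by rewrite invr_gt0 ltr0n/= invf_le1 ?ler1n ?ltr0n.
pose pi := mesh x M N.
have [y yE] : exists y : V, {ae mu, forall t, y t = mesh_value M N (pi t)}.
  exists (Lclass (Lfun_Sub p1 (step_Lfun mu p pi (mesh_value M N)))).
  have := LclassK (Lfun_Sub p1 (step_Lfun mu p pi (mesh_value M N))).
  by apply: filterS => t /(_ I).
have xy : `|x - y| <= e / 2.
  rewrite leNgt; apply/negP => /(gt0_ltr_powR p0).
  rewrite !nnegrE normr_ge0 divr_ge0 ?(ltW e0)// => /(_ isT isT).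
  apply/negP; rewrite -leNgt -powint_norm.
  pose h t := `|x t| `^ p * \1_[set u | M%:R < `|x u|] t.
  have hi : mu.-integrable setT (EFin \o h).
    apply: (le_integrable measurableT _ _ (Lspace_integrable_powR x)).
      apply/measurable_EFinP/measurable_funM.
        exact/measurable_fun_norm_powR/Lspace_measurable.
      apply: measurable_indic.
      have mn : measurable_fun setT (fun u => `|x u|).
        by apply: measurableT_comp => //; exact: Lspace_measurable.
      rewrite -[X in measurable X]setTI.
      rewrite (_ : [set u | _] = (fun u => `|x u|) @^-1` `]M%:R, +oo[); first exact: mn.
      by apply/seteqP; split => u /=; rewrite in_itv/= andbT.
    move=> t _; rewrite lee_fin /h /= normrM !(ger0_norm (powR_ge0 _ _)).
    by rewrite ler_piMr ?powR_ge0// indicE; case: (_ \in _); rewrite ?normr1 ?normr0.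
  apply: (@le_trans _ _ (\int[mu]_t (N%:R^-1 `^ p + h t))).
    apply: ae_le_Rintegral.
    - exact: Lspace_integrable_powR.
    - by apply: Rintegrable_add => //; exact: Rintegrable_cst.
    - have := Lspace_sub_ae x y; move: yE; apply: filterS2 => t yE ->.
      by rewrite yE; exact: mesh_dist.
  rewrite RintegralD//; last exact: Rintegrable_cst.
  by rewrite Rintegral_prob_cst; move: HM NR; rewrite -/h; lra.
exists pi => pi' [g gE].
have Ey : cexp pi' y = y.
  apply: (@cexp_step _ _ _ _ _ _ _ _ (mesh_value M N \o g)) => //.
  by apply: filterS yE => t ->; rewrite gE.
have -> : x - cexp pi' x = (x - y) - cexp pi' (x - y).
  by rewrite linearB/= Ey opprB addrA subrK.
apply: (le_trans (ler_normB _ _)).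
have := norm_cexp_le p2 pi' (x - y); lra.
Qed.

End conditional_expectation_approximation.

(** * Completeness *)

Section sequential_completeness.
Context (R : realType).

Definition cauchy_in (X : normedModType R) (u : nat -> X) :=
  forall e : R, 0 < e -> exists N, forall m n, (N <= m)%N -> (N <= n)%N ->
    `|u m - u n| <= e.

Definition tends_to (X : normedModType R) (u : nat -> X) (l : X) :=
  forall e : R, 0 < e -> exists N, forall n, (N <= n)%N -> `|u n - l| <= e.

(** Serves two ends: an embedding of a complete space has closed range, and infinite
    l_2-combinations of vectors of X converge. *)
Definition seq_complete (X : normedModType R) :=
  forall u : nat -> X, cauchy_in u -> exists l, tends_to u l.

Lemma tends_to_unique (X : normedModType R) (u : nat -> X) l l' :
  tends_to u l -> tends_to u l' -> l = l'.
Proof.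
move=> ul ul'; apply/eqP; rewrite -subr_eq0 -normr_eq0; apply/negPn/negP => n0.
have d0 : 0 < `|l - l'| / 3 by rewrite divr_gt0// lt0r n0 normr_ge0.
have [N HN] := ul _ d0; have [N' HN'] := ul' _ d0.
pose n := maxn N N'.
have h1 := HN n (leq_maxl _ _); have h2 := HN' n (leq_maxr _ _).
have : `|l - l'| <= `|u n - l'| + `|u n - l|.
  by rewrite (le_trans _ (ler_normB _ _))// opprB addrCA addrAC subrr add0r addrC.
have : 0 < `|l - l'| by rewrite lt0r n0 normr_ge0.
lra.
Qed.

Lemma tends_to_cauchy (X : normedModType R) (u : nat -> X) l :
  tends_to u l -> cauchy_in u.
Proof.
move=> ul e e0; have [N HN] := ul _ (divr_gt0 e0 (ltr0n R 2)).
exists N => m n Nm Nn; have := HN _ Nm; have := HN _ Nn.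
have -> : u m - u n = (u m - l) - (u n - l) by rewrite opprB addrA subrK.
move=> h1 h2; rewrite (le_trans (ler_normB _ _))//; lra.
Qed.

Lemma tends_to_norm_le (X : normedModType R) (u : nat -> X) l (C : R) N :
  (forall n, (N <= n)%N -> `|u n| <= C) -> tends_to u l -> `|l| <= C.
Proof.
move=> uC ul; rewrite leNgt; apply/negP => Cl.
have [M HM] := ul ((`|l| - C) / 2) ltac:(by rewrite divr_gt0// subr_gt0).
pose n := maxn N M; have h1 := uC n (leq_maxl _ _); have h2 := HM n (leq_maxr _ _).
have : `|l| <= `|u n| + `|u n - l|.
  by rewrite (le_trans _ (ler_normB _ _))// opprB addrCA subrr addr0.
lra.
Qed.

Lemma tends_to_norm_ge (X : normedModType R) (u : nat -> X) l (C : R) N :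
  (forall n, (N <= n)%N -> C <= `|u n|) -> tends_to u l -> C <= `|l|.
Proof.
move=> uC ul; rewrite leNgt; apply/negP => Cl.
have [M HM] := ul ((C - `|l|) / 2) ltac:(by rewrite divr_gt0// subr_gt0).
pose n := maxn N M; have h1 := uC n (leq_maxl _ _); have h2 := HM n (leq_maxr _ _).
have : `|u n| <= `|l| + `|u n - l|.
  by rewrite (le_trans _ (ler_normD _ _))// addrC subrK.
lra.
Qed.

Lemma tends_to_linear (X : normedModType R) (u v : nat -> X) l l' (a : R) :
  tends_to u l -> tends_to v l' -> tends_to (fun n => a *: u n + v n) (a *: l + l').
Proof.
move=> ul vl e e0; have a1 : 0 < `|a| + 1 by rewrite ltr_wpDl.
have [N HN] := ul _ (divr_gt0 (divr_gt0 e0 (ltr0n R 2)) a1).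
have [M HM] := vl _ (divr_gt0 e0 (ltr0n R 2)).
exists (maxn N M) => n; rewrite geq_max => /andP[/HN h1 /HM h2].
have -> : a *: u n + v n - (a *: l + l') = a *: (u n - l) + (v n - l').
  by rewrite scalerBr opprD addrACA.
rewrite (le_trans (ler_normD _ _))// normrZ.
have : `|a| * `|u n - l| <= (`|a| + 1) * (e / 2 / (`|a| + 1)).
  by rewrite ler_pM// lerDl.
rewrite [leRHS]mulrC divfK ?gt_eqF//; lra.
Qed.

End sequential_completeness.

Lemma cvg_powR (R : realType) (p l : R) (u : nat -> R) : 1 <= p ->
  (forall n, 0 <= u n) -> 0 <= l ->
  u @ \oo --> l -> (fun n => u n `^ p) @ \oo --> l `^ p.
Proof.
move=> p1 u0 l0 /cvgrPdist_le ul; apply/cvgrPdist_le => e e0.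
have c0 : 0 < p * (l + 1) `^ (p - 1).
  by rewrite mulr_gt0 ?(lt_le_trans _ p1)// powR_gt0// ltr_wpDl.
have m0 : 0 < Num.min 1 (e / (p * (l + 1) `^ (p - 1))).
  by rewrite lt_min ltr01 divr_gt0.
apply: filterS (ul _ m0) => n; rewrite le_min => /andP[h1 h2].
have un : 0 <= u n <= l + 1.
  by rewrite u0/=; move: h1; rewrite ler_norml; lra.
have ln : 0 <= l <= l + 1 by rewrite l0/= lerDl ler01.
rewrite (le_trans (powR_lipschitz p1 ln un))//.
by rewrite -ler_pdivlMl// mulrC.
Qed.

Section riesz_fischer.
Context d (T : measurableType d) (R : realType).
Variable mu : {measure set T -> \bar R}.
Variables (p : R) (p1 : (1 <= p%:E)%E).
Local Notation V := (LspaceType mu p1).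

Let p1' : 1 <= p. Proof. by rewrite -lee_fin. Qed.
Let p0 : 0 < p. Proof. exact: lt_le_trans p1'. Qed.

Lemma Lspace_norm_le (x : V) (K : R) : 0 <= K ->
  (\int[mu]_t (`|x t| `^ p)%:E <= (K `^ p)%:E)%E -> `|x| <= K.
Proof.
move=> K0 h; rewrite leNgt; apply/negP => /(gt0_ltr_powR p0).
rewrite !nnegrE normr_ge0 => /(_ K0 isT); apply/negP; rewrite -leNgt.
rewrite Lspace_norm_powR -lee_fin fineK//.
by rewrite integrable_fin_num// Lspace_integrable_powR.
Qed.

Lemma Lspace_integral_powR (x : V) :
  (\int[mu]_t (`|x t| `^ p)%:E = (`|x| `^ p)%:E)%E.
Proof.
rewrite Lspace_norm_powR fineK//.
by rewrite integrable_fin_num// Lspace_integrable_powR.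
Qed.

Section fast_cauchy.
Variable v : nat -> V.
Hypothesis fast : forall k, `|v k.+1 - v k| <= 4^-1 ^+ k.

Let a k t : R := 2 ^+ k * `|(v k.+1 - v k) t|.

Let ma k : measurable_fun setT (fun t => (a k t `^ p)%:E).
Proof.
apply/measurable_EFinP; apply: (measurableT_comp (measurable_powR p)).
apply: measurable_funM => //.
by apply: measurableT_comp => //; exact: Lspace_measurable.
Qed.

Let int_a k : (\int[mu]_t (a k t `^ p)%:E <= (2^-1 ^+ k)%:E)%E.
Proof.
rewrite (_ : (fun t => _) = (fun t => ((2 ^+ k) `^ p)%:E *
    (`|(v k.+1 - v k) t| `^ p)%:E)%E); last first.
  by apply/funext => t; rewrite -EFinM -powRM// exprn_ge0.
rewrite integralZl//; last exact: Lspace_integrable_powR.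
rewrite Lspace_integral_powR -EFinM lee_fin -powRM ?exprn_ge0//.
apply: (@le_trans _ _ ((2^-1 ^+ k) `^ p)).
  rewrite ge0_ler_powR ?(ltW p0)// ?nnegrE ?mulr_ge0 ?exprn_ge0//.
  apply: (@le_trans _ _ (2 ^+ k * 4^-1 ^+ k)).
    by rewrite ler_wpM2l ?exprn_ge0.
  by rewrite -exprMn (_ : 2 * 4^-1 = 2^-1 :> R)//; field.
rewrite ge1r_powR// exprn_gt0//= exprn_ile1//; lra.
Qed.

(** Even after the weight 2^k, the integrals of the p-th powers of the increments are at most 2^-k.
    Their sum G is therefore finite almost everywhere, and G^(1/p) bounds every weighted
    increment. *)
Lemma fast_cauchy_bounded_ae : {ae mu, forall t, exists2 K, 0 <= K &
  forall k, `|(v k.+1 - v k) t| <= K * 2^-1 ^+ k}.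
Proof.
pose G t := (\sum_(k <oo) (a k t `^ p)%:E)%E.
have G0 t k : (0 <= (a k t `^ p)%:E)%E by rewrite lee_fin powR_ge0.
have Gge0 t : (0 <= G t)%E by apply: nneseries_ge0 => k _ _; exact: G0.
have mG : measurable_fun setT G.
  by apply: ge0_emeasurable_sum => [k t _ _|k _]; [exact: G0|exact: ma].
have intG : mu.-integrable setT G.
  apply/integrableP; split=> //.
  have -> : (\int[mu]_t `|G t| = \int[mu]_t G t)%E.
    by apply: eq_integral => t _; rewrite gee0_abs.
  have -> : (\int[mu]_t G t = \sum_(k <oo) \int[mu]_t (a k t `^ p)%:E)%E.
    by apply: integral_nneseries => // k t _; exact: G0.
  apply: (@le_lt_trans _ _ (\sum_(k <oo) (2^-1 ^+ k)%:E)%E).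
    apply: lee_nneseries => [k *|k *]; last exact: int_a.
    by apply: integral_ge0 => t _; exact: G0.
  have : cvgn (series (geometric 1 (2^-1 : R))).
    by apply: is_cvg_geometric_series; rewrite ger0_norm//; lra.
  move=> /cvg_ex[l hl].
  suff -> : (\sum_(k <oo) (2^-1 ^+ k)%:E)%E = l%:E by exact: ltry.
  apply/cvg_lim => //.
  have E n : (\sum_(0 <= k < n) (2^-1 ^+ k)%:E = (series (geometric 1 (2^-1 : R)) n)%:E)%E.
    by rewrite /series/= -sumEFin; apply: eq_bigr => k _; rewrite /= mul1r.
  apply: cvg_EFin; first by apply: nearW => n; rewrite E.
  by move: hl; apply: cvg_trans; apply: near_eq_cvg; apply: nearW => n /=; rewrite E.
have := integrable_ae measurableT intG; apply: filterS => t /(_ I) Gfin.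
pose g := fine (G t).
have g0 : 0 <= g by rewrite fine_ge0.
exists (g `^ p^-1) => [|k]; first exact: powR_ge0.
have ag : a k t `^ p <= g.
  rewrite -lee_fin fineK//.
  apply: le_trans (nneseries_lim_ge k.+1 _); last by move=> *; exact: G0.
  by rewrite big_nat_recr//= leeDr// sume_ge0// => *; exact: G0.
have ak0 : 0 <= a k t by rewrite mulr_ge0// exprn_ge0.
have : a k t <= g `^ p^-1.
  rewrite -[leLHS](powRr1 ak0) -(mulfV (lt0r_neq0 p0)) powRrM.
  by rewrite ge0_ler_powR ?nnegrE ?powR_ge0// invr_ge0 ltW.
rewrite /a => h; rewrite exprVn ler_pdivlMr ?exprn_gt0// mulrC.
exact: h.
Qed.

Lemma fast_cauchy_cvg_ae : {ae mu, forall t, cvgn (fun k => v k t)}.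
Proof.
have H : {ae mu, forall t, forall k, (v k.+1 - v k) t = v k.+1 t - v k t}.
  by apply/ae_foralln => k; exact: Lspace_sub_ae.
have := fast_cauchy_bounded_ae; move: H; apply: filterS2 => t H [K K0 HK].
have -> : (fun k => v k t) =
    (fun k => v 0%N t + series (telescope (fun k => v k t)) k).
  by apply/funext => k; exact: eq_sum_telescope.
apply: is_cvgD; first exact: is_cvg_cst.
apply: normed_cvg.
apply: (@series_le_cvg _ _ (geometric K 2^-1)).
- by move=> n /=.
- by move=> n; rewrite /= mulr_ge0// exprn_ge0.
- by move=> n; have := HK n; rewrite H.
- by apply: is_cvg_geometric_series; rewrite ger0_norm//; lra.
Qed.

Lemma fast_cauchy_limit (e : nat -> R) : (forall k, 0 <= e k) ->
  (forall k m, (k <= m)%N -> `|v m - v k| <= e k) ->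
  exists l : V, forall k, `|l - v k| <= e k.
Proof.
move=> e0 ve.
(* A limit superior is measurable as it stands, and it equals the limit almost everywhere. *)
pose f t := fine (limn_esup (fun k => (v k t)%:E)).
have mf : measurable_fun setT f.
  apply: measurableT_comp; first exact: fine_measurable.
  apply: measurable_fun_limn_esup => n.
  exact/measurable_EFinP/Lspace_measurable.
have vf : {ae mu, forall t, (fun k => v k t) @ \oo --> f t}.
  have := fast_cauchy_cvg_ae; apply: filterS => t /cvg_ex[l vl].
  have /cvg_limn_einf_sup[_] : (fun k => (v k t)%:E) @ \oo --> l%:E.
    by apply: cvg_EFin => //; exact: nearW.
  by rewrite /f => ->.
have F k : (\int[mu]_t (`|f t - v k t| `^ p)%:E <= (e k `^ p)%:E)%E.
  pose h m t := (`|(v m - v k) t| `^ p)%:E.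
  have mh m : measurable_fun setT (h m).
    exact/measurable_EFinP/measurable_fun_norm_powR/Lspace_measurable.
  have H : {ae mu, forall t, forall m, (v m - v k) t = v m t - v k t}.
    by apply/ae_foralln => m; exact: Lspace_sub_ae.
  have -> : (\int[mu]_t (`|f t - v k t| `^ p)%:E =
             \int[mu]_t limn_einf (h ^~ t))%E.
    apply: ge0_ae_eq_integral => //.
    - apply/measurable_EFinP/measurable_fun_norm_powR/measurable_funB => //.
      exact: Lspace_measurable.
    - under eq_fun do rewrite limn_einf_lim.
      have := @measurable_fun_limn_esup _ _ _ setT (fun m t => - h m t)%E.
      move=> /(_ (fun m => measurableT_comp (@oppe_measurable _ _) (mh m))) H1.
      have : measurable_fun setT (fun t => - limn_esup (fun m => - h m t))%E.
        exact: measurableT_comp.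
      congr (measurable_fun _ _); apply/funext => t.
      by rewrite -limn_einf_lim.
    - move=> t _; rewrite limn_einf_lim; apply: lime_ge; first exact: is_cvg_einfs.
      apply: nearW => m; apply: le_ereal_inf_tmp => _ [j _ <-].
      by rewrite /h lee_fin powR_ge0.
    - move: vf H; apply: filterS2 => t vt H _.
      have /cvg_limn_einf_sup[-> _]// : h ^~ t @ \oo --> (`|f t - v k t| `^ p)%:E.
      apply: cvg_EFin; first exact: nearW.
      rewrite (_ : _ \o _ = fun m => `|v m t - v k t| `^ p); last first.
        by apply/funext => m; rewrite /h /= H.
      have : (fun m => `|v m t - v k t|) @ \oo --> `|f t - v k t|.
        by apply: cvg_norm; apply: cvgB => //; exact: cvg_cst.
      exact: cvg_powR.
  have h0 m t : [set: T] t -> (0 <= h m t)%E by rewrite /h lee_fin powR_ge0.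
  apply: le_trans (fatou mu measurableT mh h0) _.
  rewrite limn_einf_lim; apply: lime_le; first exact: is_cvg_einfs.
  apply: nearW => n; apply: (@le_trans _ _ (\int[mu]_t h (maxn n k) t)%E).
    by apply: ereal_inf_lbound; exists (maxn n k) => //=; rewrite leq_maxl.
  rewrite Lspace_integral_powR lee_fin ge0_ler_powR ?nnegrE ?(ltW p0)//.
  by apply: ve; rewrite leq_maxr.
(* Fatou bounds f - v 0, not f itself; so the difference is turned into a class and v 0 is added
   back. *)
have [z zE] : exists z : V, (z : T -> R) = (fun t => f t - v 0%N t) %[ae mu].
  apply: Lclass_exists; first by apply: measurable_funB => //; exact: Lspace_measurable.
  by rewrite (le_lt_trans (F 0%N))// ltry.
exists (z + v 0%N) => k; apply: Lspace_norm_le => //.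
apply: le_trans (F k); rewrite le_eqVlt; apply/orP; left; apply/eqP.
apply: ge0_ae_eq_integral => //.
- exact/measurable_EFinP/measurable_fun_norm_powR/Lspace_measurable.
- apply/measurable_EFinP/measurable_fun_norm_powR/measurable_funB => //.
  exact: Lspace_measurable.
- have := Lspace_sub_ae (z + v 0%N) (v k); have := Lspace_add_ae z (v 0%N).
  move: zE; apply: filterS3 => t zE -> -> _.
  by rewrite zE// subrK.
Qed.

End fast_cauchy.

Lemma Lspace_seq_complete : seq_complete (V : normedModType R).
Proof.
move=> u cu.
have c0 k : 0 < 4^-1 ^+ k :> R by rewrite exprn_gt0// invr_gt0.
have [N HN] := choice (fun k => cu _ (c0 k)).
(* Partial sums stay beyond [N k] and make the chosen indices nondecreasing. *)
pose M k := (\sum_(j < k.+1) N j)%N.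
have NM k : (N k <= M k)%N by rewrite /M big_ord_recr/= leq_addl.
have MM k m : (k <= m)%N -> (M k <= M m)%N.
  elim: m => [|m IH]; first by rewrite leqn0 => /eqP ->.
  rewrite leq_eqVlt => /predU1P[->//|]; rewrite ltnS => /IH/leq_trans; apply.
  by rewrite /M [leqRHS]big_ord_recr leq_addr.
have vv k m : (k <= m)%N -> `|u (M m) - u (M k)| <= 4^-1 ^+ k.
  by move=> km; apply: HN; rewrite ?(leq_trans (NM k))// MM.
have [k|k|l lv] := @fast_cauchy_limit (u \o M) _ (fun k => 4^-1 ^+ k) _ vv.
- exact: vv.
- exact: ltW.
exists l => e e0.
have [K HK] : exists K, 4^-1 ^+ K <= e / 2 :> R.
  have : (geometric 1 (4^-1 : R)) @ \oo --> 0.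
    by apply: cvg_geometric; rewrite ger0_norm//; lra.
  move=> /cvgrPdist_le/(_ _ (divr_gt0 e0 (ltr0n R 2)))[K _ HK].
  exists K; have := HK K (leqnn K); rewrite /= mul1r sub0r normrN.
  exact: le_trans (ler_norm _).
exists (N K) => n Kn; have h1 := HN K n (M K) Kn (NM K); have h2 := lv K.
have -> : u n - l = (u n - u (M K)) - (l - u (M K)) by rewrite opprB addrA subrK.
by rewrite (le_trans (ler_normB _ _))//; lra.
Qed.

End riesz_fischer.

Section ranges_of_embeddings.
Context (R : realType).
Implicit Types X Y Z : normedModType R.

Lemma norm_bounded_continuous X Y (f : {linear X -> Y}) (K : R) :
  (forall x, `|f x| <= K * `|x|) -> continuous f.
Proof.
move=> fK; apply/bounded_linear_continuous/linear_boundedP.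
near=> r => x; apply: (le_trans (fK x)); rewrite ler_wpM2r//.
Unshelve. all: by end_near.
Qed.

Lemma closed_of_tends_to X (A : set X) :
  (forall (u : nat -> X) l, (forall n, A (u n)) -> tends_to u l -> A l) ->
  closed A.
Proof.
move=> H l cl.
have inv0 (n : nat) : 0 < n.+1%:R^-1 :> R by rewrite invr_gt0.
have U n : exists x, A x /\ `|x - l| <= n.+1%:R^-1.
  have [|x [Ax]] := cl (ball l n.+1%:R^-1); first exact: nbhsx_ballx.
  rewrite -ball_normE /ball_ /= => xl; exists x; split=> //.
  by rewrite distrC ltW.
have [u Hu] := choice U; apply: (H u) => [n|e e0]; first by case: (Hu n).
exists (Num.truncn e^-1) => n Nn; apply: (le_trans (proj2 (Hu n))).
rewrite -[leRHS]invrK lef_pV2 ?posrE ?invr_gt0//.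
by rewrite ltW// (lt_le_trans (truncnS_gt _))// ler_nat ltnS.
Qed.

Lemma closed_tends_to X (A : set X) (u : nat -> X) l :
  closed A -> (forall n, A (u n)) -> tends_to u l -> A l.
Proof.
move=> cA Au ul; apply: cA => B /nbhs_ballP[e /= e0 eB].
have [N HN] := ul _ (divr_gt0 e0 (ltr0n R 2)).
exists (u N); split; first exact: Au.
apply: eB; rewrite -ball_normE /ball_ /= distrC.
by rewrite (le_lt_trans (HN N _))//; lra.
Qed.

Lemma closed_subspace_complete X (Z : closed_subspace X) :
  seq_complete X -> seq_complete (Z : normedModType R).
Proof.
move=> cX u cu.
have [l ul] := cX (fun n => val (u n)) cu.
have Zl : l \in subspace_pred Z.
  apply/mem_set; apply: (closed_tends_to (@subspace_closed _ _ Z) _ ul) => n.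
  by have := subspace_valP (u n); rewrite inE.
by exists (SubspaceElt Zl) => e e0; exact: ul.
Qed.

(** The lower bound turns a convergent sequence of images into a Cauchy sequence of preimages, whose
    limit is sent to the given limit. The inverse comes from choice and is linear because f is
    injective. *)
Lemma range_closed_subspace X Y (f : {linear X -> Y}) (c : R) :
  seq_complete X -> 0 < c -> (forall x, c * `|x| <= `|f x|) ->
  (exists2 K, 0 < K & forall x, `|f x| <= K * `|x|) ->
  exists (Z : closed_subspace Y) (g : {linear X -> Z}) (h : {linear Z -> X}),
    [/\ cancel g h, cancel h g & forall x, val (g x) = f x].
Proof.
move=> cX c0 fc fK.
have subm : submod_closed (mem (range f)).
  split; first by rewrite inE; exists 0; rewrite // linear0.
  move=> a _ _ /set_mem[x _ <-] /set_mem[y _ <-]; rewrite inE.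
  by exists (a *: x + y); rewrite // linearP.
have clos : closed (range f).
  apply: closed_of_tends_to => u l uf ul.
  have uf' n : exists x, f x = u n by have [x _ xe] := uf n; exists x.
  have [v Hv] := choice uf'.
  have [|w vw] := cX v.
    move=> e e0; have [N HN] := tends_to_cauchy ul (mulr_gt0 c0 e0).
    exists N => m n Nm Nn; have := HN _ _ Nm Nn.
    rewrite -!Hv -linearB => /(le_trans (fc _)).
    by rewrite ler_pM2l.
  exists w => //; apply: tends_to_unique ul => e e0.
  have [K K0 fK'] := fK.
  have [N HN] := vw _ (divr_gt0 e0 K0); exists N => n /HN h.
  rewrite -Hv -linearB (le_trans (fK' _))//.
  by rewrite -ler_pdivlMl// mulrC.
pose Z := ClosedSubspace subm clos.
have gP x : f x \in subspace_pred Z by apply/mem_set; exists x.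
pose g x : Z := SubspaceElt (gP x).
have g_linear : linear g.
  by move=> a x y; apply: val_inj; rewrite /= linearP.
have zP (z : Z) : exists x, f x = val z.
  by have /set_mem[x _ xz] := subspace_valP z; exists x.
have [h hE] := choice zP.
have finj x y : f x = f y -> x = y.
  move=> fxy; apply/eqP; rewrite -subr_eq0 -normr_le0 -(pmulr_rle0 _ c0).
  by rewrite (le_trans (fc _))// linearB fxy subrr normr0.
have h_linear : linear h.
  by move=> a x y; apply: finj; rewrite linearP !hE.
pose g' : {linear X -> Z} := HB.pack g (GRing.isLinear.Build R X Z _ g g_linear).
pose h' : {linear Z -> X} := HB.pack h (GRing.isLinear.Build R Z X _ h h_linear).
exists Z, g', h'; split=> //.
- by move=> x; apply: finj; rewrite hE.
- by move=> z; apply: val_inj; rewrite /= hE.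
Qed.

End ranges_of_embeddings.

(** * The sequence spaces l_p *)

Section sequence_spaces.
Context (R : realType).
Variables (q : R) (q1 : (1 <= q%:E)%E).
Local Notation V := (LspaceType (counting : {measure set nat -> \bar R}) q1).
Implicit Types x y : V.

Let q1' : 1 <= q. Proof. by rewrite -lee_fin. Qed.
Let q0 : 0 < q. Proof. exact: lt_le_trans q1'. Qed.

Lemma counting_ae (P : nat -> Prop) :
  {ae (counting : {measure set nat -> \bar R}), forall n, P n} -> forall n, P n.
Proof.
move=> [A [mA A0 PA]] n; apply: contrapT => nP.
have An : A n by exact: PA.
have : (\sum_(k <oo) (\1_A k : R)%:E = 0)%E.
  rewrite -ge0_integral_count => [|k]; last by rewrite lee_fin.
  by rewrite integral_indic// setIT.
apply/eqP; rewrite gt_eqF//; apply: (@lt_le_trans _ _ (\1_A n : R)%:E).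
  by rewrite indicE mem_set.
apply: le_trans (nneseries_lim_ge n.+1 _); last by move=> k _ _; rewrite lee_fin.
by rewrite big_nat_recr//= leeDr// sume_ge0// => k _; rewrite lee_fin.
Qed.

Lemma lp_eq x y : (forall k, x k = y k) -> x = y.
Proof. by move=> xy; apply: Lspace_eq_ae; exact: aeW. Qed.

Lemma lp_coord_linear a x y k : (a *: x + y) k = a * x k + y k.
Proof.
have H1 := counting_ae (Lspace_add_ae (a *: x) y).
by rewrite H1 (counting_ae (Lspace_scale_ae a x)).
Qed.

Lemma lp_norm_powR x :
  ((`|x| `^ q)%:E = \sum_(k <oo) (`|x k| `^ q)%:E)%E.
Proof.
by rewrite -Lspace_integral_powR ge0_integral_count// => k; rewrite lee_fin powR_ge0.
Qed.

Lemma lp_partial_sum_le x n : \sum_(k < n) `|x k| `^ q <= `|x| `^ q.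
Proof.
rewrite -lee_fin lp_norm_powR -sumEFin.
rewrite -(big_mkord xpredT (fun k => (`|x k| `^ q)%:E)).
by apply: nneseries_lim_ge => k _ _; rewrite lee_fin powR_ge0.
Qed.

Lemma lp_norm_le x (K : R) : 0 <= K ->
  (forall n, \sum_(k < n) `|x k| `^ q <= K `^ q) -> `|x| <= K.
Proof.
move=> K0 xK; rewrite leNgt; apply/negP => /(gt0_ltr_powR q0).
rewrite !nnegrE normr_ge0 => /(_ K0 isT); apply/negP; rewrite -leNgt.
rewrite -lee_fin lp_norm_powR; apply: lime_le.
  by apply: is_cvg_nneseries => k _ _; rewrite lee_fin powR_ge0.
apply: nearW => n; rewrite (big_mkord xpredT (fun k => (`|x k| `^ q)%:E)).
by rewrite sumEFin lee_fin.
Qed.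

Lemma lp_tail x (e : R) : 0 < e -> exists n, `|x| `^ q <= \sum_(k < n) `|x k| `^ q + e.
Proof.
move=> e0; apply: contrapT => H.
have xp := powR_ge0 `|x| q.
have Hn n : \sum_(k < n) `|x k| `^ q <= `|x| `^ q - e.
  rewrite lerBrDr leNgt; apply/negP => h; apply: H; exists n; exact: ltW.
have Ke : 0 <= `|x| `^ q - e by have := Hn 0%N; rewrite big_ord0.
have : `|x| <= (`|x| `^ q - e) `^ q^-1.
  apply: lp_norm_le => [|n]; first exact: powR_ge0.
  by rewrite -powRrM mulVf ?gt_eqF// powRr1.
move=> /(ge0_ler_powR (ltW q0)); rewrite !nnegrE normr_ge0 powR_ge0.
by move=> /(_ isT isT); rewrite -powRrM mulVf ?gt_eqF// powRr1//; lra.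
Qed.

Lemma lp_exists (f : nat -> R) (K : R) :
  (forall n, \sum_(k < n) `|f k| `^ q <= K) -> exists x, forall k, x k = f k.
Proof.
move=> fK.
have mf : measurable_fun setT f by [].
have [|x xf] := @Lclass_exists _ _ _ (counting : {measure set nat -> \bar R}) q q1 f mf.
  rewrite ge0_integral_count; last by move=> k; rewrite lee_fin powR_ge0.
  apply: (@le_lt_trans _ _ K%:E); last exact: ltry.
  apply: lime_le; first by apply: is_cvg_nneseries => k _ _; rewrite lee_fin powR_ge0.
  apply: nearW => n; rewrite (big_mkord xpredT (fun k => (`|f k| `^ q)%:E)).
  by rewrite sumEFin lee_fin.
by exists x => k; apply: (counting_ae xf).
Qed.

End sequence_spaces.

Lemma sum_cutoff_le (R : realDomainType) (g : nat -> R) n m :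
  (forall k, 0 <= g k) ->
  \sum_(k < m) (if (k < n)%N then g k else 0) <= \sum_(k < n) g k.
Proof.
move=> g0; have f0 k : 0 <= (if (k < n)%N then g k else 0) by case: ifP.
apply: (@le_trans _ _ (\sum_(k < m + n) (if (k < n)%N then g k else 0))).
  by rewrite big_split_ord /= lerDl sumr_ge0.
rewrite addnC big_split_ord /= [X in _ + X]big1 ?addr0.
  by apply: ler_sum => k _; rewrite ltn_ord.
by move=> k _; rewrite ltnNge leq_addr.
Qed.

Lemma sum_widen_le (R : realDomainType) (g : nat -> R) n m :
  (forall k, 0 <= g k) -> (n <= m)%N ->
  \sum_(k < n) g k <= \sum_(k < m) g k.
Proof.
by move=> g0 nm; rewrite -(subnKC nm) big_split_ord /= lerDl sumr_ge0.
Qed.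

(** * Growth of norms: l_2 does not embed into l_p *)

Section l2_does_not_embed.
Context (R : realType).
Variables (p : R) (p2 : 2 < p) (p1 : (1 <= p%:E)%E).
Local Notation lpT := (LspaceType (counting : {measure set nat -> \bar R}) p1).
Local Notation l2T := (LspaceType (counting : {measure set nat -> \bar R}) (@lee1n R 2)).

Let p0 : 0 < p. Proof. exact: lt_trans p2. Qed.
Let p1' : 1 <= p. Proof. by rewrite -lee_fin. Qed.

Lemma l2_unit_vector i : exists e : l2T, forall k, e k = (k == i)%:R.
Proof.
apply: (@lp_exists _ _ _ _ 1) => n.
have [ni|ni] := ltnP i n.
  rewrite (bigD1 (Ordinal ni))//= eqxx normr1 powR1 big1 ?addr0// => k ki.
  rewrite (negbTE (_ : val k != i)) ?normr0 ?powR0//.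
rewrite big1// => k _; rewrite (_ : (val k == i) = false) ?normr0 ?powR0//.
by apply/negbTE; rewrite neq_ltn (leq_trans (ltn_ord k) ni).
Qed.

Lemma lp_coord_le (x : lpT) k : `|x k| <= `|x|.
Proof.
rewrite leNgt; apply/negP => /(gt0_ltr_powR p0).
rewrite !nnegrE !normr_ge0 => /(_ isT isT); apply/negP; rewrite -leNgt.
apply: le_trans (lp_partial_sum_le x k.+1).
by rewrite big_ord_recr /= lerDr sumr_ge0// => i _; exact: powR_ge0.
Qed.

Variable U : {linear l2T -> lpT}.
Variables (a A : R).
Hypothesis a0 : 0 < a.
Hypothesis A0 : 0 < A.
Hypothesis Ua : forall b, a * `|b| <= `|U b|.
Hypothesis UA : forall b, `|U b| <= A * `|b|.

Let unit := projT1 (choice l2_unit_vector).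
Let unitE i k : unit i k = (k == i)%:R.
Proof. exact: (projT2 (choice l2_unit_vector) i k). Qed.

Let norm_unit i : `|unit i| <= 1.
Proof.
apply: lp_norm_le => // n; rewrite powR1.
under eq_bigr do rewrite unitE.
have [ni|ni] := ltnP i n.
  rewrite (bigD1 (Ordinal ni))//= eqxx normr1 powR1 big1 ?addr0// => k ki.
  by rewrite (_ : (val k == i) = false) ?normr0 ?powR0//; apply/negbTE.
rewrite big1// => k _; rewrite (_ : (val k == i) = false) ?normr0 ?powR0//.
by apply/negbTE; rewrite neq_ltn (leq_trans (ltn_ord k) ni).
Qed.

Let coord_lp_linear (c : R) (x y : lpT) k : (c *: x + y) k = c * x k + y k.
Proof. exact: lp_coord_linear. Qed.

Let lp0 k : (0 : lpT) k = 0.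
Proof. by have := coord_lp_linear (-1) 0 0 k; rewrite scaleN1r oppr0 add0r; lra. Qed.

Let l20 k : (0 : l2T) k = 0.
Proof. by have := lp_coord_linear (-1) (0 : l2T) 0 k; rewrite scaleN1r oppr0 add0r; lra. Qed.

Let comb (c : nat -> R) n : l2T := \sum_(i < n) c i *: unit i.

Let combE c n k : comb c n k = if (k < n)%N then c k else 0.
Proof.
elim: n => [|n IH]; first by rewrite /comb big_ord0 l20.
rewrite /comb big_ord_recr /= addrC lp_coord_linear unitE -/(comb c n) IH.
rewrite (ltnS k n) (leq_eqVlt k n); case: eqVneq => [->|kn] /=; first by rewrite ltnn mulr1 addr0.
by rewrite mulr0 add0r.
Qed.

Let norm_comb (c : nat -> R) n (K : R) : 0 <= K -> \sum_(i < n) c i ^+ 2 <= K ^+ 2 ->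
  `|comb c n| <= K.
Proof.
move=> K0 cK; apply: lp_norm_le => // m; rewrite powR_mulrn//.
apply: le_trans cK.
under eq_bigr => k _.
  have -> : `|comb c n k| `^ 2 = if (k < n)%N then c k ^+ 2 else 0.
    rewrite combE; case: ifP => _; last by rewrite normr0 powR0.
    by rewrite powR_mulrn// real_normK ?num_real.
  over.
by apply: (@sum_cutoff_le _ (fun k => c k ^+ 2)) => k; exact: sqr_ge0.
Qed.

(** A duality argument: U is tested on the combination whose coefficients are the coordinates c i
    themselves. Its k-th coordinate is the sum s of their squares, while the norm of the combination
    is at most sqrt s, so s <= A sqrt s. *)
Let coords_sum k n : \sum_(i < n) (U (unit i) k) ^+ 2 <= A ^+ 2.
Proof.
pose c i := U (unit i) k.
pose s := \sum_(i < n) c i ^+ 2.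
have s0 : 0 <= s by apply: sumr_ge0 => i _; exact: sqr_ge0.
have Es : U (comb c n) k = s.
  rewrite /comb /s; elim: n {s s0} => [|n IH]; first by rewrite !big_ord0 linear0 lp0.
  by rewrite !big_ord_recr /= addrC linearP coord_lp_linear IH /c expr2 addrC.
have : s <= A * Num.sqrt s.
  rewrite -[leLHS]Es (le_trans (ler_norm _))// (le_trans (lp_coord_le _ _))//.
  rewrite (le_trans (UA _))// ler_wpM2l ?(ltW A0)//.
  by apply: norm_comb; rewrite ?sqrtr_ge0// sqr_sqrtr.
rewrite -/s -{1 3}(sqr_sqrtr s0) expr2; set t := Num.sqrt s.
have [->|t0] := eqVneq t 0; first by rewrite mul0r sqr_ge0.
have tp : 0 < t by rewrite lt0r t0 sqrtr_ge0.
rewrite ler_pM2r// => tA; rewrite -expr2.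
by rewrite ler_sqr ?nnegrE ?sqrtr_ge0// ltW.
Qed.

Let coord_small k (e : R) : 0 < e ->
  exists N, forall i, (N <= i)%N -> `|U (unit i) k| <= e.
Proof.
move=> e0; pose s n := \sum_(0 <= i < n) (U (unit i) k) ^+ 2.
have cs : cvgn (series (fun i => (U (unit i) k) ^+ 2)).
  apply: nondecreasing_is_cvgn.
    by apply: nondecreasing_series => i _ _; exact: sqr_ge0.
  exists (A ^+ 2) => _ [n _ <-]; rewrite /series /= big_mkord.
  exact: coords_sum.
have e20 : 0 < e ^+ 2 by rewrite exprn_gt0.
have /cvgrPdist_le/(_ _ e20)[N _ HN] := cvg_series_cvg_0 cs.
exists N => i Ni; have := HN i Ni; rewrite sub0r normrN.
rewrite ger0_norm ?sqr_ge0// -(real_normK (num_real (U _ k))).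
by rewrite ler_sqr ?nnegrE// ltW.
Qed.

Let coords_small K (e : R) : 0 < e ->
  exists N, forall i k, (N <= i)%N -> (k < K)%N -> `|U (unit i) k| <= e.
Proof.
move=> e0; elim: K => [|K [N HN]]; first by exists 0%N.
have [M HM] := coord_small K e0.
exists (maxn N M) => i k; rewrite geq_max => /andP[Ni Mi].
by rewrite ltnS leq_eqVlt => /predU1P[->|]; [exact: HM|exact: HN].
Qed.

(** The last 1 pays for the first K coordinates. The other term is convexity on the tail, where f
    contributes at most 1 and the image of a unit vector at most A^p. *)
Let D : R := 2 `^ (p - 1) * (1 + A `^ p) + 1.

(* On finitely many coordinates U e_i is negligible, on the others f is. *)
Let step (f : lpT) : exists N, forall i, (N <= i)%N ->
  `|f + U (unit i)| `^ p <= `|f| `^ p + D.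
Proof.
have [K HK] := lp_tail f ltr01.
pose L := \sum_(k < K) p * (`|f k| + 1) `^ (p - 1).
have L0 : 0 <= L.
  by apply: sumr_ge0 => k _; rewrite mulr_ge0 ?powR_ge0// ltW.
(* [L] sums the Lipschitz constants of the p-th power at the first K coordinates of f, so moving
   each of them by at most e changes the sum by at most L e <= 1. *)
pose e : R := (1 + L)^-1.
have e0 : 0 < e by rewrite invr_gt0 ltr_wpDr.
have e1 : e <= 1 by rewrite /e invf_le1 ?lerDl// (lt_le_trans ltr01)// lerDl.
have [N HN] := coords_small K e0.
exists N => i Ni; set r := U (unit i).
have rA : `|r| <= A by rewrite (le_trans (UA _))// ler_piMr ?norm_unit// ltW.
have frE k : (f + r) k = f k + r k.
  by have := coord_lp_linear 1 f r k; rewrite scale1r mul1r.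
have D0 : 0 <= D.
  by rewrite addr_ge0// mulr_ge0 ?powR_ge0// addr_ge0// powR_ge0.
have f0 := powR_ge0 `|f| p.
have fD : 0 <= `|f| `^ p + D := addr_ge0 f0 D0.
have : `|f + r| <= (`|f| `^ p + D) `^ p^-1.
  apply: lp_norm_le => [|n]; first exact: powR_ge0.
  rewrite -powRrM mulVf ?gt_eqF// powRr1//.
  apply: (@le_trans _ _ (\sum_(k < K + n) `|(f + r) k| `^ p)).
    rewrite addnC big_split_ord /= lerDl sumr_ge0// => k _; exact: powR_ge0.
  rewrite big_split_ord /=.
  have H1 : \sum_(k < K) `|(f + r) k| `^ p <= \sum_(k < K) `|f k| `^ p + 1.
    apply: (@le_trans _ _ (\sum_(k < K) `|f k| `^ p + L * e)).
      rewrite /L mulr_suml -big_split /=; apply: ler_sum => k _.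
      have rk := HN i k Ni (ltn_ord k); rewrite -/r in rk.
      have h1 : 0 <= `|f k + r k| <= `|f k| + 1.
        by rewrite normr_ge0 (le_trans (ler_normD _ _))// lerD2l (le_trans rk).
      have h2 : 0 <= `|f k| <= `|f k| + 1 by rewrite normr_ge0 lerDl ler01.
      have := powR_lipschitz p1' h1 h2; rewrite frE.
      have h3 : `| `|f k + r k| - `|f k| | <= e.
        apply: le_trans rk; have := ler_dist_dist (f k + r k) (f k).
        by rewrite addrAC subrr add0r.
      have : p * (`|f k| + 1) `^ (p - 1) * `| `|f k + r k| - `|f k| | <=
             p * (`|f k| + 1) `^ (p - 1) * e.
        by rewrite ler_wpM2l// mulr_ge0 ?powR_ge0// ltW.
      by rewrite ler_norml => ? /andP[_ ?]; lra.
    by rewrite lerD2l /e ler_pdivrMr ?mul1r ?lerDr// ltr_wpDr.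
  have H2 : \sum_(k < n) `|(f + r) (K + k)%N| `^ p <= 2 `^ (p - 1) * (1 + A `^ p).
    apply: (@le_trans _ _ (2 `^ (p - 1) *
        (\sum_(k < n) `|f (K + k)%N| `^ p + \sum_(k < n) `|r (K + k)%N| `^ p))).
      rewrite -big_split /= mulr_sumr; apply: ler_sum => k _; rewrite frE.
      apply: le_trans (powR_midconvex p1' (normr_ge0 _) (normr_ge0 _)).
      by rewrite ge0_ler_powR ?nnegrE ?addr_ge0 ?(ltW p0)// ler_normD.
    rewrite ler_wpM2l ?powR_ge0// lerD//.
      have := lp_partial_sum_le f (K + n); rewrite big_split_ord /=; lra.
    apply: (@le_trans _ _ (`|r| `^ p)).
      apply: le_trans (lp_partial_sum_le r (K + n)).
      by rewrite big_split_ord /= lerDr sumr_ge0// => k _; exact: powR_ge0.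
    by rewrite ge0_ler_powR ?nnegrE ?(ltW p0) ?(ltW A0).
  have H3 := lp_partial_sum_le f K.
  by rewrite /D; move: H1 H2 H3; lra.
move=> /(ge0_ler_powR (ltW p0)); rewrite !nnegrE normr_ge0 powR_ge0.
by move=> /(_ isT isT); rewrite -powRrM mulVf ?gt_eqF// powRr1.
Qed.

(** g is a sum of m distinct unit vectors. The support bound N puts the next one beyond the previous
    ones, and [step] charges D for each. *)
Let growth m : exists N (g : l2T), [/\ forall k, (N <= k)%N -> g k = 0,
  m%:R <= \sum_(k < N) `|g k| `^ 2 & `|U g| `^ p <= m%:R * D].
Proof.
elim: m => [|m [N [g [g0 gm gD]]]].
  exists 0%N, 0; split => //; first by rewrite big_ord0.
  by rewrite linear0 normr0 powR0 ?gt_eqF// mul0r.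
have [M HM] := step (U g).
pose i := maxn N M.
have Ni : (N <= i)%N by rewrite leq_maxl.
have gi k : (g + unit i) k = g k + (k == i)%:R.
  by have := lp_coord_linear 1 g (unit i) k; rewrite scale1r mul1r unitE.
exists i.+1, (g + unit i); split.
- move=> k ik; rewrite gi g0 ?(leq_trans Ni (ltnW ik))// add0r.
  by rewrite gtn_eqF.
- rewrite big_ord_recr /= gi eqxx g0// add0r normr1 powR1 -natr1 lerD2r.
  apply: (le_trans gm).
  apply: (@le_trans _ _ (\sum_(k < N) `|(g + unit i) k| `^ 2)).
    apply: ler_sum => k _; rewrite gi (_ : (val k == i) = false) ?addr0//.
    by apply/negbTE; rewrite neq_ltn (leq_trans (ltn_ord k) Ni).
  exact: (@sum_widen_le _ (fun k => `|(g + unit i) k| `^ 2) _ _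
    (fun k => powR_ge0 _ _) Ni).
- rewrite linearD (le_trans (HM i (leq_maxr _ _)))//.
  have -> : m.+1%:R * D = m%:R * D + D by rewrite mulrSr mulrDl mul1r.
  by rewrite lerD2r.
Qed.

Lemma l2_no_embedding : False.
Proof.
have D0 : 0 < D.
  by rewrite ltr_wpDl// mulr_ge0 ?powR_ge0// addr_ge0// powR_ge0.
have q1 : 0 < p / 2 - 1 by rewrite subr_gt0 ltr_pdivlMr// mul1r.
have ap : 0 < a `^ p by rewrite powR_gt0.
(* The estimates give a^p m^(p/2) <= m D, which fails as soon as m exceeds this x because p / 2 >
   1. *)
pose x := (D / a `^ p) `^ (p / 2 - 1)^-1.
pose m := (Num.truncn x).+1.
have mx : x < m%:R by exact: truncnS_gt.
have x0 : 0 <= x by exact: powR_ge0.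
have m0 : 0 < m%:R :> R by rewrite ltr0n.
have [N [g [_ gm gD]]] := growth m.
have h1 : m%:R <= `|g| `^ 2 := le_trans gm (lp_partial_sum_le g N).
have h2 : a `^ p * m%:R `^ (p / 2) <= m%:R * D.
  apply: le_trans gD.
  apply: (@le_trans _ _ ((a * `|g|) `^ p)).
    rewrite powRM ?(ltW a0)// ler_wpM2l ?powR_ge0//.
    have -> : `|g| `^ p = (`|g| `^ 2) `^ (p / 2).
      by rewrite -powRrM mulrC divfK.
    by rewrite ge0_ler_powR ?nnegrE ?powR_ge0// divr_ge0// ltW.
  by rewrite ge0_ler_powR ?nnegrE ?mulr_ge0 ?(ltW p0) ?(ltW a0)// Ua.
have h3 : D / a `^ p < m%:R `^ (p / 2 - 1).
  have := gt0_ltr_powR q1 _ _ mx; rewrite !nnegrE x0 (ltW m0) => /(_ isT isT).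
  by rewrite /x -powRrM mulVf ?gt_eqF// powRr1// divr_ge0// ltW.
move: h2; apply/negP; rewrite -ltNge.
have -> : m%:R `^ (p / 2) = m%:R * m%:R `^ (p / 2 - 1) :> R.
  by rewrite mulr_powRB1 ?(ltW m0)// divr_gt0.
by rewrite mulrCA ltr_pM2l// mulrC -ltr_pdivrMr.
Qed.

End l2_does_not_embed.

(** * Copies of l_2 from sequences with two-sided l_2-estimates *)

Section l2_embedding.
Context (R : realType) (X : normedModType R).
Local Notation l2T := (LspaceType (counting : {measure set nat -> \bar R}) (@lee1n R 2)).
Variables (y : nat -> X) (c C : R).
Hypothesis cX : seq_complete X.
Hypothesis c0 : 0 < c.
Hypothesis C0 : 0 < C.
Hypothesis lower : forall (b : nat -> R) n,
  c ^+ 2 * \sum_(i < n) b i ^+ 2 <= `|\sum_(i < n) b i *: y i| ^+ 2.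
Hypothesis upper : forall (b : nat -> R) n,
  `|\sum_(i < n) b i *: y i| ^+ 2 <= C ^+ 2 * \sum_(i < n) b i ^+ 2.

Let S (b : l2T) n : X := \sum_(i < n) b i *: y i.

Let sqr_powR2 (b : l2T) i : `|b i| `^ 2 = b i ^+ 2.
Proof. by rewrite powR_mulrn// real_normK ?num_real. Qed.

Let partial_le (b : l2T) n : \sum_(i < n) b i ^+ 2 <= `|b| ^+ 2.
Proof.
have := lp_partial_sum_le b n; rewrite powR_mulrn//.
by under eq_bigr do rewrite sqr_powR2.
Qed.

Let tail (b : l2T) (e : R) : 0 < e ->
  exists n, `|b| ^+ 2 <= \sum_(i < n) b i ^+ 2 + e.
Proof.
move=> e0; have [n] := lp_tail b e0; rewrite powR_mulrn// => H; exists n.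
by move: H; under eq_bigr do rewrite sqr_powR2.
Qed.

Let S_diff (b : l2T) n m : (n <= m)%N ->
  `|S b m - S b n| ^+ 2 <= C ^+ 2 * (`|b| ^+ 2 - \sum_(i < n) b i ^+ 2).
Proof.
move=> nm; pose b' i : R := if (i < n)%N then 0 else b i.
have -> : S b m - S b n = \sum_(i < m) b' i *: y i.
  rewrite /S -(subnKC nm) !big_split_ord /= addrAC subrr add0r.
  rewrite [X in _ = X + _]big1 ?add0r; last first.
    by move=> i _; rewrite /b' ltn_ord scale0r.
  by apply: eq_bigr => i _; rewrite /b' ltnNge leq_addr.
apply: (le_trans (upper b' m)); rewrite ler_wpM2l ?sqr_ge0// lerBrDr.
apply: le_trans (partial_le b m); rewrite -(subnKC nm) !big_split_ord /=.
rewrite [X in X + _ + _]big1 ?add0r; last first.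
  by move=> i _; rewrite /b' ltn_ord expr0n.
rewrite [leLHS]addrC lerD2l; apply: ler_sum => i _.
by rewrite /b' ltnNge leq_addr.
Qed.

Let S_cauchy b : cauchy_in (S b).
Proof.
move=> e e0.
have d0 : 0 < (e / 2 / C) ^+ 2 by rewrite exprn_gt0// !divr_gt0.
have [N HN] := tail b d0.
have H n : (N <= n)%N -> `|S b n - S b N| <= e / 2.
  move=> Nn; rewrite -(@ler_sqr R) ?nnegrE ?divr_ge0 ?(ltW e0)//.
  apply: (le_trans (S_diff b Nn)).
  have -> : (e / 2) ^+ 2 = C ^+ 2 * (e / 2 / C) ^+ 2.
    by field; rewrite gt_eqF.
  by rewrite ler_wpM2l ?sqr_ge0// lerBlDl.
exists N => m n Nm Nn.
have -> : S b m - S b n = (S b m - S b N) - (S b n - S b N).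
  by rewrite opprB addrA subrK.
by rewrite (le_trans (ler_normB _ _))//; have := H _ Nm; have := H _ Nn; lra.
Qed.

Lemma l2_embedding : exists f : {linear l2T -> X},
  forall b, c * `|b| <= `|f b| /\ `|f b| <= C * `|b|.
Proof.
have [f fS] := choice (fun b => cX (@S_cauchy b)).
have f_linear : linear f.
  move=> a b b'; apply: tends_to_unique (fS _) _.
  have := tends_to_linear a (fS b) (fS b').
  congr tends_to; apply/funext => n.
  rewrite /S scaler_sumr -big_split /=; apply: eq_bigr => i _.
  by rewrite lp_coord_linear scalerDl scalerA.
pose f' : {linear l2T -> X} :=
  HB.pack f (GRing.isLinear.Build R l2T X _ f f_linear).
exists f' => b /=.
have b0 := normr_ge0 b; split.
  rewrite leNgt; apply/negP => fb.
  have d0 : 0 < `|b| ^+ 2 - (`|f b| / c) ^+ 2.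
    by rewrite subr_gt0 ltr_sqr ?nnegrE ?divr_ge0 ?(ltW c0)// ltr_pdivrMr// mulrC.
  pose d := (`|b| ^+ 2 - (`|f b| / c) ^+ 2) / 2.
  have [N HN] := tail b (divr_gt0 d0 (ltr0n R 2)); rewrite -/d in HN.
  have r0 : 0 <= `|b| ^+ 2 - d.
    by have := sqr_ge0 `|b|; have := sqr_ge0 (`|f b| / c); rewrite /d; lra.
  have : c * Num.sqrt (`|b| ^+ 2 - d) <= `|f b|.
    apply: (tends_to_norm_ge (N := N) _ (fS b)) => n Nn.
    rewrite -(@ler_sqr R) ?nnegrE ?mulr_ge0 ?sqrtr_ge0 ?(ltW c0)//.
    rewrite exprMn sqr_sqrtr//; apply: le_trans (lower b n).
    rewrite ler_wpM2l ?sqr_ge0// lerBlDr (le_trans HN)// lerD2r.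
    by apply: (@sum_widen_le _ (fun i => b i ^+ 2)) => // i; exact: sqr_ge0.
  rewrite -ler_pdivlMl// mulrC -(@ler_sqr R) ?nnegrE ?divr_ge0 ?sqrtr_ge0 ?(ltW c0)//.
  by rewrite sqr_sqrtr// /d; lra.
apply: (tends_to_norm_le (N := 0%N) _ (fS b)) => n _.
rewrite -(@ler_sqr R) ?nnegrE ?mulr_ge0 ?(ltW C0)//.
by rewrite (le_trans (upper b n))// exprMn ler_wpM2l ?sqr_ge0.
Qed.

Lemma l2_subspace :
  exists Z : closed_subspace X, isomorphic Z (l2T : normedModType R).
Proof.
have [f fb] := l2_embedding.
have [|b||Z [g [h [gh hg ge]]]] := @range_closed_subspace _ _ _ f c _ c0.
- exact: Lspace_seq_complete.
- by case: (fb b).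
- by exists C => // b; case: (fb b).
exists Z, h, g; split => //.
- apply: (@norm_bounded_continuous _ _ _ h c^-1) => z.
  rewrite -ler_pdivrMl ?invr_gt0// invrK -{2}(hg z).
  have -> : `|g (h z)| = `|f (h z)| by rewrite -ge.
  by case: (fb (h z)).
- apply: (@norm_bounded_continuous _ _ _ g C) => x.
  have -> : `|g x| = `|f x| by rewrite -ge.
  by case: (fb x).
Qed.

End l2_embedding.

(** * Subspaces containing l_2 *)

#[local] Opaque powint.

Section martingale_differences.
Context d (T : measurableType d) (R : realType).
Variable mu : probability T R.
Variables (p : R) (p2 : 2 < p) (p1 : (1 <= p%:E)%E).
Local Notation V := (LspaceType mu p1).
Implicit Types (pi : fpart T) (u w : V).

Let p0 : 0 < p. Proof. exact: lt_trans p2. Qed.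

(* Clarkson for u + w and u: since 2u is the conditional expectation of
   (u + w) + u, it is no larger than that sum. *)
Lemma martingale_lower pi q u w : 2 <= q <= p -> cexp pi u = u -> cexp pi w = 0 ->
  powint q u + 2 `^ (1 - q) * powint q w <= powint q (u + w).
Proof.
move=> qp Eu Ew.
have q1p : 1 <= q <= p.
  by case/andP: qp => q2 ->; rewrite andbT (le_trans _ q2)// ler1n.
have q0 : 0 < q by case/andP: q1p => q1 _; rewrite (lt_le_trans ltr01).
have := powint_clarkson (u + w) u qp.
rewrite [u + w - u]addrAC subrr add0r => h1.
have h2 : 2 `^ q * powint q u <= powint q (u + w + u).
  apply: le_trans (powint_cexp_le pi (u + w + u) q1p).
  have -> : cexp pi (u + w + u) = 2 *: u.
    by rewrite !linearD /= Eu Ew addr0 scaler_nat mulr2n.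
  by rewrite (powintZ _ _ q1p) ger0_norm.
have E : 2 `^ q = 2 * 2 `^ (q - 1) :> R by rewrite mulr_powRB1.
have E' : 2 `^ (1 - q) = (2 `^ (q - 1))^-1 :> R by rewrite -powRN opprB.
have t0 : 0 < 2 `^ (q - 1) :> R by rewrite powR_gt0.
rewrite E' -lerBrDl -(ler_pM2l t0) mulrA divff ?gt_eqF// mul1r.
move: h1 h2; rewrite E mulrBr mulrDr; move: (2 `^ (q - 1)) => t.
move: (powint q u) (powint q w) (powint q (u + w)) (powint q _) => A B D F h1 h2.
lra.
Qed.

(* By smoothness, as |u| <= |u - w|: u is the conditional expectation of u - w. *)
Lemma martingale_upper : exists2 C, 1 <= C & forall pi u w,
  cexp pi u = u -> cexp pi w = 0 -> `|u + w| ^+ 2 <= `|u| ^+ 2 + C * `|w| ^+ 2.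
Proof.
have [C C1 HC] := norm_smooth mu p2 p1; exists (2 * C) => [|pi u w Eu Ew].
  by lra.
apply: (@powR_smooth_sqr _ p) => //; first exact: ltW.
have := HC u w.
have : `|u| `^ p <= `|u - w| `^ p.
  rewrite ge0_ler_powR ?nnegrE ?(ltW p0)//.
  apply: le_trans (norm_cexp_le p2 pi (u - w)).
  by rewrite linearB /= Eu Ew subr0.
lra.
Qed.

End martingale_differences.

Lemma half_powR (R : realType) : 2 `^ (1 - 2) = 2^-1 :> R.
Proof. by rewrite (_ : 1 - 2 = -1 :> R) ?powR_inv1//; ring. Qed.

Lemma half_dist_le_mesh (R : realFieldType) (e x y : R) (k l : nat) : 0 < e ->
  k = l -> k%:R <= (x + 1) / e -> (x + 1) / e < k.+1%:R ->
  l%:R <= (y + 1) / e -> (y + 1) / e < l.+1%:R -> `|2^-1 * (x - y)| <= e.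
Proof.
move=> e0 <-; rewrite -natr1; move: k%:R => {}k.
rewrite !ler_pdivlMr// !ltr_pdivrMr// mulrDl mul1r => h1 h2 h3 h4.
by rewrite ler_norml; apply/andP; split; lra.
Qed.

Section l2_subspaces_of_Lp.
Context d (T : measurableType d) (R : realType).
Variable mu : probability T R.
Variables (p : R) (p2 : 2 < p) (p1 : (1 <= p%:E)%E).
Local Notation V := (LspaceType mu p1).
Variable X : closed_subspace (V : normedModType R).
Implicit Types (pi : fpart T).

Let p0 : 0 < p. Proof. exact: lt_trans p2. Qed.

(** [e] bounds a squared distance, and centres outside X are allowed. The negation thus provides,
    for every finite list in V, a point of the ball of X far from all of it. *)
Definition L2_totally_bounded := forall e : R, 0 < e -> exists s : seq V,
  forall x : X, `|x| <= 1 -> exists2 g, g \in s & powint 2 (val x - g) <= e.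

Lemma cellfun_le pi i (x : V) : (i < ncell pi)%N -> `|cellfun pi i x| <= `|x|.
Proof.
move=> ni; apply: le_trans (norm_cexp_le p2 pi x).
rewrite leNgt; apply/negP => /(gt0_ltr_powR p0).
rewrite !nnegrE !normr_ge0 => /(_ isT isT); apply/negP; rewrite -leNgt.
by rewrite norm_cexp_powR// (bigD1 (Ordinal ni))//= lerDl sumr_ge0.
Qed.

Lemma cexp_le_cellfun pi (x : V) (e : R) : 0 <= e ->
  (forall i, (i < ncell pi)%N -> `|cellfun pi i x| <= e) ->
  `|cexp pi x| <= (ncell pi).+1%:R * e.
Proof.
move=> e0 xe.
rewrite leNgt; apply/negP => /(gt0_ltr_powR p0).
rewrite !nnegrE normr_ge0 mulr_ge0// => /(_ isT isT).
apply/negP; rewrite -leNgt norm_cexp_powR// powRM//.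
apply: (@le_trans _ _ ((ncell pi)%:R * e `^ p)).
  rewrite mulr_natl -[ncell pi in leRHS]card_ord -sumr_const.
  by apply: ler_sum => i _; rewrite ge0_ler_powR ?nnegrE ?(ltW p0)// xe.
rewrite ler_wpM2r ?powR_ge0// (@le_trans _ _ (ncell pi).+1%:R)//.
  by rewrite ler_nat.
by rewrite le1r_powR// ler1n.
Qed.

Section not_totally_bounded.
Variable delta : R.
Hypothesis delta0 : 0 < delta.
Hypothesis separated : forall s : seq V, exists2 x : X, `|x| <= 1 &
  forall g, g \in s -> delta < powint 2 (val x - g).

(* Half the difference of two points of the ball that are far apart in L_2 and
   have the same rounded coordinates [lev]; they exist by pigeonhole. *)
Lemma small_cexp pi (e : R) : 0 < e -> exists y : X,
  [/\ `|y| <= 1, delta / 4 <= powint 2 (val y) & `|cexp pi (val y)| <= e].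
Proof.
move=> e0; set n := ncell pi.
(* [cexp_le_cellfun] loses the factor n + 1 when passing from coordinates to the norm. *)
pose e' := e / n.+1%:R.
have e'0 : 0 < e' by rewrite divr_gt0.
pose K := Num.truncn (2 / e').
pose lev (x : X) i := Num.truncn ((cellfun pi i (val x) + 1) / e').
have levK x i : `|x| <= 1 -> (i < n)%N -> (lev x i < K.+1)%N.
  move=> x1 ni; rewrite ltnS; apply: le_truncn; rewrite ler_pM2r ?invr_gt0//.
  rewrite -[leRHS]/(1 + 1) lerD2r (le_trans (ler_norm _))//.
  exact: le_trans (cellfun_le _ ni) x1.
pose phi (x : X) : {ffun 'I_n -> 'I_K.+1} := [ffun i : 'I_n => inord (lev x i)].
(* One representative for each rounded coordinate vector, or 0 if the vector is not attained by the
   ball. This makes the list of centres finite. *)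
have pick (f : {ffun 'I_n -> 'I_K.+1}) : exists g : V, forall x : X,
    `|x| <= 1 -> phi x = f -> exists x' : X, [/\ `|x'| <= 1, phi x' = f & g = val x'].
  have [[x' [x1 xf]]|nx] := pselect (exists x' : X, `|x'| <= 1 /\ phi x' = f).
    by exists (val x') => x _ _; exists x'.
  by exists 0 => x x1 xf; exfalso; apply: nx; exists x.
have [g Hg] := choice pick.
have [x x1 xs] := separated [seq g f | f : {ffun 'I_n -> 'I_K.+1}].
have [x' [x'1 x'f gx']] := Hg (phi x) x x1 erefl.
have dx : delta < powint 2 (val x - val x').
  by rewrite -gx'; apply: xs; apply: map_f; rewrite mem_enum.
exists (2^-1 *: (x - x')); split.
- rewrite normrZ ger0_norm ?invr_ge0//.
  by have := ler_normB x x'; lra.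
- have -> : val (2^-1 *: (x - x')) = 2^-1 *: (val x - val x') :> V by [].
  rewrite powintZ; last by rewrite ler1n ltW.
  rewrite ger0_norm ?invr_ge0// powR_mulrn ?invr_ge0//.
  have -> : 2^-1 ^+ 2 = 4^-1 :> R by rewrite exprVn -natrX.
  by rewrite mulrC ler_pM2l ?invr_gt0// ltW.
have -> : e = n.+1%:R * e' by rewrite mulrC divfK.
apply: cexp_le_cellfun; first exact: ltW.
move=> i ni.
have E : cellfun pi i (val (2^-1 *: (x - x'))) =
    2^-1 * (cellfun pi i (val x) - cellfun pi i (val x')).
  have -> : val (2^-1 *: (x - x')) = (2^-1 *: val x) + (- 2^-1 *: val x' + 0).
    by rewrite addr0 scaleNr -scalerBr.
  have L0 : cellfun pi i (0 : V) = 0.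
    by have := cellfun_linear pi i (-1) (0 : V) 0; rewrite scaleN1r oppr0 addr0; lra.
  by rewrite !cellfun_linear L0; ring.
have same : lev x i = lev x' i.
  have := congr1 (fun h : {ffun 'I_n -> 'I_K.+1} => val (h (Ordinal ni))) x'f.
  by rewrite !ffunE /= !inordK ?levK.
have cge (w : X) : `|w| <= 1 -> 0 <= (cellfun pi i (val w) + 1) / e'.
  move=> w1; rewrite divr_ge0 ?(ltW e'0)//.
  have : `|cellfun pi i (val w)| <= 1 := le_trans (cellfun_le _ ni) w1.
  by rewrite ler_norml => /andP[+ _]; rewrite -lerBlDr sub0r.
have /andP[h1 h2] := truncn_itv (cge _ x1).
have /andP[h3 h4] := truncn_itv (cge _ x'1).
rewrite E; exact: (half_dist_le_mesh e'0 same h1 h2 h3 h4).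
Qed.

(** kappa^2 = delta / 64 arises in steps: the y i have squared L_2-norm at least delta / 4, the z i
    near them delta / 16, [martingale_lower] at q = 2 halves this, and passing from L_2 to the norm
    halves it again. *)
Let kappa : R := Num.sqrt delta / 8.
Let kappa0 : 0 < kappa. Proof. by rewrite divr_gt0// sqrtr_gt0. Qed.
Let kappa_sqr : kappa ^+ 2 = delta / 64.
Proof. by rewrite expr_div_n sqr_sqrtr ?(ltW delta0)// -natrX. Qed.

(** The errors 2 eps i add up to at most kappa / 2, half of the lower constant kappa of the
    martingale differences, so half of it survives the perturbation. *)
Let eps i : R := kappa / 8 * 2^-1 ^+ i.
Let eps0 i : 0 < eps i. Proof. by apply: mulr_gt0; [exact: divr_gt0|rewrite exprn_gt0// invr_gt0]. Qed.
Let eps_le i : eps i <= kappa / 8.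
Proof.
apply: ler_piMr; first by rewrite ltW// divr_gt0.
by rewrite exprn_ile1 ?invr_ge0// invf_le1// ler1n.
Qed.

Let next i pi : exists r : X * fpart T,
  [/\ refines pi r.2, `|r.1| <= 1, delta / 4 <= powint 2 (val r.1),
      `|cexp pi (val r.1)| <= eps i & `|val r.1 - cexp r.2 (val r.1)| <= eps i].
Proof.
have [y [y1 yd ye]] := small_cexp pi (eps0 i).
have [pi' Hpi'] := cexp_dense p2 (val y) (eps0 i).
exists (y, fpart_join pi pi'); split => //=; first exact: refines_joinl.
by apply: Hpi'; exact: refines_joinr.
Qed.

Lemma l2_sequence_exists : exists (y : nat -> X) (c C : R), [/\ 0 < c, 0 < C,
  forall (b : nat -> R) n,
    c ^+ 2 * \sum_(i < n) b i ^+ 2 <= `|\sum_(i < n) b i *: y i| ^+ 2 &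
  forall (b : nat -> R) n,
    `|\sum_(i < n) b i *: y i| ^+ 2 <= C ^+ 2 * \sum_(i < n) b i ^+ 2].
Proof.
have [F HF] := choice (fun ip : nat * fpart T => next ip.1 ip.2).
have [P [y HP]] : exists (P : nat -> fpart T) (y : nat -> X), forall i,
    [/\ refines (P i) (P i.+1), `|y i| <= 1, delta / 4 <= powint 2 (val (y i)),
    `|cexp (P i) (val (y i))| <= eps i &
    `|val (y i) - cexp (P i.+1) (val (y i))| <= eps i].
  pose P := fix P i := if i is j.+1 then (F (j, P j)).2 else fpart_trivial T.
  by exists P, (fun i => (F (i, P i)).1) => i; exact: (HF (i, P i)).
clear F HF.
(* Exact martingale differences: fixed by the partition i + 1 and annihilated by the partition i. *)
pose z i : V := cexp (P i.+1) (val (y i)) - cexp (P i) (val (y i)).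
have yz i : `|val (y i) - z i| <= 2 * eps i.
  case: (HP i) => _ _ _ h1 h2.
  by rewrite /z opprB addrA addrAC (le_trans (ler_normD _ _))//; lra.
have Ez i : cexp (P i) (z i) = 0.
  case: (HP i) => r _ _ _ _.
  by rewrite /z linearB /= (cexp_towerl _ r) cexp_idem subrr.
have zE i : cexp (P i.+1) (z i) = z i.
  case: (HP i) => r _ _ _ _.
  by rewrite /z linearB /= cexp_idem (cexp_towerr _ r).
have z2 i : `|z i| <= 2.
  case: (HP i) => _ y1 _ _ _.
  have h1 := le_trans (norm_cexp_le p2 (P i.+1) (val (y i))) y1.
  have h2 := le_trans (norm_cexp_le p2 (P i) (val (y i))) y1.
  by rewrite (le_trans (ler_normB _ _))//; lra.
have zd i : delta / 16 <= powint 2 (z i).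
  case: (HP i) => _ _ yd _ _.
  have := powint2_sub p2 (z i) (z i - val (y i)); rewrite opprB addrC subrK.
  have := powint2_le p2 (z i - val (y i)); rewrite distrC.
  have : `|val (y i) - z i| ^+ 2 <= (kappa / 4) ^+ 2.
    rewrite ler_sqr ?nnegrE ?divr_ge0 ?(ltW kappa0)// (le_trans (yz i))//.
    by have := eps_le i; lra.
  move: yd (delta0); rewrite expr_div_n kappa_sqr -natrX.
  move: (powint 2 (z i)) (powint 2 (val (y i))) (powint 2 _) (`|_| ^+ 2) delta.
  by move=> A B D E dd; lra.
clearbody z.
have [C C1 HC] := martingale_upper mu p2 p1.
have [Z [Z0 ZS Zsum]] : exists Z : (nat -> R) -> nat -> V,
    [/\ forall b, Z b 0%N = 0, forall b n, Z b n.+1 = Z b n + b n *: z n &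
        forall (b : nat -> R) n, Z b n = \sum_(i < n) b i *: z i].
  exists (fun (b : nat -> R) n => \sum_(i < n) b i *: z i).
  by split=> // [b|b n]; rewrite ?big_ord0 ?big_ord_recr.
have ZE (b : nat -> R) n : cexp (P n) (Z b n) = Z b n.
  elim: n => [|n IH]; first by rewrite Z0 linear0.
  rewrite ZS linearD linearZ /= zE.
  by case: (HP n) => r _ _ _ _; rewrite -IH (cexp_towerr _ r).
have EZ (b : nat -> R) n : cexp (P n) (b n *: z n) = 0.
  by rewrite linearZ /= Ez scaler0.
have Zlow (b : nat -> R) n : delta / 32 * \sum_(i < n) b i ^+ 2 <= powint 2 (Z b n).
  elim: n => [|n IH]; first by rewrite big_ord0 mulr0 powint_ge0.
  rewrite ZS big_ord_recr /=.
  have q2 : 2 <= (2 : R) <= p by rewrite lexx ltW.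
  have := martingale_lower q2 (ZE b n) (EZ b n).
  apply: le_trans; rewrite mulrDr; apply: (lerD IH).
  have q1 : 1 <= (2 : R) <= p by rewrite ler1n ltW.
  rewrite (powintZ (b n) (z n) q1) half_powR.
  rewrite (powR_mulrn 2 (normr_ge0 (b n))) real_normK ?num_real//.
  have -> : delta / 32 * b n ^+ 2 = 2^-1 * (b n ^+ 2 * (delta / 16)) by field.
  clear IH; apply: ler_wpM2l; first by rewrite invr_ge0.
  by apply: ler_wpM2l (zd n); exact: sqr_ge0.
have Zup (b : nat -> R) n : `|Z b n| ^+ 2 <= 4 * C * \sum_(i < n) b i ^+ 2.
  elim: n => [|n IH]; first by rewrite Z0 big_ord0 normr0 expr0n mulr0.
  rewrite ZS big_ord_recr /=.
  apply: le_trans (HC _ _ _ (ZE b n) (EZ b n)) _; rewrite mulrDr.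
  apply: (lerD IH); rewrite normrZ exprMn real_normK ?num_real//.
  have zn : `|z n| ^+ 2 <= 2 ^+ 2 by rewrite ler_sqr ?nnegrE.
  have C0 : 0 <= C by rewrite (le_trans ler01).
  have -> : 4 * C * b n ^+ 2 = C * (b n ^+ 2 * 2 ^+ 2) by ring.
  by apply: (ler_wpM2l C0); apply: ler_wpM2l zn; exact: sqr_ge0.
have pert (b : nat -> R) n : `|\sum_(i < n) b i *: (val (y i) - z i)| <=
    Num.sqrt (\sum_(i < n) b i ^+ 2) * (kappa / 2).
  set B := Num.sqrt _.
  have B0 : 0 <= B by exact: sqrtr_ge0.
  have bB (i : 'I_n) : `|b i| <= B.
    rewrite -sqrtr_sqr ler_wsqrtr// (bigD1 i)//= lerDl sumr_ge0// => j _.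
    exact: sqr_ge0.
  apply: (@le_trans _ _ (\sum_(i < n) B * (2 * eps i))).
    apply: (le_trans (ler_norm_sum _ _ _)); apply: ler_sum => i _.
    by rewrite normrZ ler_pM.
  rewrite -mulr_sumr ler_wpM2l//.
  have H m : \sum_(i < m) 2 * eps i = kappa / 2 * (1 - 2^-1 ^+ m).
    elim: m => [|m IH]; first by rewrite big_ord0 expr0 subrr mulr0.
    by rewrite big_ord_recr /= IH /eps exprS; field.
  rewrite H; apply: ler_piMr; first by rewrite ltW// divr_gt0.
  by rewrite gerBl exprn_ge0// invr_ge0.
exists y, (kappa / 2), (2 * Num.sqrt C + kappa).
have c0 : 0 < kappa / 2 by rewrite divr_gt0.
have C0 : 0 < 2 * Num.sqrt C + kappa.
  by rewrite ltr_wpDl// mulr_ge0// sqrtr_ge0.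
have norm_val (b : nat -> R) n : `|\sum_(i < n) b i *: y i| =
    `|Z b n + \sum_(i < n) b i *: (val (y i) - z i)|.
  rewrite Zsum -[LHS]/(`|val _|) linear_sum -big_split /=; congr `|_|.
  apply: eq_bigr => i _; rewrite -scalerDr addrC subrK.
  by rewrite -[RHS]/(val (b i *: y i)).
split => // b n; set s := \sum_(i < n) b i ^+ 2.
- have s0 : 0 <= s by apply: sumr_ge0 => i _; exact: sqr_ge0.
  rewrite -[s](sqr_sqrtr s0) -exprMn ler_sqr ?nnegrE ?mulr_ge0 ?sqrtr_ge0 ?(ltW c0)//.
  rewrite norm_val.
  have h1 : kappa * Num.sqrt s <= `|Z b n|.
    rewrite -(@ler_sqr R) ?nnegrE ?mulr_ge0 ?sqrtr_ge0 ?(ltW kappa0)//.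
    rewrite exprMn sqr_sqrtr// kappa_sqr.
    have := Zlow b n; have := powint2_le p2 (Z b n); rewrite -/s.
    move: (powint 2 _) (`|_| ^+ 2) (s) (delta) => A B t dd; lra.
  move: h1; have := pert b n; rewrite -/s; set W := \sum_(i < n) _.
  have := ler_normB (Z b n + W) W; rewrite addrK.
  move: (`|Z b n|) (`|Z b n + W|) (`|W|) (Num.sqrt s) (kappa).
  by move=> A B D E k; lra.
- have s0 : 0 <= s by apply: sumr_ge0 => i _; exact: sqr_ge0.
  rewrite -[s](sqr_sqrtr s0) -exprMn ler_sqr ?nnegrE ?mulr_ge0 ?sqrtr_ge0 ?(ltW C0)//.
  rewrite norm_val (le_trans (ler_normD _ _))//.
  have h1 : `|Z b n| <= 2 * Num.sqrt C * Num.sqrt s.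
    rewrite -(@ler_sqr R) ?nnegrE ?mulr_ge0 ?sqrtr_ge0//.
    rewrite !exprMn !sqr_sqrtr//; last by rewrite (le_trans ler01).
    by have := Zup b n; rewrite -/s -natrX.
  move: h1; have := pert b n; rewrite -/s; have := mulr_ge0 (sqrtr_ge0 s) (ltW c0).
  move: (`|Z b n|) (`|_|) (Num.sqrt s) (Num.sqrt C) (kappa).
  by move=> A B D E k; lra.
Qed.

End not_totally_bounded.

Lemma no_l2_totally_bounded :
  ~ (exists Y : closed_subspace X, isomorphic Y (lp (@lee1n R 2))) ->
  L2_totally_bounded.
Proof.
move=> H e e0; apply: contrapT => ns; apply: H.
have sep (s : seq V) : exists2 x : X, `|x| <= 1 &
    forall g, g \in s -> e < powint 2 (val x - g).
  apply: contrapT => nx; apply: ns; exists s => x x1.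
  apply: contrapT => ng; apply: nx; exists x => // g gs.
  by rewrite ltNge; apply/negP => xg; apply: ng; exists g.
have [y [c [C [c0 C0 lo up]]]] := l2_sequence_exists e0 sep.
apply: (l2_subspace _ c0 C0 lo up).
exact/closed_subspace_complete/Lspace_seq_complete.
Qed.

End l2_subspaces_of_Lp.

(** * Almost isometric embeddings into l_p *)

Section skipped_blocks.
Context (R : realType) (V : normedModType R).
Variables (p : R) (p2 : 2 < p).
Variables (E : nat -> {linear V -> V}) (u : nat -> V) (delta : R) (N : nat).
Hypothesis delta0 : 0 < delta.
Hypothesis N2 : (1 < N)%N.
Hypothesis u_le1 : forall k, `|u k| <= 1.
Hypothesis E_u : forall k m, (m <= k)%N -> E k (u m) = u m.
(** The norm bound 2(k + 1) leaves room for every partial sum of blocks or gaps fixed by [E k], and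
    the errors on the right add up to at most delta. *)
Hypothesis almost_disjoint : forall k m m' f, (k < m)%N -> (m <= m')%N ->
  E k f = f -> `|f| <= 2 * k.+1%:R ->
  `| `|f + (u m' - u m)| `^ p - `|f| `^ p - `|u m' - u m| `^ p| <=
  delta * 2^-1 ^+ k.+1.
Hypothesis increments : forall n,
  \sum_(k < n) `|u k.+1 - u k| `^ p <= 2 `^ (p - 1).

Let p0 : 0 < p. Proof. exact: lt_trans p2. Qed.
Let p1 : 1 <= p. Proof. by rewrite (le_trans _ (ltW p2))// ler1n. Qed.

(* The block ending at the cut k; the previous cut is k - N, and the increment
   following it is skipped. *)
Definition block k : V := if (k < N)%N then u k else u k - u (k.+1 - N)%N.

Section offset.
Variable j : nat.
Hypothesis jN : (j < N)%N.

Let c i := (i * N + j)%N.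

Let cS i : c i.+1 = (c i + N)%N.
Proof. by rewrite /c mulSn addnAC addnC addnA addnAC. Qed.

Let c_ge i : (i <= c i)%N.
Proof. by rewrite /c (leq_trans (leq_pmulr i (ltnW N2)))// leq_addr. Qed.

Let blockS i : block (c i.+1) = u (c i.+1) - u (c i).+1.
Proof.
rewrite /block ltnNge cS leq_addl /=; congr (_ - u _).
by rewrite -addSn addnK.
Qed.

(** The kept part of [u (c m)]; [D] below is the dropped part. *)
Let S m := \sum_(i < m.+1) block (c i).
Let D m := \sum_(i < m) (u (c i).+1 - u (c i)).

Let SD m : S m + D m = u (c m).
Proof.
elim: m => [|m IH].
  by rewrite /S /D big_ord0 addr0 big_ord1 /block /c mul0n add0n jN.
rewrite /S /D big_ord_recr /= [X in _ + X]big_ord_recr /= -/(S m) -/(D m).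
by rewrite addrACA IH blockS [X in _ + X]addrA subrK addrC subrK.
Qed.

Let norm_diff m n : `|u m - u n| <= 2.
Proof. by rewrite (le_trans (ler_normB _ _))//; have := u_le1 m; have := u_le1 n; lra. Qed.

Let norm_S m : `|S m| <= 2 * m.+1%:R.
Proof.
rewrite (le_trans (ler_norm_sum _ _ _))//.
rewrite mulr_natr -[X in _ *+ X]card_ord -sumr_const; apply: ler_sum => i _.
rewrite /block; case: ifP => _; last exact: norm_diff.
by rewrite (le_trans (u_le1 _))// ler1n.
Qed.

Let norm_D m : `|D m| <= 2 * m%:R.
Proof.
rewrite (le_trans (ler_norm_sum _ _ _))//.
rewrite mulr_natr -[X in _ *+ X]card_ord -sumr_const; apply: ler_sum => i _.
exact: norm_diff.
Qed.

Let c_lt i m : (i < m)%N -> (c i + N <= c m)%N.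
Proof.
move=> im; rewrite -cS /c leq_add2r leq_mul2r; apply/orP; right; exact: im.
Qed.

Let c_mono i m : (i <= m)%N -> (c i <= c m)%N.
Proof. by move=> im; rewrite /c leq_add2r leq_mul2r im orbT. Qed.

Let E_S m : E (c m) (S m) = S m.
Proof.
rewrite /S linear_sum; apply: eq_bigr => i _; rewrite /block.
have im : (c i <= c m)%N by apply: c_mono; rewrite -ltnS ltn_ord.
case: ifP => iN; first exact: E_u.
rewrite linearB /= !E_u// (leq_trans _ im)//.
rewrite leq_subLR -add1n leq_add2r; exact: ltnW.
Qed.

(** The last gap in [D m] ends at c (m - 1) + 1, which is at most c m - 1 because N >= 2. So there
    is an operator strictly before the next gap, which starts at c m. *)
Let E_D m k : ((c m).-1 <= k)%N -> E k (D m) = D m.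
Proof.
move=> ck; rewrite /D linear_sum; apply: eq_bigr => i _.
have im : (c i + N <= c m)%N by apply: c_lt.
have h1 : ((c i).+1 <= k)%N.
  apply: leq_trans ck; rewrite -ltnS prednK; last first.
    by rewrite (leq_trans _ im)// addn_gt0 (ltnW N2) orbT.
  by apply: leq_trans im; rewrite -addn2 leq_add2l.
by rewrite linearB /= !E_u// ltnW.
Qed.

Let half_pow m n : (m <= n)%N -> 2^-1 ^+ n <= 2^-1 ^+ m :> R.
Proof.
by move=> mn; rewrite ler_wiXn2l// ?invr_ge0// invf_le1// ler1n.
Qed.

(** The new block starts at c m + 1, one index after the operator fixing [S m]; this is what the
    dropped increment buys. Since c m >= m, the errors are dominated by a geometric series. *)
Lemma sum_blocks_offset m :
  `| `|S m| `^ p - \sum_(i < m.+1) `|block (c i)| `^ p| <= delta * (1 - 2^-1 ^+ m).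
Proof.
elim: m => [|m IH].
  by rewrite /S !big_ord1 subrr normr0 expr0 subrr mulr0.
rewrite {1}/S big_ord_recr /= -/(S m) [X in _ - X]big_ord_recr /= blockS.
have k1 : (c m < (c m).+1)%N by [].
have k2 : ((c m).+1 <= c m.+1)%N by rewrite cS -addn1 leq_add2l ltnW.
have k3 : `|S m| <= 2 * (c m).+1%:R.
  by rewrite (le_trans (norm_S m))// ler_wpM2l// ler_nat ltnS c_ge.
have h := almost_disjoint k1 k2 (E_S m) k3.
have h2 : delta * 2^-1 ^+ (c m).+1 <= delta * 2^-1 ^+ m.+1.
  by rewrite ler_wpM2l ?(ltW delta0)// half_pow// ltnS c_ge.
have E1 : 2^-1 ^+ m = 2 * 2^-1 ^+ m.+1 :> R by rewrite exprS mulrA divff ?mul1r.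
rewrite E1 in IH.
move: IH h h2; rewrite !ler_norml.
set A := `|_ + _| `^ p; set B := `|S m| `^ p; set F := \sum_(i < _) _.
set G := `|_ - _| `^ p; set H := 2^-1 ^+ m.+1.
by move=> /andP[a1 a2] /andP[a3 a4] a5; apply/andP; split; lra.
Qed.

Lemma sum_gaps_offset m :
  `| `|D m| `^ p - \sum_(i < m) `|u (c i).+1 - u (c i)| `^ p| <=
  delta * (1 - 2^-1 ^+ m).
Proof.
elim: m => [|m IH].
  by rewrite /D !big_ord0 normr0 powR0 ?gt_eqF// subrr normr0 expr0 subrr mulr0.
(* The first gap may start at index 0, with no operator before it; a single term has no defect
   anyway. *)
have [m0|m0] := posnP m.
  rewrite m0 /D !big_ord1 subrr normr0 mulr_ge0 ?(ltW delta0)// subr_ge0.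
  by rewrite exprn_ile1// ?invr_ge0// invf_le1// ler1n.
rewrite {1}/D big_ord_recr /= -/(D m) [X in _ - X]big_ord_recr /=.
have mc : (m < c m)%N.
  by rewrite /c (leq_trans _ (leq_addr _ _))// -[X in (X < _)%N]muln1 ltn_pmul2l.
have cm0 : (0 < c m)%N by exact: leq_ltn_trans mc.
have k1 : ((c m).-1 < c m)%N by rewrite prednK.
have k2 : (c m <= (c m).+1)%N by [].
have k3 : `|D m| <= 2 * (c m).-1.+1%:R.
  by rewrite (le_trans (norm_D m))// ler_wpM2l// ler_nat prednK// ltnW.
have h := almost_disjoint k1 k2 (E_D (leqnn _)) k3.
rewrite prednK// in h.
have h2 : delta * 2^-1 ^+ (c m) <= delta * 2^-1 ^+ m.+1.
  by rewrite ler_wpM2l ?(ltW delta0)// half_pow.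
have E1 : 2^-1 ^+ m = 2 * 2^-1 ^+ m.+1 :> R by rewrite exprS mulrA divff ?mul1r.
rewrite E1 in IH.
move: IH h h2; rewrite !ler_norml.
set A := `|_ + _| `^ p; set B := `|D m| `^ p; set F := \sum_(i < _) _.
set G := `|_ - _| `^ p; set H := 2^-1 ^+ m.+1.
by move=> /andP[a1 a2] /andP[a3 a4] a5; apply/andP; split; lra.
Qed.

(** [powRD_le_eps] is used in both directions, on S = u - D and on u = S + D, with |u| <= 1 for the
    upper bound. The p-th power of the norm of D is at most delta plus the sum of the gaps. *)
Lemma offset_estimates (s C : R) m : 0 <= s -> 0 <= C ->
  (forall x y, 0 <= x -> 0 <= y ->
    (x + y) `^ p <= (1 + s) * x `^ p + C * y `^ p) ->
  let B := \sum_(i < m.+1) `|block (c i)| `^ p in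
  let G := \sum_(i < m.+1) `|u (c i).+1 - u (c i)| `^ p in
  B <= 1 + s + delta + C * (delta + G) /\
  `|u (c m)| `^ p <= (1 + s) * (B + delta) + C * (delta + G).
Proof.
move=> s0 C0 sC B G.
have hp m' : delta * (1 - 2^-1 ^+ m') <= delta.
  by rewrite ler_piMr ?(ltW delta0)// gerBl exprn_ge0// invr_ge0.
have hS := le_trans (sum_blocks_offset m) (hp m).
have hD := le_trans (sum_gaps_offset m) (hp m).
have GG : \sum_(i < m) `|u (c i).+1 - u (c i)| `^ p <= G.
  by rewrite /G big_ord_recr /= lerDl powR_ge0.
have Dp : `|D m| `^ p <= delta + G by move: hD; rewrite ler_norml; lra.
have n1 : `|S m| `^ p <= (1 + s) * `|u (c m)| `^ p + C * `|D m| `^ p.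
  apply: le_trans (sC _ _ (normr_ge0 _) (normr_ge0 _)).
  rewrite ge0_ler_powR ?nnegrE ?addr_ge0 ?(ltW p0)//.
  by rewrite -SD (le_trans _ (ler_normB _ _))// addrK.
have n2 : `|u (c m)| `^ p <= (1 + s) * `|S m| `^ p + C * `|D m| `^ p.
  apply: le_trans (sC _ _ (normr_ge0 _) (normr_ge0 _)).
  rewrite ge0_ler_powR ?nnegrE ?addr_ge0 ?(ltW p0)//.
  by rewrite -SD ler_normD.
have up : `|u (c m)| `^ p <= 1.
  have -> : 1 = 1 `^ p :> R by rewrite powR1.
  by rewrite ge0_ler_powR ?nnegrE ?(ltW p0).
have CD := ler_wpM2l C0 Dp.
have s1 : 0 <= 1 + s by rewrite addr_ge0.
move: hS; rewrite ler_norml -/B => /andP[b1 b2].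
split.
  have := ler_wpM2l s1 up; rewrite mulr1; lra.
have : (1 + s) * `|S m| `^ p <= (1 + s) * (B + delta) by rewrite ler_wpM2l//; lra.
lra.
Qed.

End offset.

Lemma sum_offsets (F : nat -> R) m :
  \sum_(k < m * N) F k = \sum_(j < N) \sum_(i < m) F (i * N + j)%N.
Proof.
elim: m => [|m IH].
  by rewrite mul0n big_ord0 big1// => j _; rewrite big_ord0.
rewrite mulSn addnC big_split_ord /= IH -big_split /=.
by apply: eq_bigr => j _; rewrite big_ord_recr.
Qed.

(** Summed over the residues j, the gaps run once through all increments. Their total is at most
    2^(p-1) however large N is, while every other term is multiplied by N. *)
Lemma blocks_upper (s C : R) m : 0 <= s -> 0 <= C ->
  (forall x y, 0 <= x -> 0 <= y ->
    (x + y) `^ p <= (1 + s) * x `^ p + C * y `^ p) ->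
  \sum_(k < m * N) `|block k| `^ p <=
  N%:R * (1 + s + delta + C * delta) + C * 2 `^ (p - 1).
Proof.
move=> s0 C0 sC; case: m => [|m].
  rewrite mul0n big_ord0 addr_ge0 ?mulr_ge0 ?addr_ge0 ?powR_ge0 ?(ltW delta0)//.
  by rewrite mulr_ge0// ltW.
have inc := increments (m.+1 * N).
rewrite (sum_offsets (fun k => `|u k.+1 - u k| `^ p)) in inc.
rewrite (sum_offsets (fun k => `|block k| `^ p)).
apply: (@le_trans _ _ (\sum_(j < N) (1 + s + delta + C * (delta +
    \sum_(i < m.+1) `|u (i * N + j).+1 - u (i * N + j)%N| `^ p)))).
  by apply: ler_sum => j _; have [] := offset_estimates (ltn_ord j) m s0 C0 sC.
under eq_bigr => j _ do rewrite mulrDr addrA.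
rewrite big_split /= sumr_const card_ord mulr_natl lerD2l -mulr_sumr.
by rewrite ler_wpM2l.
Qed.

Lemma blocks_lower (s C L : R) m : 0 <= s -> 0 <= C ->
  (forall x y, 0 <= x -> 0 <= y ->
    (x + y) `^ p <= (1 + s) * x `^ p + C * y `^ p) ->
  (forall k, (m <= k)%N -> L <= `|u k| `^ p) ->
  N%:R * L <= (1 + s) * (\sum_(k < m.+1 * N) `|block k| `^ p + N%:R * delta) +
    C * (N%:R * delta + 2 `^ (p - 1)).
Proof.
move=> s0 C0 sC uL.
have inc := increments (m.+1 * N).
rewrite (sum_offsets (fun k => `|u k.+1 - u k| `^ p)) in inc.
rewrite (sum_offsets (fun k => `|block k| `^ p)).
have -> : N%:R * L = \sum_(j < N) L by rewrite sumr_const card_ord mulr_natl.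
have -> : N%:R * delta = \sum_(j < N) delta by rewrite sumr_const card_ord mulr_natl.
apply: (@le_trans _ _ (\sum_(j < N) ((1 + s) *
   (\sum_(i < m.+1) `|block (i * N + j)%N| `^ p + delta) + C * (delta +
    \sum_(i < m.+1) `|u (i * N + j).+1 - u (i * N + j)%N| `^ p)))).
  apply: ler_sum => j _; have [_] := offset_estimates (ltn_ord j) m s0 C0 sC.
  apply: le_trans; apply: uL.
  by rewrite (leq_trans (leq_pmulr m (ltnW N2)))// leq_addr.
rewrite big_split /= -!mulr_sumr !big_split /= lerD2l ler_wpM2l// lerD2l.
exact: inc.
Qed.

End skipped_blocks.

#[local] Opaque powint.

Lemma residual_split (V : zmodType) (E : {additive V -> V}) (x g : V) :
  x - g - (E g - g) - E (x - g) = x - E x.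
Proof.
have -> : x - g - (E g - g) = x - E g by rewrite opprB addrA subrK.
by rewrite raddfB opprB addrA subrK.
Qed.

Lemma norm_sub_le2 (R : realType) (V : normedModType R) (x y : V) :
  `|x| <= 1 -> `|y| <= 1 -> `|x - y| <= 2.
Proof. by move=> x1 y1; rewrite (le_trans (ler_normB _ _))//; lra. Qed.

Lemma twice_quarters_le (R : realFieldType) (h a b : R) :
  a <= h / 4 -> b <= h / 4 -> 2 * a + 2 * b <= h.
Proof. by move=> *; lra. Qed.

Lemma approx_norm_lower (R : realFieldType) (a b c d e f g h i : R) :
  a <= e / 2 -> b <= c -> d <= e / 2 -> c <= d -> f <= g ->
  h <= b + f -> i <= a + h -> i - e <= g.
Proof. by move=> *; lra. Qed.

Lemma blocks_upper_le (R : realFieldType) (e c b C K : R) :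
  0 < e -> 0 < c -> C * K <= c * (e / 8) -> c * (b + C * b) <= c * (e / 8) ->
  c * (1 + e / 8 + b + C * b) + C * K <= c * (1 + e).
Proof. by move=> e0 c0 h1 h2; have := mulr_gt0 c0 e0; lra. Qed.

Lemma blocks_lower_contradiction (R : realFieldType) (e c b C K S : R) :
  0 < e -> e < 1 -> 0 < c -> 0 <= b -> 0 <= C ->
  C * K <= c * (e / 8) -> c * (b + C * b) <= c * (e / 8) -> S < c * (1 - e) ->
  c * (1 - e / 8) <= (1 + e / 8) * (S + c * b) + C * (c * b + K) -> False.
Proof.
move=> e0 e1 c0 b0 C0 h1 h2 h3 h4.
have ce : 0 < c * e by rewrite mulr_gt0.
have ce2 : 0 <= c * (e * e) by rewrite !mulr_ge0// ltW.
have cb : 0 <= c * b by rewrite mulr_ge0// ltW.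
have cCb : 0 <= c * (C * b) by rewrite mulr_ge0 ?(ltW c0)// mulr_ge0.
have ecb : e * (c * b) <= c * b by rewrite ler_piMl// ltW.
have e8 : 0 <= 1 + e / 8 by lra.
have h5 : (1 + e / 8) * S <= (1 + e / 8) * (c * (1 - e)).
  by rewrite ler_wpM2l// ltW.
by lra.
Qed.

Section adapted_partitions.
Context d (T : measurableType d) (R : realType).
Variable mu : probability T R.
Variables (p : R) (p2 : 2 < p) (p1 : (1 <= p%:E)%E).
Local Notation V := (LspaceType mu p1).
Variable X : closed_subspace (V : normedModType R).
Hypothesis Xtb : L2_totally_bounded X.
Implicit Types (pi : fpart T).

Let p0 : 0 < p. Proof. exact: lt_trans p2. Qed.
Let p1' : 1 <= p. Proof. by rewrite -lee_fin. Qed.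
Let q1 : 1 <= (2 : R) <= p. Proof. by rewrite ler1n ltW. Qed.

Lemma cexp_dense_seq (s : seq V) (e : R) : 0 < e ->
  exists pi, forall pi', refines pi pi' -> forall g, g \in s -> `|g - cexp pi' g| <= e.
Proof.
move=> e0; elim: s => [|g s [pi Hpi]]; first by exists (fpart_trivial T).
have [pi' Hpi'] := cexp_dense p2 g e0.
exists (fpart_join pi pi') => pi2 r h.
rewrite inE => /predU1P[->|hs].
  exact: Hpi' _ (refines_trans (refines_joinr pi pi') r).
exact: Hpi _ (refines_trans (refines_joinl pi pi') r) _ hs.
Qed.

(** For g in a finite net near x, x - E x splits into x - g, E g - g and E (x - g). Each
    [powint2_sub] doubles, and the shares e / 12 for x - g and E (x - g) and e / 8 for E g - g add
    up to e. *)
Lemma L2_dist_cexp (e : R) : 0 < e -> exists pi, forall pi', refines pi pi' ->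
  forall x : X, `|x| <= 1 -> powint 2 (val x - cexp pi' (val x)) <= e.
Proof.
move=> e0; have [s Hs] := Xtb (divr_gt0 e0 (ltr0n R 12)).
have q0 : 0 < Num.sqrt e / 4 by rewrite divr_gt0// sqrtr_gt0.
have [pi Hpi] := cexp_dense_seq s q0.
exists pi => pi' r x x1; have [g gs xg] := Hs x x1.
have gE := Hpi _ r _ gs.
have h1 := powint2_sub p2 (val x - g) (cexp pi' g - g).
have h2 := powint2_sub p2 (val x - g - (cexp pi' g - g)) (cexp pi' (val x - g)).
have h3 := powint_cexp_le pi' (val x - g) q1.
have h4 := powint2_le p2 (cexp pi' g - g).
have h5 : `|cexp pi' g - g| ^+ 2 <= e / 16.
  have -> : e / 16 = (Num.sqrt e / 4) ^+ 2.
    by rewrite expr_div_n sqr_sqrtr ?(ltW e0)// -natrX.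
  by rewrite ler_sqr ?nnegrE ?(ltW q0)// distrC.
have E : val x - g - (cexp pi' g - g) - cexp pi' (val x - g) =
    val x - cexp pi' (val x).
  exact: residual_split.
rewrite E in h2; move: h1 h2 h3 h4 h5 xg.
move: (powint 2 (val x - cexp pi' (val x))) (powint 2 (cexp pi' (val x - g))).
move: (powint 2 (val x - g - (cexp pi' g - g))) (powint 2 (cexp pi' g - g)).
move: (powint 2 (val x - g)) (`|cexp pi' g - g| ^+ 2) => A B D F G H.
by move=> *; lra.
Qed.

(** Being fixed by [cexp pi], f has its sup bounded by a constant M depending only on pi and B. Half
    of e pays for the terms in c, as |r| <= 2, and half for the L_2 term. *)
Lemma almost_disjoint_cexp pi (B e : R) : 0 <= B -> 0 < e ->
  exists2 h, 0 < h & forall f r : V, cexp pi f = f -> `|f| <= B -> `|r| <= 2 ->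
    powint 2 r <= h -> `| `|f + r| `^ p - `|f| `^ p - `|r| `^ p| <= e.
Proof.
move=> B0 e0; have [C C0 HC] := cexp_sup_bound mu p2 p1 pi.
pose M := C * Num.sqrt (2 * B ^+ 2).
have M0 : 0 <= M by rewrite mulr_ge0// sqrtr_ge0.
have t0 : 0 < 1 + 2 `^ p :> R by rewrite ltr_wpDr ?powR_ge0.
pose c := e / 2 / (1 + 2 `^ p).
have e'0 : 0 < c by rewrite !divr_gt0.
have [D D0 HD] := norm_almost_disjoint mu p2 p1 M0 e'0.
have D1 : 0 < D + 1 by rewrite ltr_wpDl.
exists (e / 2 / (D + 1)) => [|f r Ef fB r2 rh]; first by rewrite !divr_gt0.
have fM : {ae mu, forall t, `|f t| <= M}.
  have := HC f; rewrite Ef; apply: filterS => t /le_trans; apply.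
  rewrite ler_wpM2l// ler_wsqrtr// (le_trans (powint2_le p2 f))//.
  by rewrite ler_wpM2l// ler_sqr ?nnegrE.
apply: (le_trans (HD f r fM)).
have h1 : `|r| `^ p <= 2 `^ p by rewrite ge0_ler_powR ?nnegrE ?(ltW p0).
have h2 : D * powint 2 r <= D * (e / 2 / (D + 1)) by rewrite ler_wpM2l.
have h3 : D * (e / 2 / (D + 1)) <= e / 2.
  rewrite mulrCA; apply: ler_piMr; first by rewrite ltW// divr_gt0.
  by rewrite ler_pdivrMr// mul1r lerDl.
have h4 := ler_wpM2l (ltW e'0) h1.
have h5 : c * (1 + 2 `^ p) = e / 2 by rewrite divfK// gt_eqF.
move: h2 h3 h4 h5; rewrite mulrDr mulr1.
move: (D * powint 2 r) (D * (e / 2 / (D + 1))) (c) (c * _) (c * 2 `^ p) => a1 a2 a3 a4 a5.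
by move=> *; lra.
Qed.

Lemma partition_sequence (e : R) : 0 < e -> exists P : nat -> fpart T,
  [/\ forall k m, (k <= m)%N -> refines (P k) (P m),
      forall k m (x : X), `|x| <= 1 -> (k < m)%N ->
        powint 2 (val x - cexp (P m) (val x)) <= 2^-1 ^+ k &
      forall (x : X), `|x| <= 1 -> forall k m m' (f : V), (k < m)%N -> (m <= m')%N ->
        cexp (P k) f = f -> `|f| <= 2 * k.+1%:R ->
        `| `|f + (cexp (P m') (val x) - cexp (P m) (val x))| `^ p - `|f| `^ p -
          `|cexp (P m') (val x) - cexp (P m) (val x)| `^ p| <= e * 2^-1 ^+ k.+1].
Proof.
move=> e0.
have next (ip : nat * fpart T) : exists pi', refines ip.2 pi' /\
    forall pi2 pi3, refines pi' pi2 -> refines pi' pi3 -> forall x : X, `|x| <= 1 ->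
      powint 2 (val x - cexp pi2 (val x)) <= 2^-1 ^+ ip.1 /\
      forall f : V, cexp ip.2 f = f -> `|f| <= 2 * ip.1.+1%:R ->
        `| `|f + (cexp pi3 (val x) - cexp pi2 (val x))| `^ p - `|f| `^ p -
          `|cexp pi3 (val x) - cexp pi2 (val x)| `^ p| <= e * 2^-1 ^+ ip.1.+1.
  case: ip => k pi /=.
  have B0 : 0 <= 2 * k.+1%:R :> R by rewrite mulr_ge0.
  have ek : 0 < e * 2^-1 ^+ k.+1 by rewrite mulr_gt0// exprn_gt0// invr_gt0.
  have [h h0 Hh] := almost_disjoint_cexp pi B0 ek.
  (* The difference of two averages of x is a difference of two residuals; [powint2_sub] doubles
     both, so h / 4 for each gives h. The threshold h depends on the current partition, which is why
     the next one is chosen after it. *)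
  have hk : 0 < Num.min (2^-1 ^+ k) (h / 4).
    by rewrite lt_min divr_gt0// exprn_gt0// invr_gt0.
  have [pi0 Hpi0] := L2_dist_cexp hk.
  exists (fpart_join pi pi0); split; first exact: refines_joinl.
  move=> pi2 pi3 r2 r3 x x1.
  have H pi' : refines (fpart_join pi pi0) pi' ->
      powint 2 (val x - cexp pi' (val x)) <= 2^-1 ^+ k /\
      powint 2 (val x - cexp pi' (val x)) <= h / 4.
    move=> r; have := Hpi0 _ (refines_trans (refines_joinr pi pi0) r) x x1.
    by rewrite le_min => /andP[].
  have [H2 h2] := H _ r2; have [_ h3] := H _ r3.
  split; first exact: H2.
  move=> f Ef fB; apply: Hh => //.
    by apply: norm_sub_le2; exact: le_trans (norm_cexp_le p2 _ (val x)) x1.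
  have -> : cexp pi3 (val x) - cexp pi2 (val x) =
      (val x - cexp pi2 (val x)) - (val x - cexp pi3 (val x)).
    by rewrite opprB [RHS]addrC addrA subrK.
  apply: (le_trans (powint2_sub p2 _ _)).
  exact: twice_quarters_le h2 h3.
have [F HF] := choice next.
pose P := fix P i := if i is j.+1 then F (j, P j) else fpart_trivial T.
have PS k : refines (P k) (P k.+1) by case: (HF (k, P k)).
have Pm k m : (k <= m)%N -> refines (P k) (P m).
  move=> km; rewrite -(subnKC km); elim: (m - k)%N => [|i IH].
    by rewrite addn0; exact: refines_refl.
  by rewrite addnS; exact: refines_trans IH (PS _).
exists P; split => //.
- move=> k m x x1 km; case: (HF (k, P k)) => _ H.
  by have [h _] := H (P m) (P m) (Pm _ _ km) (Pm _ _ km) x x1.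
- move=> x x1 k m m' f km mm' Ef fB; case: (HF (k, P k)) => _ H.
  have [_ h] := H (P m) (P m') (Pm _ _ km) (Pm _ _ (leq_trans km mm')) x x1.
  exact: h.
Qed.

(** On a fixed fine partition pi, [cexp pi x] has almost the norm of x. There the L_2-norm controls
    the norm, so L_2-convergence passes to norms after applying [cexp pi], and contractivity then
    bounds [cexp (P k) x] from below. *)
Lemma norm_cexp_cvg (P : nat -> fpart T) (x : X) (e : R) :
  (forall k m, (k < m)%N -> powint 2 (val x - cexp (P m) (val x)) <= 2^-1 ^+ k) ->
  0 < e -> exists K, forall k, (K <= k)%N -> `|x| - e <= `|cexp (P k) (val x)|.
Proof.
move=> HP e0; have e20 : 0 < e / 2 by rewrite divr_gt0.
have [pi Hpi] := cexp_dense p2 (val x) e20.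
have h1 := Hpi _ (refines_refl pi).
have [C C0 HC] := cexp_norm_bound mu p2 p1 pi.
have C1 : 0 < C + 1 by rewrite ltr_wpDl.
have d0 : 0 < (e / 2 / (C + 1)) ^+ 2 by rewrite exprn_gt0// divr_gt0.
have [K HK] : exists K, 2^-1 ^+ K <= (e / 2 / (C + 1)) ^+ 2 :> R.
  have : (geometric 1 (2^-1 : R)) @ \oo --> 0.
    by apply: cvg_geometric; rewrite ger0_norm//; lra.
  move=> /cvgrPdist_le/(_ _ d0)[K _ HK].
  exists K; have := HK K (leqnn K); rewrite /= mul1r sub0r normrN.
  exact: le_trans (ler_norm _).
exists K.+1 => k Kk; have h2 := le_trans (HP _ _ Kk) HK.
have h3 := HC (val x - cexp (P k) (val x)).
have h4 : Num.sqrt (powint 2 (val x - cexp (P k) (val x))) <= e / 2 / (C + 1).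
  rewrite -[leRHS]ger0_norm ?(ltW (divr_gt0 e20 C1))// -sqrtr_sqr.
  exact: ler_wsqrtr.
have h5 : C * (e / 2 / (C + 1)) <= e / 2.
  rewrite mulrCA; apply: ler_piMr; first exact: ltW.
  by rewrite ler_pdivrMr// mul1r lerDl.
have h6 := ler_wpM2l C0 h4.
have h7 := norm_cexp_le p2 pi (cexp (P k) (val x)).
have h8 := ler_normD (cexp pi (val x) - cexp pi (cexp (P k) (val x)))
  (cexp pi (cexp (P k) (val x))).
rewrite subrK in h8.
have h9 := ler_normD (val x - cexp pi (val x)) (cexp pi (val x)).
rewrite subrK in h9.
rewrite (linearB (cexp pi)) in h3.
change (`|val x| - e <= `|cexp (P k) (val x)|).
exact: (approx_norm_lower h1 h3 h5 h6 h7 h8 h9).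
Qed.

Lemma almost_isometric_blocks (e : R) : 0 < e -> e < 1 ->
  exists (P : nat -> fpart T) (N : nat),
  [/\ (0 < N)%N, forall k m, (k <= m)%N -> refines (P k) (P m) &
  forall x : X, `|x| = 1 ->
    (forall n, \sum_(k < n) `|block (fun k => cexp (P k) (val x)) N k| `^ p <=
      N%:R * (1 + e)) /\
    exists n, N%:R * (1 - e) <=
      \sum_(k < n) `|block (fun k => cexp (P k) (val x)) N k| `^ p].
Proof.
move=> e0 e1; pose s := e / 8.
have s0 : 0 < s by rewrite divr_gt0.
have [C C0 sC] := powRD_le_eps p1' s0.
have C1 : 0 < C + 1 by rewrite ltr_wpDl.
pose dl := e / 8 / (C + 1).
have dl0 : 0 < dl by rewrite !divr_gt0.
have [P [Pm Pd Pa]] := partition_sequence dl0.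
(* Chosen last, since C depends on s alone: the loss C 2^(p-1), common to all offsets, becomes at
   most N e / 8. The + 2 also ensures N > 1. *)
pose N := (Num.truncn (8 * (C * 2 `^ (p - 1)) / e)).+2.
have N2 : (1 < N)%N by [].
have N0 : 0 < N%:R :> R by rewrite ltr0n.
have Ne : C * 2 `^ (p - 1) <= N%:R * (e / 8).
  have : 8 * (C * 2 `^ (p - 1)) / e <= N%:R.
    by rewrite ltW// (lt_le_trans (truncnS_gt _))// ler_nat.
  by rewrite ler_pdivrMr// => h; move: h; clearbody N; lra.
have Cdl : dl + C * dl <= e / 8.
  have -> : dl + C * dl = dl * (C + 1) by ring.
  by rewrite /dl divfK ?gt_eqF.
exists P, N; split => // x x1.
pose u k := cexp (P k) (val x).
have xle : `|x| <= 1 by rewrite x1.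
have u1 k : `|u k| <= 1 by apply: le_trans (norm_cexp_le p2 (P k) (val x)) xle.
have Eu k m : (m <= k)%N -> cexp (P k) (u m) = u m.
  by move=> mk; exact: cexp_towerr (Pm _ _ mk).
(* Clarkson's inequality for martingale differences, at exponent p, telescopes: |u 0|^p plus 2^(1-p)
   times the sum of the increments is at most |u n|^p <= 1. *)
have inc n : \sum_(k < n) `|u k.+1 - u k| `^ p <= 2 `^ (p - 1).
  have t0 : 0 < 2 `^ (p - 1) :> R by rewrite powR_gt0.
  have E' : 2 `^ (1 - p) = (2 `^ (p - 1))^-1 :> R by rewrite -powRN opprB.
  have H : `|u 0%N| `^ p + 2 `^ (1 - p) * \sum_(k < n) `|u k.+1 - u k| `^ p <= `|u n| `^ p.
    elim: n => [|n IH]; first by rewrite big_ord0 mulr0 addr0.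
    rewrite big_ord_recr /= mulrDr addrA.
    have qp : 2 <= p <= p by rewrite lexx (ltW p2).
    have Ew : cexp (P n) (u n.+1 - u n) = 0.
      by rewrite linearB /= (Eu n n)// /u (cexp_towerl _ (Pm _ _ (leqnSn n))) subrr.
    have := martingale_lower qp (Eu n n (leqnn n)) Ew.
    rewrite !powint_norm [u n + _]addrC subrK; apply: le_trans.
    by apply: lerD IH _.
  have h1 : `|u n| `^ p <= 1.
    have -> : 1 = 1 `^ p :> R by rewrite powR1.
    by rewrite ge0_ler_powR ?nnegrE ?(ltW p0).
  have h2 := powR_ge0 `|u 0%N| p.
  rewrite E' in H; rewrite -(ler_pM2l (_ : 0 < (2 `^ (p - 1))^-1)) ?invr_gt0//.
  rewrite mulVf ?gt_eqF//; apply: le_trans h1; apply: le_trans H.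
  by rewrite lerDr.
have Pa' := Pa x xle.
have dlN : N%:R * (dl + C * dl) <= N%:R * (e / 8) by rewrite ler_wpM2l// ltW.
have up m := @blocks_upper _ _ _ p2 (fun k => cexp (P k)) u dl N dl0 N2 u1 Eu Pa' inc
  s C m (ltW s0) C0 sC.
split.
  move=> n; apply: (@le_trans _ _ (\sum_(k < n * N) `|block u N k| `^ p)).
    apply: (@sum_widen_le _ (fun k => `|block u N k| `^ p)) => [k|].
      exact: powR_ge0.
    exact: leq_pmulr.
  by apply: (le_trans (up n)); exact: blocks_upper_le e0 N0 Ne dlN.
have e'0 : 0 < e / 8 / p by rewrite !divr_gt0.
have [M HM] : exists M, forall k, (M <= k)%N -> `|x| - e / 8 / p <= `|cexp (P k) (val x)|.
  by apply: norm_cexp_cvg => // k m km; exact: Pd.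
(* The tangent to the p-th power at 1 gives (1 - e / (8p))^p >= 1 - e / 8, whence the division by
   p. *)
have uL k : (M <= k)%N -> 1 - e / 8 <= `|u k| `^ p.
  move=> Mk; have hu := HM k Mk; rewrite x1 -/(u k) in hu.
  have := powR_tangent p1' ler01 (normr_ge0 (u k)).
  rewrite !powR1 mulr1; apply: le_trans.
  have := ler_wpM2l (ltW p0) hu.
  rewrite mulrBr mulr1 [p * (e / 8 / p)]mulrC divfK ?gt_eqF// => h.
  by rewrite lerD2l mulrBr mulr1 lerBrDr addrC.
have lo := @blocks_lower _ _ _ p2 (fun k => cexp (P k)) u dl N dl0 N2 u1 Eu Pa' inc
  s C (1 - e / 8) M (ltW s0) C0 sC uL.
exists (M.+1 * N)%N; rewrite leNgt; apply/negP => lt.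
exact: (blocks_lower_contradiction e0 e1 N0 (ltW dl0) C0 Ne dlN lt lo).
Qed.

End adapted_partitions.

(** * Listing the coordinates of all blocks as one sequence *)

Section lexicographic_enumeration.
Variable n : nat -> nat.

(** Row k gets n k + 1 entries, so that no row is empty and the recursion never has to skip one. The
    extra entry later carries the coordinate 0. *)
Fixpoint lex_enum m : nat * nat :=
  if m is m'.+1 then
    let: (k, i) := lex_enum m' in
    if (i.+1 < (n k).+1)%N then (k, i.+1) else (k.+1, 0%N)
  else (0%N, 0%N).

Definition lex_offset K := (\sum_(k < K) (n k).+1)%N.

Lemma lex_enumE K i : (i <= n K)%N -> lex_enum (lex_offset K + i) = (K, i).
Proof.
elim: K i => [|K IHK] i; elim: i => [|i IHi] // ile.
- by rewrite /lex_offset big_ord0.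
- by rewrite addnS /= IHi ?(ltnW ile)// ltnS ile.
- rewrite addn0 /lex_offset big_ord_recr /= -/(lex_offset K) addnS /=.
  by rewrite IHK// ltnn.
- by rewrite addnS /= IHi ?(ltnW ile)// ltnS ile.
Qed.

Lemma lex_offset_ge K : (K <= lex_offset K)%N.
Proof.
rewrite /lex_offset -[X in (X <= _)%N]card_ord -sum1_card; exact: leq_sum.
Qed.

Lemma sum_lex_enum (R : nmodType) (F : nat -> nat -> R) K :
  \sum_(m < lex_offset K) F (lex_enum m).1 (lex_enum m).2 =
  \sum_(k < K) \sum_(i < (n k).+1) F k i.
Proof.
elim: K => [|K IH]; first by rewrite /lex_offset !big_ord0.
have -> : lex_offset K.+1 = (lex_offset K + (n K).+1)%N.
  by rewrite /lex_offset big_ord_recr.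
rewrite [RHS]big_ord_recr /= -IH big_split_ord /=; congr (_ + _).
by apply: eq_bigr => i _; rewrite lex_enumE//= -ltnS.
Qed.

End lexicographic_enumeration.

Section embedding_into_lp.
Context (R : realType) (X : normedModType R).
Variables (p : R) (p1 : (1 <= p%:E)%E).
Local Notation lpT := (LspaceType (counting : {measure set nat -> \bar R}) p1).
Variables (n : nat -> nat) (phi : nat -> nat -> X -> R) (a b : R).
Hypothesis a0 : 0 <= a.
Hypothesis b0 : 0 <= b.
Hypothesis phi_linear : forall k i c x y, phi k i (c *: x + y) = c * phi k i x + phi k i y.
Hypothesis upper : forall x K,
  \sum_(k < K) \sum_(i < n k) `|phi k i x| `^ p <= (b * `|x|) `^ p.
Hypothesis lower : forall x, exists K,
  (a * `|x|) `^ p <= \sum_(k < K) \sum_(i < n k) `|phi k i x| `^ p.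

Let p0 : 0 < p.
Proof. by rewrite (lt_le_trans ltr01)// -lee_fin. Qed.

Let coord x m : R :=
  let: (k, i) := lex_enum n m in if (i < n k)%N then phi k i x else 0.

Let coordE x K : \sum_(m < lex_offset n K) `|coord x m| `^ p =
  \sum_(k < K) \sum_(i < n k) `|phi k i x| `^ p.
Proof.
pose F k i : R := `|if (i < n k)%N then phi k i x else 0| `^ p.
have -> : \sum_(m < lex_offset n K) `|coord x m| `^ p =
    \sum_(m < lex_offset n K) F (lex_enum n m).1 (lex_enum n m).2.
  by apply: eq_bigr => m _; rewrite /coord /F; case: (lex_enum n m).
rewrite sum_lex_enum; apply: eq_bigr => k _.
rewrite big_ord_recr /= {2}/F ltnn normr0 powR0 ?gt_eqF// addr0.
by apply: eq_bigr => i _; rewrite /F ltn_ord.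
Qed.

Let coord_le x m : \sum_(i < m) `|coord x i| `^ p <= (b * `|x|) `^ p.
Proof.
apply: le_trans (upper x m); rewrite -coordE.
apply: (@sum_widen_le _ (fun i => `|coord x i| `^ p)) => [k|].
  exact: powR_ge0.
exact: lex_offset_ge.
Qed.

Lemma lp_embedding : exists f : {linear X -> lpT},
  forall x, a * `|x| <= `|f x| /\ `|f x| <= b * `|x|.
Proof.
have [f fE] := choice (fun x => lp_exists p1 (coord_le x)).
have f_linear : linear f.
  move=> c x y; apply: lp_eq => m; rewrite lp_coord_linear !fE /coord.
  case: (lex_enum n m) => k i; case: ifP => _; first exact: phi_linear.
  by rewrite mulr0 addr0.
pose f' : {linear X -> lpT} := HB.pack f (GRing.isLinear.Build R X lpT _ f f_linear).
exists f' => x /=; split.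
  have [K HK] := lower x.
  rewrite leNgt; apply/negP => /(gt0_ltr_powR p0).
  rewrite !nnegrE normr_ge0 mulr_ge0// => /(_ isT isT); apply/negP; rewrite -leNgt.
  apply: (le_trans HK); rewrite -coordE.
  apply: le_trans (lp_partial_sum_le (f x) (lex_offset n K)).
  by apply: ler_sum => i _; rewrite fE.
apply: lp_norm_le => [|m]; first by rewrite mulr_ge0.
apply: le_trans (coord_le x m).
by apply: ler_sum => i _; rewrite fE.
Qed.

End embedding_into_lp.

#[local] Opaque powint.

(** The choice s = e / (e + 3) makes (1 + s) / (1 - s) equal to 1 + 2 e / 3. *)
Lemma distortion_bounds (R : realFieldType) (e : R) : 0 < e ->
  1 <= (1 + e / (e + 3)) / (1 - e / (e + 3)) /\
  (1 + e / (e + 3)) / (1 - e / (e + 3)) < 1 + e.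
Proof.
move=> e0; have e3 : 0 < e + 3 by rewrite addr_gt0.
have -> : (1 + e / (e + 3)) / (1 - e / (e + 3)) = (2 * e + 3) / 3.
  by field; apply/andP; split; apply: lt0r_neq0; lra.
by split; [rewrite ler_pdivlMr//|rewrite ltr_pdivrMr//]; lra.
Qed.

Section banach_mazur_bounds.
Context (R : realType).
Implicit Types X Y Z : normedModType R.

Lemma opnorm_ge0 X Y (f : {linear X -> Y}) : (0 <= opnorm f)%E.
Proof.
apply: ereal_sup_ubound; exists 0; first by rewrite /= normr0.
by rewrite linear0 normr0.
Qed.

Lemma opnorm_le X Y (f : {linear X -> Y}) (c : R) : 0 <= c ->
  (forall x, `|f x| <= c * `|x|) -> (opnorm f <= c%:E)%E.
Proof.
move=> c0 fc; apply: ge_ereal_sup => _ [x /= x1 <-].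
by rewrite lee_fin (le_trans (fc x))// ler_piMr.
Qed.

Lemma banach_mazur_embedding X Y (f : {linear X -> Y}) (a b : R) :
  seq_complete X -> 0 < a -> 0 < b ->
  (forall x, a * `|x| <= `|f x| /\ `|f x| <= b * `|x|) ->
  exists Z : closed_subspace Y, (banach_mazur Z X <= (b / a)%:E)%E.
Proof.
move=> cX a0 b0 fab.
have fK : exists2 K, 0 < K & forall x, `|f x| <= K * `|x|.
  by exists b => // x; case: (fab x).
have [Z [g [h [gh hg ge]]]] := range_closed_subspace cX a0 (fun x => (fab x).1) fK.
have ng x : `|g x| = `|f x| by rewrite -ge.
have gb x : `|g x| <= b * `|x| by rewrite ng; case: (fab x).
have ha z : `|h z| <= a^-1 * `|z|.
  rewrite -ler_pdivrMl ?invr_gt0// invrK -{2}(hg z) ng.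
  by case: (fab (h z)).
exists Z; apply: (@le_trans _ _ (opnorm h * opnorm g)%E).
  apply: ereal_inf_lbound; exists (h, g) => //=; split => //.
  - exact: norm_bounded_continuous ha.
  - exact: norm_bounded_continuous gb.
rewrite mulrC EFinM; apply: lee_pmul; rewrite ?opnorm_ge0//.
- by apply: opnorm_le ha; rewrite invr_ge0 ltW.
- by apply: opnorm_le gb; rewrite ltW.
Qed.

Lemma banach_mazur_isomorphic X Y (e : R) :
  (banach_mazur X Y < e%:E)%E -> isomorphic Y X.
Proof.
move=> /ereal_inf_lt[_ [[f g] /= [cf cg fg gf] _] _].
by exists g, f; split.
Qed.

End banach_mazur_bounds.

Section almost_isometric_embedding.
Context d (T : measurableType d) (R : realType).
Variable mu : probability T R.
Variables (p : R) (p2 : 2 < p) (p1 : (1 <= p%:E)%E).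
Local Notation V := (LspaceType mu p1).
Local Notation lpT := (LspaceType (counting : {measure set nat -> \bar R}) p1).
Variable X : closed_subspace (V : normedModType R).

Let p0 : 0 < p. Proof. exact: lt_trans p2. Qed.
Let p1' : 1 <= p. Proof. by rewrite -lee_fin. Qed.

Section blocks.
Variables (P : nat -> fpart T) (N : nat).
Hypothesis N0 : (0 < N)%N.
Hypothesis P_refines : forall k m, (k <= m)%N -> refines (P k) (P m).

Let B k (x : V) : V := block (fun k => cexp (P k) x) N k.

Let B_linear k c (x y : V) : B k (c *: x + y) = c *: B k x + B k y.
Proof.
rewrite /B /block; case: ifP => _; first by rewrite linearP.
rewrite (linearP (cexp (P k))) (linearP (cexp (P (k.+1 - N)%N))).
by rewrite scalerBr opprD addrACA.
Qed.

Let cexp_B k x : cexp (P k) (B k x) = B k x.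
Proof.
rewrite /B /block; case: ifP => _; first exact: cexp_idem.
rewrite (linearB (cexp (P k))) /= cexp_idem cexp_towerr //.
by apply: P_refines; rewrite leq_subLR -add1n leq_add2r.
Qed.

(** Each block is fixed by the conditional expectation at its end, so its cell coordinates give its
    norm exactly. The factor N^(-1/p) turns the total over the N offsets into a mean; homogeneity
    reduces to the unit sphere. *)
Lemma block_embedding (e : R) : 0 < e -> e < 1 ->
  (forall x : X, `|x| = 1 ->
    (forall n, \sum_(k < n) `|B k (val x)| `^ p <= N%:R * (1 + e)) /\
    exists n, N%:R * (1 - e) <= \sum_(k < n) `|B k (val x)| `^ p) ->
  exists f : {linear X -> lpT}, forall x,
    (1 - e) `^ p^-1 * `|x| <= `|f x| /\ `|f x| <= (1 + e) `^ p^-1 * `|x|.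
Proof.
move=> e0 e1 HB.
pose phi k i (x : X) : R := N%:R `^ (- p^-1) * cellfun (P k) i (B k (val x)).
have NR : 0 < N%:R :> R by rewrite ltr0n.
have B0 k : B k 0 = 0.
  by have := B_linear k (-1) 0 0; rewrite scaleN1r oppr0 addr0 scaleN1r addNr.
have sumE (x : X) n : \sum_(k < n) \sum_(i < ncell (P k)) `|phi k i x| `^ p =
    N%:R^-1 * \sum_(k < n) `|B k (val x)| `^ p.
  rewrite mulr_sumr; apply: eq_bigr => k _.
  rewrite -[in RHS]cexp_B norm_cexp_powR// mulr_sumr; apply: eq_bigr => i _.
  rewrite /phi normrM powRM// (ger0_norm (powR_ge0 _ _)) -powRrM mulNr.
  by rewrite mulVf ?gt_eqF// powR_inv1 ?(ltW NR).
have scale (x : X) : x != 0 -> exists2 y : X, `|y| = 1 & forall n,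
    \sum_(k < n) `|B k (val x)| `^ p = `|x| `^ p * \sum_(k < n) `|B k (val y)| `^ p.
  move=> x0; have nx : `|x| != 0 by rewrite normr_eq0.
  exists (`|x|^-1 *: x).
    by rewrite normrZ normfV normr_id mulVf.
  move=> n; rewrite mulr_sumr; apply: eq_bigr => k _.
  have -> : B k (val (`|x|^-1 *: x)) = `|x|^-1 *: B k (val x).
    have -> : val (`|x|^-1 *: x) = `|x|^-1 *: val x + 0 :> V by rewrite addr0.
    by rewrite B_linear B0 addr0.
  rewrite -powRM// normrZ normfV normr_id mulrA divff// mul1r.
  by [].
have sum0 n : \sum_(k < n) `|B k (val (0 : X))| `^ p = 0.
  by apply: big1 => k _; rewrite (B0 k) normr0 powR0 ?gt_eqF.
have pow (c y : R) : 0 <= c -> 0 <= y -> (c `^ p^-1 * y) `^ p = c * y `^ p.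
  move=> c0 y0; rewrite powRM ?powR_ge0// -powRrM mulVf ?gt_eqF// powRr1//.
apply: (@lp_embedding _ _ _ _ (fun k => ncell (P k)) phi).
- exact: powR_ge0.
- exact: powR_ge0.
- move=> k i c x y; rewrite /phi.
  have -> : B k (val (c *: x + y)) = c *: B k (val x) + B k (val y) by exact: B_linear.
  by rewrite cellfun_linear mulrDr mulrCA.
- move=> x n; rewrite sumE pow//; last by rewrite addr_ge0// ltW.
  have [->|x0] := eqVneq x 0.
    by rewrite sum0 mulr0 mulr_ge0 ?powR_ge0// addr_ge0// ltW.
  have [y y1 ->] := scale x x0; have [/(_ n) h _] := HB y y1.
  rewrite mulrCA [leRHS]mulrC ler_wpM2l ?powR_ge0//.
  by rewrite mulrC ler_pdivrMr// mulrC.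
- move=> x; have [->|x0] := eqVneq x 0.
    exists 0%N; rewrite big_ord0 normr0 mulr0 powR0 ?gt_eqF//.
  have [y y1 yx] := scale x x0; have [_ [n h]] := HB y y1.
  exists n; rewrite sumE pow//; last by rewrite subr_ge0 ltW.
  rewrite yx mulrCA [leLHS]mulrC ler_wpM2l ?powR_ge0//.
  by rewrite [leRHS]mulrC ler_pdivlMr// mulrC.
Qed.

End blocks.

Lemma almost_isometric_embedding : L2_totally_bounded X ->
  forall e : R, 0 < e -> exists X0 : closed_subspace (lpT : normedModType R),
    (banach_mazur X0 (X : normedModType R) < (1 + e)%:E)%E.
Proof.
move=> Xtb e e0; pose s := e / (e + 3).
have e3 : 0 < e + 3 by rewrite addr_gt0.
have s0 : 0 < s by rewrite divr_gt0.
have s1 : s < 1 by rewrite /s ltr_pdivrMr// mul1r ltrDl.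
have [P [N [N0 Pm HB]]] := almost_isometric_blocks p2 Xtb s0 s1.
have [f fab] := block_embedding N0 Pm s0 s1 HB.
have a0 : 0 < 1 - s by rewrite subr_gt0.
have b0 : 0 < 1 + s by rewrite addr_gt0.
have cX : seq_complete (X : normedModType R).
  exact/closed_subspace_complete/Lspace_seq_complete.
have [Z HZ] := banach_mazur_embedding cX (powR_gt0 _ a0) (powR_gt0 _ b0) fab.
exists Z; apply: (le_lt_trans HZ); rewrite lte_fin.
have -> : (1 + s) `^ p^-1 / (1 - s) `^ p^-1 = ((1 + s) / (1 - s)) `^ p^-1.
  rewrite powRM ?invr_ge0 ?(ltW a0) ?(ltW b0)//; congr (_ * _).
  by rewrite -(powR_inv1 (ltW a0)) -powRrM mulN1r powRN.
have [r1 r2] := distortion_bounds e0.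
(* The distortion is a p-th root of a number that is at least 1, hence no larger than that
   number. *)
by apply: le_lt_trans (ler1_powR r1 _) r2; rewrite invf_le1.
Qed.

End almost_isometric_embedding.

Lemma isomorphic_lp_no_l2 (R : realType) (p : R) (p2 : 2 < p) (p1 : (1 <= p%:E)%E)
    (X : normedModType R) :
  (exists Y : closed_subspace (lp p1), isomorphic X Y) ->
  ~ exists Y : closed_subspace X, isomorphic Y (lp (@lee1n R 2)).
Proof.
move=> [Z [f [g [cf cg fg gf]]]] [Y [f' [g' [cf' cg' fg' gf']]]].
pose U (b : lp (@lee1n R 2)) : lp p1 := val (f (val (g' b))).
have U_linear : linear U.
  move=> a x y; rewrite /U linearP.
  have -> : val (a *: g' x + g' y) = a *: val (g' x) + val (g' y) by [].
  by rewrite linearP.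
pose U' : {linear lp (@lee1n R 2) -> lp p1} :=
  HB.pack U (GRing.isLinear.Build R (lp (@lee1n R 2)) (lp p1) _ U U_linear).
have [kf kf0 Hf] := linear_lipschitz cf.
have [kg kg0 Hg] := linear_lipschitz cg.
have [kf' kf'0 Hf'] := linear_lipschitz cf'.
have [kg' kg'0 Hg'] := linear_lipschitz cg'.
have A0 : 0 < kf * kg' by rewrite mulr_gt0.
have a0 : 0 < (kf' * kg)^-1 by rewrite invr_gt0 mulr_gt0.
apply: (@l2_no_embedding R p p2 p1 U' (kf' * kg)^-1 (kf * kg') a0 A0) => b.
  rewrite ler_pdivrMl ?mulr_gt0// -[b in `|b|]gf'.
  apply: (le_trans (Hf' _)); rewrite -mulrA ler_wpM2l ?(ltW kf'0)//.
  have -> : `|g' b| = `|val (g' b)| by [].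
  by rewrite -[val (g' b) in leLHS]fg; exact: Hg.
apply: (le_trans (Hf _)); rewrite -mulrA ler_wpM2l ?(ltW kf0)//.
exact: Hg'.
Qed.

Theorem corollary5p6 (R : realType) (K : pmetricType R)
    (K_compact : compact [set: K])
    (mu : probability (g_sigma_algebraType (@open K)) R)
    (mu_nonatomic : nonatomic mu)
    (p : R) (p_gt2 : 2 < p)
    (X : closed_subspace (Lp mu (gt2_ge1 p_gt2))) :
  [<-> ~ exists Y : closed_subspace X, isomorphic Y (lp (@lee1n R 2));
       exists Y : closed_subspace (lp (gt2_ge1 p_gt2)), isomorphic X Y;
       forall e : R, 0 < e ->
         exists X0 : closed_subspace (lp (gt2_ge1 p_gt2)),
           (banach_mazur X0 X < (1 + e)%:E)%E].
Proof.
have no_l2_embeds :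
    ~ (exists Y : closed_subspace X, isomorphic Y (lp (@lee1n R 2))) ->
    forall e : R, 0 < e -> exists X0 : closed_subspace (lp (gt2_ge1 p_gt2)),
      (banach_mazur X0 X < (1 + e)%:E)%E.
  by move=> /(no_l2_totally_bounded p_gt2)/(almost_isometric_embedding p_gt2).
have no_l2 := @isomorphic_lp_no_l2 R p p_gt2 (gt2_ge1 p_gt2) X.
(* (i) reaches (ii) through (iii) with e = 1; (ii) reaches (iii) through (i). *)
tfae.
- move=> /no_l2_embeds/(_ 1 ltr01)[X0 /banach_mazur_isomorphic XX0].
  by exists X0.
- by move=> /no_l2/no_l2_embeds.
- move=> /(_ 1 ltr01)[X0 /banach_mazur_isomorphic XX0].
  by apply: no_l2; exists X0.
Qed.
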